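(* Let $A$ be an integral domain with field of fractions $K$, and let $H=\bigoplus_{i\in\mathbb{Z}}H_i$ be a $\mathbb{Z}$-graded associative $A$-algebra, finitely generated and free as an $A$-module. Assume that $A$ is integrally closed in $K$ and let $\theta:A\to L$ be a ring homomorphism into a field $L$ such that $L$ is the field of fractions of $\theta(A)$. Let $\mathcal{O}\subseteq K$ be a valuation ring with maximal ideal $J(\mathcal{O})$ such that $A\subseteq\mathcal{O}$ and $J(\mathcal{O})\cap A=\operatorname{Ker}(\theta)$, let $k$ be the residue field of $\mathcal{O}$, and regard $L$ as a subfield of $k$. Assume that either (a) $LH$ is split, or (b) $L=k$ and $L$ is perfect. Then the following hold. (1) Modular reduction induces a (well-defined) $\mathbb{N}[q,q^{-1}]$-semigroup homomorphism $d^{\mathrm{gr}}_\theta:\mathcal{R}_0^+(KH)\to\mathcal{R}_0^+(LH)$ by setting $$d^{\mathrm{gr}}_\theta([K\otimes_{\mathcal{O}}\widetilde{V}]):=[k\otimes_{\mathcal{O}}\widetilde{V}],$$ where $\widetilde{V}$ is a graded $\mathcal{O}H$-lattice and $[k\otimes_{\mathcal{O}}\widetilde{V}]$ is regarded as an element of $\mathcal{R}_0^+(LH)$ via the identification of $\mathcal{R}_0^+(LH)$ with $\mathcal{R}_0^+(kH)$. (2) The image of $\mathfrak{p}_K$ is contained in $\operatorname{Maps}(H_0,A[X]^{\mathbb{Z}})$, and $$\mathfrak{p}_L\circ d^{\mathrm{gr}}_\theta=t_\theta\circ\mathfrak{p}_K$$ as maps $\mathcal{R}_0^+(KH)\to\operatorname{Maps}(H_0,L[X]^{\mathbb{Z}})$,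 where $t_\theta:\operatorname{Maps}(H_0,A[X]^{\mathbb{Z}})\to\operatorname{Maps}(H_0,L[X]^{\mathbb{Z}})$ is the natural map obtained by applying $\theta$ to the coefficients of the polynomials in $A[X]$. (3) The map $d^{\mathrm{gr}}_\theta$ is the unique map $\mathcal{R}_0^+(KH)\to\mathcal{R}_0^+(LH)$ satisfying the identity in (2); in particular, $d^{\mathrm{gr}}_\theta$ does not depend on the choice of $\mathcal{O}$.
   Context: Algebras and modules are unital. A $\mathbb{Z}$-grading on an algebra $H$ over a commutative ring $R$ is a decomposition $H=\bigoplus_{i\in\mathbb{Z}}H_i$ into $R$-submodules with $H_iH_j\subseteq H_{i+j}$ (so $H_0$ is a subalgebra). A graded $H$-module is an $H$-module $M=\bigoplus_i M_i$ ($R$-submodules) with $H_iM_j\subseteq M_{i+j}$. The shift $M\langle j\rangle$ is given by $M\langle j\rangle_i=M_{i-j}$. Morphisms of graded modules are module morphisms $f$ with $f(M_i)\subseteq N_i$ for all $i$. Modules over algebras over a field are finite-dimensional. Write $KH=K\otimes_A H$, $LH=L\otimes_A H$ ($L$ an $A$-module via $\theta$), $\mathcal{O}H=\mathcal{O}\otimes_A H$, $kH=k\otimes_{\mathcal{O}}\mathcal{O}H$, all graded by the corresponding extensions of the $H_i$. For a graded finite-dimensional algebra $\mathcal{H}$ over a field, $\mathcal{R}_0(\mathcal{H})$ is the Grothendieck group of finite-dimensional graded $\mathcal{H}$-modules, and $\mathcal{R}_0^+(\mathcal{H})$ is the subset of classes $[V]$ of graded modules $V$. With $q$ an indeterminate,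 $\mathbb{Z}[q,q^{-1}]$ acts on $\mathcal{R}_0(\mathcal{H})$ by $q^j[V]=[V\langle j\rangle]$. An $\mathbb{N}[q,q^{-1}]$-semigroup homomorphism is a semigroup homomorphism preserving the action of $\mathbb{N}[q,q^{-1}]$. An algebra over a field $F$ is split if every simple module has endomorphism ring $F$. A valuation ring $\mathcal{O}\subseteq K$ is a subring such that for all $0\neq x\in K$, $x\in\mathcal{O}$ or $x^{-1}\in\mathcal{O}$. A graded $\mathcal{O}H$-lattice is a graded $\mathcal{O}H$-module that is finitely generated and free over $\mathcal{O}$; every finite-dimensional graded $KH$-module is isomorphic, as a graded module, to $K\otimes_{\mathcal{O}}\widetilde{V}$ for some graded $\mathcal{O}H$-lattice $\widetilde{V}$. The $kH$-module $k\otimes_{\mathcal{O}}\widetilde{V}$ is the modular reduction of $\widetilde{V}$. Since the restriction to $A$ of $\mathcal{O}\to k$ has kernel $\operatorname{Ker}(\theta)$, $L$ is regarded as a subfield of $k$ via $\theta(a)\mapsto a+J(\mathcal{O})$. The identification of $\mathcal{R}_0(LH)$ with $\mathcal{R}_0(kH)$ is the map $[V]\mapsto[k\otimes_L V]$, which is an isomorphism preserving classes of simple graded modules when $LH$ is split (and is the identity when $L=k$). For $F\in\{K,L\}$, $X$ an indeterminate, and $\operatorname{Maps}(H_0,F[X]^{\mathbb{Z}})$ the set of maps from $H_0$ to $F[X]^{\mathbb{Z}}$, the map $\mathfrak{p}_F:\mathcal{R}_0^+(FH)\to\operatorname{Maps}(H_0,F[X]^{\mathbb{Z}})$ is defined,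 for a graded $FH$-module $V=\bigoplus_iV_i$ and $h_0\in H_0$, by $\mathfrak{p}_F([V])(h_0)=(\operatorname{Poly}(\rho_{V_i}(h_0)))_{i\in\mathbb{Z}}$, where $\rho_{V_i}$ is the representation of $FH_0$ on $V_i$ (evaluated at the image $1\otimes h_0$ of $h_0$ in $FH_0$) and $\operatorname{Poly}$ is the characteristic polynomial (equal to $1$ if $V_i=0$). *)

(* Defs.v *)
From HB Require Import structures.
From mathcomp Require Import all_boot all_algebra separable.
From mathcomp Require Import generic_quotient boolp classical_sets.

Set Implicit Arguments.
Unset Strict Implicit.
Unset Printing Implicit Defensive.

Import GRing.Theory.
Local Open Scope ring_scope.
Local Open Scope quotient_scope.
Local Open Scope classical_set_scope.

Section FreeAndGraded.
Variables (R : comNzRingType) (M : lmodType R).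

Definition is_submodule (U : set M) : Prop :=
  U 0 /\ forall (a : R) u v, U u -> U v -> U (a *: u + v).

Definition is_basis (U : set M) (n : nat) (e : 'I_n -> M) : Prop :=
  (forall i, U (e i)) /\
  forall v, U v -> exists! c : 'rV[R]_n, v = \sum_i c 0 i *: e i.

Definition finite_free : Prop :=
  exists (n : nat) (e : 'I_n -> M), is_basis setT e.

Definition is_finsum (c : int -> M) (v : M) : Prop :=
  exists s : seq int,
    [/\ uniq s, forall i, i \notin s -> c i = 0 & v = \sum_(i <- s) c i].

Definition direct_sum (g : int -> set M) : Prop :=
  (forall i, is_submodule (g i)) /\
  forall v, exists! c : int -> M, (forall i, g i (c i)) /\ is_finsum c v.

End FreeAndGraded.

Definition graded_algebra (R : comNzRingType) (B : algType R)
    (g : int -> set B) : Prop :=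
  direct_sum g /\
  forall i j b c, g i b -> g j c -> g (i + j) (b * c).

(* The tensor product of S and M over R, for f : R -> S: formal sums of pairs,
   two of them being identified when every R-balanced map into an abelian group
   takes the same value on them (see [tens_lift] for the universal property). *)
Section Tensor.
Variables (R S : comNzRingType) (f : {rmorphism R -> S}) (M : lmodType R).

Definition balanced (N : zmodType) (b : S -> M -> N) : Prop :=
  [/\ forall s s' m, b (s + s') m = b s m + b s' m,
      forall s m m', b s (m + m') = b s m + b s m' &
      forall s r m, b (s * f r) m = b s (r *: m)].

Definition ev (N : zmodType) (b : S -> M -> N) (t : seq (S * M)) : N :=
  \sum_(p <- t) b p.1 p.2.

Definition tens_eqv (t u : seq (S * M)) : bool :=
  `[< forall (N : zmodType) (b : S -> M -> N), balanced b -> ev b t = ev b u >].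

Lemma tens_eqv_equiv : equiv_class_of tens_eqv.
Proof.
split.
- by move=> t; apply/asboolP.
- by move=> t u; apply/asboolP/asboolP => h N b bb; rewrite h.
- move=> u t v /asboolP h1 /asboolP h2; apply/asboolP => N b bb.
  by rewrite h1 // h2.
Qed.
Canonical tens_eqv_rel := EquivRelPack tens_eqv_equiv.

Definition tens := {eq_quot tens_eqv}.
HB.instance Definition _ := Choice.on tens.
HB.instance Definition _ := EqQuotient.on tens.

Definition tev (N : zmodType) (b : S -> M -> N) (x : tens) : N := ev b (repr x).

Lemma tev_pi (N : zmodType) (b : S -> M -> N) (t : seq (S * M)) :
  balanced b -> tev b (\pi_tens t) = ev b t.
Proof.
move=> bb; rewrite /tev.
have /eqP : \pi_tens (repr (\pi_tens t)) = \pi_tens t by rewrite reprK.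
by rewrite eqmodE => /asboolP; exact.
Qed.

Lemma tensP (x y : tens) :
  (forall (N : zmodType) (b : S -> M -> N), balanced b -> tev b x = tev b y) ->
  x = y.
Proof.
move=> h; rewrite -[x]reprK -[y]reprK; apply/eqP; rewrite eqmodE.
by apply/asboolP => N b bb; exact: h.
Qed.

Lemma balanced0l (N : zmodType) (b : S -> M -> N) m : balanced b -> b 0 m = 0.
Proof. by case=> h _ _; apply: (addIr (b 0 m)); rewrite -h !add0r. Qed.

Lemma balanced0r (N : zmodType) (b : S -> M -> N) s : balanced b -> b s 0 = 0.
Proof. by case=> _ h _; apply: (addIr (b s 0)); rewrite -h !add0r. Qed.

Lemma balancedNl (N : zmodType) (b : S -> M -> N) s m :
  balanced b -> b (- s) m = - b s m.
Proof.
move=> bb; apply: (addIr (b s m)); rewrite addNr.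
by case: (bb) => <- _ _; rewrite addNr balanced0l.
Qed.

Definition pure (s : S) (m : M) : tens := \pi_tens [:: (s, m)].
Definition tens_zero : tens := \pi_tens [::].
Definition tens_add (x y : tens) : tens := \pi_tens (repr x ++ repr y).
Definition tens_scale (c : S) (x : tens) : tens :=
  \pi_tens [seq (c * p.1, p.2) | p <- repr x].
Definition tens_opp (x : tens) : tens := tens_scale (- 1) x.

Lemma tev_pure (N : zmodType) (b : S -> M -> N) s m :
  balanced b -> tev b (pure s m) = b s m.
Proof. by move=> bb; rewrite tev_pi // /ev big_seq1. Qed.

Lemma tev_zero (N : zmodType) (b : S -> M -> N) :
  balanced b -> tev b tens_zero = 0.
Proof. by move=> bb; rewrite tev_pi // /ev big_nil. Qed.

Lemma tev_add (N : zmodType) (b : S -> M -> N) x y :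
  balanced b -> tev b (tens_add x y) = tev b x + tev b y.
Proof. by move=> bb; rewrite tev_pi // /ev big_cat. Qed.

Lemma balanced_scale (N : zmodType) (b : S -> M -> N) c :
  balanced b -> balanced (fun s => b (c * s)).
Proof.
case=> h1 h2 h3; split=> [s s' m|s m m'|s r m].
- by rewrite mulrDr h1.
- by rewrite h2.
- by rewrite mulrA h3.
Qed.

Lemma tev_scale (N : zmodType) (b : S -> M -> N) c x :
  balanced b -> tev b (tens_scale c x) = tev (fun s => b (c * s)) x.
Proof. by move=> bb; rewrite tev_pi // /ev big_map. Qed.

Lemma tev_opp (N : zmodType) (b : S -> M -> N) x :
  balanced b -> tev b (tens_opp x) = - tev b x.
Proof.
move=> bb; rewrite tev_scale // /tev /ev -sumrN; apply: eq_bigr => p _.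
by rewrite mulN1r balancedNl.
Qed.

Lemma tens_addA : associative tens_add.
Proof. by move=> x y z; apply: tensP => N b bb; rewrite !tev_add ?addrA. Qed.
Lemma tens_addC : commutative tens_add.
Proof. by move=> x y; apply: tensP => N b bb; rewrite !tev_add // addrC. Qed.
Lemma tens_add0 : left_id tens_zero tens_add.
Proof.
by move=> x; apply: tensP => N b bb; rewrite tev_add // tev_zero // add0r.
Qed.
Lemma tens_addN : left_inverse tens_zero tens_opp tens_add.
Proof.
move=> x; apply: tensP => N b bb.
by rewrite tev_add // tev_opp // tev_zero // addNr.
Qed.

HB.instance Definition _ :=
  GRing.isZmodule.Build tens tens_addA tens_addC tens_add0 tens_addN.

Lemma tevD (N : zmodType) (b : S -> M -> N) (x y : tens) :
  balanced b -> tev b (x + y) = tev b x + tev b y.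
Proof. exact: tev_add. Qed.
Lemma tev0 (N : zmodType) (b : S -> M -> N) : balanced b -> tev b 0 = 0.
Proof. exact: tev_zero. Qed.

Lemma tev_sum (N : zmodType) (b : S -> M -> N) I (r : seq I) (F : I -> tens) :
  balanced b -> tev b (\sum_(i <- r) F i) = \sum_(i <- r) tev b (F i).
Proof.
move=> bb; elim: r => [|i r IH]; first by rewrite !big_nil tev0.
by rewrite !big_cons tevD // IH.
Qed.

Lemma tens_scaleA a b x : tens_scale a (tens_scale b x) = tens_scale (a * b) x.
Proof.
apply: tensP => N c cb.
rewrite !tev_scale //; last exact: balanced_scale.
by congr (tev _ x); apply/funext => s; rewrite mulrA.
Qed.
Lemma tens_scale1 : left_id 1 tens_scale.
Proof.
move=> x; apply: tensP => N b bb; rewrite tev_scale //.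
by congr (tev _ x); apply/funext => s; rewrite mul1r.
Qed.
Lemma tens_scaleDr : right_distributive tens_scale +%R.
Proof.
move=> a x y; apply: tensP => N b bb.
by rewrite tev_scale // !tevD ?tev_scale //; exact: balanced_scale.
Qed.
Lemma tens_scaleDl x : {morph tens_scale^~ x : a b / a + b}.
Proof.
move=> a b; apply: tensP => N c cb.
rewrite tevD // !tev_scale // /tev /ev -big_split; apply: eq_bigr => p _ /=.
by case: cb => h _ _; rewrite mulrDl h.
Qed.

HB.instance Definition _ := GRing.Zmodule_isLmodule.Build S tens
  tens_scaleA tens_scale1 tens_scaleDr tens_scaleDl.

Lemma tevZ (N : zmodType) (b : S -> M -> N) c (x : tens) :
  balanced b -> tev b (c *: x) = tev (fun s => b (c * s)) x.
Proof. exact: tev_scale. Qed.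

Lemma pure_balanced : balanced pure.
Proof.
by split=> *; apply: tensP => N b bb; rewrite ?tevD ?tev_pure //; case: bb.
Qed.

Lemma scale_pure c s m : c *: pure s m = pure (c * s) m.
Proof.
apply: tensP => N b bb; rewrite tevZ // !tev_pure //.
exact: balanced_scale.
Qed.

Lemma tensE (x : tens) : x = \sum_(p <- repr x) pure p.1 p.2.
Proof.
apply: tensP => N b bb; rewrite tev_sum //.
by apply: eq_bigr => p _; rewrite tev_pure.
Qed.

Definition tens_lift (N : lmodType S) (g : M -> N) (x : tens) : N :=
  tev (fun s m => s *: g m) x.

Lemma tens_lift_balanced (N : lmodType S) (g : M -> N) :
  (forall u v, g (u + v) = g u + g v) ->
  (forall r u, g (r *: u) = f r *: g u) ->
  balanced (fun s m => s *: g m).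
Proof.
move=> gD gZ; split=> [s s' m|s m m'|s r m].
- by rewrite scalerDl.
- by rewrite gD scalerDr.
- by rewrite gZ scalerA.
Qed.

Lemma tens_liftP (N : lmodType S) (g : M -> N) :
  (forall u v, g (u + v) = g u + g v) ->
  (forall r u, g (r *: u) = f r *: g u) ->
  [/\ linear (tens_lift g), forall m, tens_lift g (pure 1 m) = g m &
      forall h : tens -> N, linear h -> (forall m, h (pure 1 m) = g m) ->
        h =1 tens_lift g].
Proof.
move=> gD gZ; have bb := tens_lift_balanced gD gZ; split.
- move=> a x y; rewrite /tens_lift tevD // tevZ //; congr (_ + _).
  rewrite /tev /ev scaler_sumr; apply: eq_bigr => p _.
  by rewrite scalerA.
- by move=> m; rewrite /tens_lift tev_pure // scale1r.
- move=> h hlin hg x.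
  have h0 : h 0 = 0 by have := hlin (- 1) 0 0; rewrite !scaleN1r !addNr.
  rewrite [x in LHS]tensE /tens_lift /tev /ev.
  elim: (repr x) => [|p r IH]; first by rewrite !big_nil.
  rewrite !big_cons -IH -[p.1]mulr1 -scale_pure hlin hg mulr1 //.
Qed.

(* The S-submodule of the tensor product spanned by the image of U. *)
Definition tens_span (U : set M) : set tens :=
  [set x | exists t : seq (S * M),
     (forall p, p \in t -> U p.2) /\ x = \sum_(p <- t) pure p.1 p.2].

Lemma tens_span_sub (U : set M) : is_submodule (tens_span U).
Proof.
split; first by exists [::]; split => //; rewrite big_nil.
move=> a x y [t [ht ->]] [u [hu ->]].
exists ([seq (a * p.1, p.2) | p <- t] ++ u); split.
  move=> p; rewrite mem_cat => /orP[/mapP[q qt ->]|]; first exact: (ht _ qt).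
  exact: hu.
rewrite big_cat big_map scaler_sumr /=; congr (_ + _).
by apply: eq_bigr => p _; rewrite scale_pure.
Qed.

End Tensor.

Arguments pure {R S} f {M} s m.
Arguments tens_span {R S} f {M} U.
Arguments balanced {R S} f {M N} b.

Section ScalarExtension.
Variables (R S : comNzRingType) (f : {rmorphism R -> S}) (H : algType R).

Let T := tens f H.

Definition tens_one : T := pure f 1 1.
Definition tens_mul (x y : T) : T :=
  \pi_T [seq (p.1 * q.1, p.2 * q.2) | p <- repr x, q <- repr y].

Lemma balanced_mulr (N : zmodType) (b : S -> H -> N) s h :
  balanced f b -> balanced f (fun s' h' => b (s * s') (h * h')).
Proof.
case=> h1 h2 h3; split=> [u u' m|u m m'|u r m].
- by rewrite mulrDr h1.
- by rewrite mulrDr h2.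
- by rewrite mulrA h3 scalerAr.
Qed.

Lemma balanced_mull (N : zmodType) (b : S -> H -> N) (y : T) :
  balanced f b ->
  balanced f (fun s h => tev (fun s' h' => b (s * s') (h * h')) y).
Proof.
case=> h1 h2 h3; split=> [u u' m|u m m'|u r m]; rewrite /tev /ev.
- by rewrite -big_split; apply: eq_bigr => p _; rewrite mulrDl h1.
- by rewrite -big_split; apply: eq_bigr => p _; rewrite mulrDl h2.
- apply: eq_bigr => p _.
  by rewrite -mulrA [f r * _]mulrC mulrA h3 scalerAl.
Qed.

Lemma tevM (N : zmodType) (b : S -> H -> N) (x y : T) : balanced f b ->
  tev b (tens_mul x y) =
  tev (fun s h => tev (fun s' h' => b (s * s') (h * h')) y) x.
Proof.
move=> bb; rewrite tev_pi // /ev big_allpairs_dep.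
by rewrite /tev /ev; apply: eq_bigr.
Qed.

Lemma tens_mulA : associative tens_mul.
Proof.
move=> x y z; apply: tensP => N b bb.
rewrite !tevM //; last exact: balanced_mull.
rewrite /tev /ev; apply: eq_bigr => p _.
have := tevM y z (balanced_mulr p.1 p.2 bb); rewrite /tev /ev => ->.
by apply: eq_bigr => q _; apply: eq_bigr => r _; rewrite !mulrA.
Qed.
Lemma tens_mul1 : left_id tens_one tens_mul.
Proof.
move=> x; apply: tensP => N b bb.
rewrite tevM // tev_pure; last exact: balanced_mull.
by rewrite /tev /ev; apply: eq_bigr => p _; rewrite !mul1r.
Qed.
Lemma tens_mulr1 : right_id tens_one tens_mul.
Proof.
move=> x; apply: tensP => N b bb; rewrite tevM //.
rewrite {1}/tev /ev; apply: eq_bigr => p _.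
by rewrite tev_pure ?mulr1 //; exact: balanced_mulr.
Qed.
Lemma tens_mulDl : left_distributive tens_mul +%R.
Proof.
move=> x y z; apply: tensP => N b bb.
by rewrite !(tevM, tevD) //; exact: balanced_mull.
Qed.
Lemma tens_mulDr : right_distributive tens_mul +%R.
Proof.
move=> x y z; apply: tensP => N b bb.
rewrite !(tevM, tevD) // /tev /ev -big_split; apply: eq_bigr => p _ /=.
exact: (tevD y z (balanced_mulr p.1 p.2 bb)).
Qed.

HB.instance Definition _ := GRing.Zmodule_isPzRing.Build (tens f H)
  tens_mulA tens_mul1 tens_mulr1 tens_mulDl tens_mulDr.

Lemma tens_scalerAl (a : S) (x y : T) : a *: (x * y) = (a *: x) * y.
Proof.
apply: tensP => N b bb.
rewrite tevZ // tevM; last exact: balanced_scale.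
rewrite tevM // tevZ; last exact: balanced_mull.
rewrite /tev /ev; apply: eq_bigr => p _; apply: eq_bigr => q _.
by rewrite mulrA.
Qed.
Lemma tens_scalerAr (a : S) (x y : T) : a *: (x * y) = x * (a *: y).
Proof.
apply: tensP => N b bb.
rewrite tevZ // tevM; last exact: balanced_scale.
rewrite tevM //; rewrite {1 3}/tev /ev; apply: eq_bigr => p _.
rewrite tevZ; last exact: balanced_mulr.
by rewrite /tev /ev; apply: eq_bigr => q _; rewrite mulrCA.
Qed.

Lemma pureM s h s' h' : pure f s h * pure f s' h' = pure f (s * s') (h * h') :> T.
Proof.
apply: tensP => N b bb; rewrite tevM // !tev_pure //; first exact: balanced_mulr.
exact: balanced_mull.
Qed.

End ScalarExtension.

Section StructureMap.
Variables (R S : comNzRingType) (f : {rmorphism R -> S}) (H : algType R).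

Definition tens_in (s : S) : tens f H := pure f s 1.

Lemma tens_in_zmod_morphism : zmod_morphism tens_in.
Proof.
move=> s s'; apply: tensP => N b bb; rewrite tevD // -scaleN1r tevZ //.
have bN : balanced f (fun s => b (-1 * s)) by exact: balanced_scale.
by rewrite !tev_pure // mulN1r; case: bb => <-.
Qed.

Lemma tens_in_monoid_morphism : monoid_morphism tens_in.
Proof. by split=> // s s'; rewrite /tens_in pureM mulr1. Qed.

HB.instance Definition _ := GRing.isZmodMorphism.Build S (tens f H) tens_in
  tens_in_zmod_morphism.
HB.instance Definition _ := GRing.isMonoidMorphism.Build S (tens f H) tens_in
  tens_in_monoid_morphism.

Lemma tens_inE s : tens_in s = s *: (1 : tens f H).
Proof. by rewrite [in RHS]/GRing.one /= scale_pure mulr1. Qed.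

End StructureMap.

(* An R-algebra is given here as a ring B with its structure map R -> B, which
   unlike [algType R] allows B to be zero.  Modules over it are R-modules with
   an R-bilinear unital action, required to be free of finite rank over R: over
   a field these are the finite-dimensional modules, in general the lattices. *)
Section Modules.
Variables (R : comNzRingType) (B : pzRingType) (eta : {rmorphism R -> B}).

Record is_action (V : lmodType R) (act : B -> V -> V) : Prop := IsAction {
  actDl : forall b c v, act (b + c) v = act b v + act c v;
  actL : forall b, linear (act b);
  act1 : forall v, act 1 v = v;
  actM : forall b c v, act (b * c) v = act b (act c v);
  actZ : forall a v, act (eta a) v = a *: v }.

Record fmod := FMod {
  fmod_car :> lmodType R;
  act : B -> fmod_car -> fmod_car;
  actP : is_action act;
  fmod_free : finite_free fmod_car }.

Definition is_endo (V : fmod) (phi : V -> V) : Prop :=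
  linear phi /\ forall b v, phi (act b v) = act b (phi v).

Definition is_simple (V : fmod) : Prop :=
  (exists v : V, v <> 0) /\
  forall U : set V, is_submodule U -> (forall b v, U v -> U (act b v)) ->
    U = [set 0] \/ U = setT.

Definition split_algebra : Prop :=
  forall V : fmod, is_simple V ->
  forall phi : V -> V, is_endo phi -> exists a : R, forall v, phi v = a *: v.

Variable g : int -> set B.

Record gmod := GMod {
  gmod_fmod :> fmod;
  deg : int -> set gmod_fmod;
  deg_sum : direct_sum deg;
  deg_act : forall i j b v, g i b -> deg j v -> deg (i + j) (act b v) }.

Definition is_gmor (V W : gmod) (phi : V -> W) : Prop :=
  [/\ linear phi, forall b v, phi (act b v) = act b (phi v) &
      forall i v, deg i v -> deg i (phi v)].

Definition short_exact (V' V V'' : gmod) : Prop :=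
  exists (alpha : V' -> V) (beta : V -> V''),
    [/\ is_gmor alpha, is_gmor beta, injective alpha,
        forall w, exists v, beta v = w &
        forall v, beta v = 0 <-> exists u, alpha u = v].

End Modules.

Section FreeLemmas.
Variable R : comNzRingType.

Lemma finsum_widen (M : lmodType R) (c : int -> M) (s t : seq int) :
  uniq s -> uniq t -> {subset s <= t} -> (forall i, i \notin s -> c i = 0) ->
  \sum_(i <- t) c i = \sum_(i <- s) c i.
Proof.
move=> us ut st c0; rewrite (bigID (mem s)) /= [X in _ + X]big1 => [|i]; last exact: c0.
rewrite addr0 -big_filter; apply: perm_big; apply: uniq_perm => //.
  exact: filter_uniq.
by move=> i; rewrite mem_filter; case: (boolP (i \in s)) => //= /st ->.
Qed.

Lemma is_finsumP (M : lmodType R) (c : int -> M) (v : M) (t : seq int) :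
  uniq t -> (forall i, i \notin t -> c i = 0) -> is_finsum c v ->
  v = \sum_(i <- t) c i.
Proof.
move=> ut ct [s [us cs ->]].
rewrite -(@finsum_widen M c s (undup (s ++ t))) ?undup_uniq //; last first.
  by move=> i; rewrite mem_undup mem_cat => ->.
apply: finsum_widen; rewrite ?undup_uniq // => i.
by rewrite mem_undup mem_cat => ->; rewrite orbT.
Qed.

Lemma finsum_lin (M N : lmodType R) (h : M -> N) (a : R) (c e : int -> M) v w :
  (forall u u', h (u + u') = h u + h u') -> h 0 = 0 ->
  is_finsum c v -> is_finsum e w ->
  is_finsum (fun i => h (a *: c i + e i)) (h (a *: v + w)).
Proof.
move=> hD h0 fc fe; have [s [us cs _]] := fc; have [t [ut et _]] := fe.
exists (undup (s ++ t)); split; first exact: undup_uniq.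
  move=> i; rewrite mem_undup mem_cat negb_or => /andP[/cs -> /et ->].
  by rewrite scaler0 addr0.
rewrite (is_finsumP (undup_uniq (s ++ t)) _ fc); last first.
  by move=> i; rewrite mem_undup mem_cat negb_or => /andP[/cs ->].
rewrite (is_finsumP (undup_uniq (s ++ t)) _ fe); last first.
  by move=> i; rewrite mem_undup mem_cat negb_or => /andP[_ /et ->].
by rewrite scaler_sumr -big_split /= (big_morph h hD h0).
Qed.

Lemma direct_sum_proj (M : lmodType R) (g : int -> set M) : direct_sum g ->
  exists p : int -> M -> M,
    [/\ forall i, linear (p i), forall v, is_finsum (p^~ v) v,
        forall i v, g i (p i v) &
        forall i j v, g j v -> p i v = if i == j then v else 0].
Proof.
move=> [gs gd]; pose P v := cid (gd v); pose p i v := sval (P v) i.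
have pP v : ((forall i, g i (p i v)) /\ is_finsum (p^~ v) v).
  by rewrite /p; case: (P v) => c /= [].
have pU v c : (forall i, g i (c i)) -> is_finsum c v -> p^~ v = c.
  by move=> gc fc; rewrite /p; case: (P v) => c' /= [_]; apply.
exists p; split.
- move=> i a u v.
  suff E : p^~ (a *: u + v) = fun i => a *: p i u + p i v.
    exact: (congr1 (fun F => F i) E).
  apply: pU; first by move=> j; apply: (gs j).2; case: (pP u); case: (pP v).
  by apply: (@finsum_lin _ _ id) => //; [case: (pP u)|case: (pP v)].
- by move=> v; case: (pP v).
- by move=> i v; case: (pP v).
- move=> i j v gv.
  suff E : p^~ v = fun i => if i == j then v else 0.
    exact: (congr1 (fun F => F i) E).
  apply: pU.
    by move=> k; case: eqP => [->|_] //; case: (gs k).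
  exists [:: j]; split=> //; last by rewrite big_seq1 eqxx.
  by move=> k; rewrite inE => /negbTE ->.
Qed.

Lemma direct_sum_intro (M : lmodType R) (g : int -> set M) (p : int -> M -> M) :
  (forall i, is_submodule (g i)) ->
  (forall i u v, p i (u + v) = p i u + p i v) ->
  (forall v, is_finsum (p^~ v) v) -> (forall i v, g i (p i v)) ->
  (forall i j v, g j v -> p i v = if i == j then v else 0) ->
  direct_sum g.
Proof.
move=> gs pD pS gp pg; split=> // v; exists (p^~ v); split; first by split.
move=> c [gc [s [us cs ->]]]; apply/funext => i.
have p0 : p i 0 = 0 by apply: (addIr (p i 0)); rewrite -pD !add0r.
rewrite (big_morph (p i) (pD i) p0).
have -> : \sum_(j <- s) p i (c j) = \sum_(j <- s) if j == i then c i else 0.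
  apply: eq_bigr => j _; rewrite (pg i j (c j)) // eq_sym.
  by case: eqP => [->|].
rewrite -big_mkcond /=; case: (boolP (i \in s)) => [si|/[dup] si /cs ->].
  rewrite -big_filter (_ : filter _ _ = [:: i]) ?big_seq1 //.
  by rewrite filter_pred1_uniq.
by rewrite big1.
Qed.

Lemma is_basis_coord (M : lmodType R) n (e : 'I_n -> M) : is_basis setT e ->
  exists x : M -> 'rV[R]_n, linear x /\
    (forall v, v = \sum_i x v 0 i *: e i) /\
    forall c : 'rV_n, x (\sum_i c 0 i *: e i) = c.
Proof.
move=> [_ h]; pose P v := cid (h v I); pose x v := sval (P v).
have xE v : v = \sum_i x v 0 i *: e i by rewrite /x; case: (P v) => c [].
have xU (c : 'rV_n) : x (\sum_i c 0 i *: e i) = c.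
  by rewrite /x; case: (P _) => c' /= [_]; apply.
exists x; split=> //; move=> a u v.
rewrite -[RHS]xU {1}[u]xE {1}[v]xE; congr x.
rewrite scaler_sumr -big_split; apply: eq_bigr => i _ /=.
by rewrite !mxE scalerDl scalerA.
Qed.

End FreeLemmas.

Section GradedConstructions.
Variables (R : comNzRingType) (B : pzRingType) (eta : {rmorphism R -> B}).
Variable g : int -> set B.
Implicit Types V W : gmod eta g.

Lemma shift_sum (V : gmod eta g) (j : int) :
  direct_sum (fun i => deg (i - j) : set V).
Proof.
have [p [pl pS pg pd]] := direct_sum_proj (deg_sum V).
apply: (@direct_sum_intro _ _ _ (fun i => p (i - j))).
- by move=> i; exact: (deg_sum V).1.
- by move=> i u v; have := pl (i - j) 1 u v; rewrite !scale1r.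
- move=> v; have [s [us ps E]] := pS v; exists (map (+%R^~ j) s); split.
  + by rewrite map_inj_uniq //; exact: addIr.
  + move=> i Hi; apply: ps; apply: contra Hi => /(map_f (+%R^~ j)).
    by rewrite subrK.
  + by rewrite big_map {1}E; apply: eq_bigr => i _; rewrite addrK.
- by move=> i v; exact: pg.
- by move=> i k v /pd ->; rewrite (inj_eq (addIr _)).
Qed.

Lemma shift_act (V : gmod eta g) (k : int) i j b (v : V) :
  g i b -> deg (j - k) v -> deg (i + j - k) (act b v).
Proof. by rewrite -addrA; exact: deg_act. Qed.

Definition gshift (j : int) (V : gmod eta g) : gmod eta g :=
  GMod (shift_sum V j) (@shift_act V j).

Definition prod_act V W (b : B) (x : V * W) : V * W :=
  (act b x.1, act b x.2).

Lemma prod_action V W : is_action eta (@prod_act V W).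
Proof.
have [h1 h2 h3 h4 h5] := actP V; have [k1 k2 k3 k4 k5] := actP W.
split.
- by move=> b c [v w]; rewrite /prod_act /= h1 k1.
- by move=> b a [v w] [v' w']; rewrite /prod_act /= h2 k2.
- by move=> [v w]; rewrite /prod_act /= h3 k3.
- by move=> b c [v w]; rewrite /prod_act /= h4 k4.
- by move=> a [v w]; rewrite /prod_act /= h5 k5.
Qed.

Lemma prod_free V W : finite_free (V * W : lmodType R)%type.
Proof.
have [m [e he]] := fmod_free V; have [n [d hd]] := fmod_free W.
have [x [_ [xE xU]]] := is_basis_coord he.
have [y [_ [yE yU]]] := is_basis_coord hd.
pose b (k : 'I_(m + n)) : V * W :=
  match split k with inl i => (e i, 0) | inr i => (0, d i) end.
have bE (c : 'rV_(m + n)) : \sum_i c 0 i *: b i =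
    (\sum_i lsubmx c 0 i *: e i, \sum_i rsubmx c 0 i *: d i).
  have bl i : b (lshift n i) = (e i, 0).
    by rewrite /b -[lshift n i]/(unsplit (inl i)) unsplitK.
  have br i : b (rshift m i) = (0, d i).
    by rewrite /b -[rshift m i]/(unsplit (inr i)) unsplitK.
  have pZ (a : R) (u : V) (w : W) : a *: (u, w) = (a *: u, a *: w) by [].
  rewrite big_split_ord /=.
  transitivity (\sum_i (lsubmx c 0 i *: e i, 0 : W) +
                \sum_i (0 : V, rsubmx c 0 i *: d i)).
    by congr (_ + _); apply: eq_bigr => i _; rewrite ?bl ?br pZ scaler0 mxE.
  have pD (u u' : V) (w w' : W) : (u, w) + (u', w') = (u + u', w + w') by [].
  have E1 r (F : 'I_r -> V) : \sum_i (F i, 0 : W) = (\sum_i F i, 0).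
    elim: (index_enum _) => [|i r' IH]; first by rewrite !big_nil.
    by rewrite !big_cons IH pD addr0.
  have E2 r (F : 'I_r -> W) : \sum_i (0 : V, F i) = (0, \sum_i F i).
    elim: (index_enum _) => [|i r' IH]; first by rewrite !big_nil.
    by rewrite !big_cons IH pD addr0.
  by rewrite E1 E2 pD addr0 add0r.
exists (m + n)%N, b; split=> // -[v w] _.
exists (row_mx (x v) (y w)); split.
  by rewrite bE row_mxKl row_mxKr -xE -yE.
move=> c; rewrite bE => -[-> ->].
by rewrite xU yU hsubmxK.
Qed.

Lemma prod_sum V W :
  direct_sum (fun i => [set x | deg i x.1 /\ deg i x.2] : set (V * W)).
Proof.
have [p [pl pS pg pd]] := direct_sum_proj (deg_sum V).
have [q [ql qS qg qd]] := direct_sum_proj (deg_sum W).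
apply: (@direct_sum_intro _ _ _ (fun i x => (p i x.1, q i x.2))).
- move=> i; have [h1 h2] := (deg_sum V).1 i; have [k1 k2] := (deg_sum W).1 i.
  split; first by split.
  by move=> a [v w] [v' w'] /= [? ?] [? ?]; split; [exact: h2|exact: k2].
- move=> i [v w] [v' w'] /=.
  have := pl i 1 v v'; have := ql i 1 w w'; rewrite !scale1r => -> -> //.
- move=> [v w] /=; have [s [us ps Es]] := pS v; have [t [ut qt Et]] := qS w.
  exists (undup (s ++ t)); split; first exact: undup_uniq.
    by move=> i; rewrite mem_undup mem_cat negb_or => /andP[/ps -> /qt ->].
  have Ev : v = \sum_(i <- undup (s ++ t)) p i v.
    apply: is_finsumP; rewrite ?undup_uniq //.
    by move=> i; rewrite mem_undup mem_cat negb_or => /andP[/ps ->].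
  have Ew : w = \sum_(i <- undup (s ++ t)) q i w.
    apply: is_finsumP; rewrite ?undup_uniq //.
    by move=> i; rewrite mem_undup mem_cat negb_or => /andP[_ /qt ->].
  rewrite {1}Ev {1}Ew.
  elim: (undup _) => [|i r IH]; first by rewrite !big_nil.
  by rewrite !big_cons -IH.
- by move=> i [v w]; split; [exact: pg|exact: qg].
- by move=> i j [v w] [/= /pd -> /qd ->]; case: eqP.
Qed.

Lemma prod_deg_act V W i j b (x : V * W) :
  g i b -> deg j x.1 /\ deg j x.2 ->
  deg (i + j) (prod_act b x).1 /\ deg (i + j) (prod_act b x).2.
Proof. by move=> gb [? ?]; split; exact: deg_act. Qed.

Definition gprod V W : gmod eta g :=
  @GMod _ _ eta g (FMod (prod_action V W) (prod_free V W)) _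
    (prod_sum V W) (@prod_deg_act V W).

Let Z : lmodType R := 'rV[R]_0.
Definition zero_act (b : B) (v : Z) : Z := v.

Lemma zero_eq (u v : Z) : u = v.
Proof. by apply/matrixP => i []. Qed.
Lemma zero_action : is_action eta zero_act.
Proof. by split=> [b c v|b a u v|v|b c v|a v]; exact: zero_eq. Qed.
Lemma zero_free : finite_free Z.
Proof.
exists 0%N, (fun=> 0); split=> // v _; exists 0.
by split=> [|c _]; exact: zero_eq.
Qed.
Lemma zero_sum : direct_sum (fun _ => setT : set Z).
Proof.
split=> // v; exists (fun=> 0); split.
  by split=> //; exists [::]; split=> //; exact: zero_eq.
by move=> c _; apply/funext => i; exact: zero_eq.
Qed.
Definition gzero : gmod eta g :=
  @GMod _ _ eta g (FMod zero_action zero_free) _ zero_sum (fun _ _ _ _ _ _ => I).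

End GradedConstructions.

Definition ext_grading (R S : comNzRingType) (f : {rmorphism R -> S})
    (H : algType R) (Hg : int -> set H) : int -> set (tens f H) :=
  fun i => tens_span f (Hg i).
Arguments ext_grading {R S} f {H} Hg.

(* For f : R -> S and g : S -> S' with composite f', and a graded module V over
   S (x)_R H, the tensor product S' (x)_S V is a graded module over S' (x)_R H,
   where (s' (x) h) (t (x) v) = s' t (x) (1 (x) h) v. *)
Section BaseChange.
Variables (R S S' : comNzRingType) (f : {rmorphism R -> S}).
Variables (f' : {rmorphism R -> S'}) (g : {rmorphism S -> S'}).
Hypothesis gf : forall r, g (f r) = f' r.
Variables (H : algType R) (Hg : int -> set H).
Variable V : gmod (tens_in f H) (ext_grading f Hg).

Definition bc_elt (s' : S') (h : H) (t : S') (v : V) : tens g V :=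
  pure g (s' * t) (act (pure f 1 h) v).

Definition bc_act (x : tens f' H) (w : tens g V) : tens g V :=
  tev (fun s' h => tev (bc_elt s' h) w) x.

Let actD (b : tens f H) (u v : V) : act b (u + v) = act b u + act b v.
Proof. by have := actL (actP V) b 1 u v; rewrite !scale1r. Qed.
Let act0 (b : tens f H) : act b (0 : V) = 0.
Proof. by apply: (addIr (act b (0 : V))); rewrite -actD !add0r. Qed.
Let actZr (b : tens f H) (a : S) (v : V) : act b (a *: v) = a *: act b v.
Proof. by have := actL (actP V) b a v 0; rewrite act0 !addr0. Qed.
Let pureDl (s t : S') (v : V) : pure g (s + t) v = pure g s v + pure g t v.
Proof. by case: (pure_balanced g V). Qed.
Let pureDr (s : S') (u v : V) : pure g s (u + v) = pure g s u + pure g s v.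
Proof. by case: (pure_balanced g V). Qed.
Let pureZ (s : S') (a : S) (v : V) : pure g (s * g a) v = pure g s (a *: v).
Proof. by case: (pure_balanced g V). Qed.

Lemma bc_elt_balanced s' h : balanced g (bc_elt s' h).
Proof.
split=> [t t' v|t v v'|t r v]; rewrite /bc_elt.
- by rewrite mulrDr pureDl.
- by rewrite actD pureDr.
- by rewrite mulrA pureZ actZr.
Qed.

Lemma bc_balanced (w : tens g V) : balanced f' (fun s' h => tev (bc_elt s' h) w).
Proof.
split=> [s s' h|s h h'|s r h]; rewrite /tev /ev.
- by rewrite -big_split; apply: eq_bigr => p _; rewrite /bc_elt mulrDl pureDl.
- rewrite -big_split; apply: eq_bigr => p _ /=; rewrite /bc_elt -pureDr -(actDl (actP V)).
  by case: (pure_balanced f H) => _ -> _.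
- apply: eq_bigr => p _; rewrite /bc_elt.
  case: (pure_balanced f H) => _ _ <-; rewrite mul1r.
  have -> : pure f (f r) h = tens_in f H (f r) * pure f 1 h.
    by rewrite pureM mulr1 mul1r.
  rewrite (actM (actP V)) (actZ (actP V)) -pureZ gf.
  by rewrite -!mulrA [f' r * _]mulrC.
Qed.

Lemma bc_actE (x : tens f' H) (w : tens g V) :
  bc_act x w = \sum_(p <- repr x) tev (bc_elt p.1 p.2) w.
Proof. by []. Qed.

Lemma tev_bc_eltE s' h (w : tens g V) :
  tev (bc_elt s' h) w = \sum_(q <- repr w) bc_elt s' h q.1 q.2.
Proof. by []. Qed.

Lemma bc_action : is_action (tens_in f' H) bc_act.
Proof.
split.
- by move=> b c w; exact: (tevD b c (bc_balanced w)).
- move=> b a u v; rewrite !bc_actE scaler_sumr -big_split /=.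
  apply: eq_bigr => p _; have bb := bc_elt_balanced p.1 p.2.
  rewrite tevD // tevZ //; congr (_ + _); rewrite tev_bc_eltE scaler_sumr.
  by apply: eq_bigr => q _; rewrite /bc_elt scale_pure mulrCA.
- move=> v; rewrite /bc_act tev_pure; last exact: bc_balanced.
  rewrite [RHS]tensE tev_bc_eltE; apply: eq_bigr => p _.
  by rewrite /bc_elt mul1r (act1 (actP V)).
- move=> b c v; rewrite {1}/bc_act [LHS]tevM; last exact: bc_balanced.
  rewrite bc_actE [LHS]/tev /ev; apply: eq_bigr => p _.
  rewrite bc_actE tev_sum; last exact: bc_elt_balanced.
  rewrite /tev /ev -/(ev _ _); apply: eq_bigr => q _.
  rewrite -[LHS]/(tev (bc_elt (p.1 * q.1) (p.2 * q.2)) v).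
  rewrite -[RHS]/(tev (bc_elt p.1 p.2) (tev (bc_elt q.1 q.2) v)).
  rewrite [tev (bc_elt q.1 q.2) v]tev_bc_eltE tev_sum; last exact: bc_elt_balanced.
  rewrite tev_bc_eltE.
  apply: eq_bigr => r _; rewrite tev_pure; last exact: bc_elt_balanced.
  by rewrite /bc_elt -(actM (actP V)) pureM mulr1 mulrA.
- move=> a v; rewrite /bc_act tev_pure; last exact: bc_balanced.
  rewrite [in RHS](tensE v) scaler_sumr tev_bc_eltE; apply: eq_bigr => p _.
  by rewrite /bc_elt scale_pure (act1 (actP V)).
Qed.

Lemma bc_free : finite_free (tens g V).
Proof.
have [n [e he]] := fmod_free V; have [x [xl [xE xU]]] := is_basis_coord he.
exists n, (fun i => pure g 1 (e i)); split=> // w _.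
have cb i : balanced g (fun s v => s * g (x v 0 i)).
  split=> [s s' v|s v v'|s r v]; first by rewrite mulrDl.
  - by have := xl 1 v v'; rewrite !scale1r => ->; rewrite mxE rmorphD mulrDr.
  - have := xl r v 0; rewrite addr0 => ->.
    have -> : x 0 = 0 by have := xl (- 1) 0 0; rewrite !scaleN1r !addNr.
    by rewrite addr0 mxE rmorphM mulrA.
have xe i j : x (e j) 0 i = (i == j)%:R.
  have {1}-> : e j = \sum_k (delta_mx 0 j : 'rV[S]_n) 0 k *: e k.
    rewrite (bigD1 j) //= big1 => [|k kj]; first by rewrite mxE !eqxx scale1r addr0.
    by rewrite mxE (negbTE kj) andbF scale0r.
  by rewrite xU mxE eqxx.
exists (\row_i tev (fun s v => s * g (x v 0 i)) w); split.
  rewrite {1}[w]tensE; under [RHS]eq_bigr do rewrite mxE.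
  rewrite /tev /ev; under [RHS]eq_bigr do rewrite scaler_suml.
  rewrite exchange_big; apply: eq_bigr => p _ /=.
  rewrite {1}(xE p.2); under [RHS]eq_bigr do rewrite scale_pure mulr1 pureZ.
  apply: (big_morph (pure g p.1)); first by move=> ? ?; rewrite pureDr.
  exact: (balanced0r _ (pure_balanced g V)).
move=> c ->; apply/rowP => i; rewrite mxE tev_sum //.
rewrite (bigD1 i) //= big1 => [|j ji]; rewrite scale_pure mulr1 tev_pure // xe.
  by rewrite eqxx rmorph1 mulr1 addr0.
by rewrite eq_sym (negbTE ji) rmorph0 mulr0.
Qed.

Lemma bc_sum : direct_sum (fun i => tens_span g (deg i : set V)).
Proof.
have [p [pl pS pg pd]] := direct_sum_proj (deg_sum V).
have pD i u v : p i (u + v) = p i u + p i v.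
  by have := pl i 1 u v; rewrite !scale1r.
have pZ i a u : p i (a *: u) = a *: p i u.
  have p0 : p i 0 = 0 by apply: (addIr (p i 0)); rewrite -pD !add0r.
  by have := pl i a u 0; rewrite p0 !addr0.
have qb i : balanced g (fun s v => pure g s (p i v)).
  by split=> [s s' v|s v v'|s r v]; rewrite ?pD ?pZ ?pureDl ?pureDr ?pureZ.
apply: (@direct_sum_intro _ _ _ (fun i => tev (fun s v => pure g s (p i v)))).
- by move=> i; exact: tens_span_sub.
- by move=> i u v; exact: tevD.
- move=> w; rewrite [X in is_finsum _ X](tensE w) /tev /ev.
  elim: (repr w) => [|[t v] r IH].
    by exists [::]; split=> [|i _|]; rewrite ?big_nil.
  rewrite big_cons /= -[pure g t v]scale1r.
  rewrite (_ : (fun i => _) = fun i => 1 *: pure g t (p i v) +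
     \sum_(q <- r) pure g q.1 (p i q.2)); last first.
    by apply/funext => i; rewrite big_cons scale1r.
  apply: (@finsum_lin _ _ _ id) => //.
  have [s [us ps Es]] := pS v; exists s; split=> //.
    by move=> i /ps ->; exact: (balanced0r _ (pure_balanced g V)).
  rewrite {1}Es; apply: (big_morph (pure g t)) => [? ?|]; first by rewrite pureDr.
  exact: (balanced0r _ (pure_balanced g V)).
- move=> i w; exists [seq (q.1, p i q.2) | q <- repr w]; split.
    by move=> q /mapP[q' _ ->] /=; exact: pg.
  by rewrite big_map.
- move=> i j w [t [ht ->]]; rewrite tev_sum //.
  transitivity (\sum_(q <- t) if i == j then pure g q.1 q.2 else 0).
    rewrite !big_seq; apply: eq_bigr => q /ht qj; rewrite tev_pure // (pd i j) //.
    by case: eqP => // _; exact: (balanced0r _ (pure_balanced g V)).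
  by case: eqP => // _; rewrite big1.
Qed.

Lemma bc_deg_act i j (x : tens f' H) (w : tens g V) :
  ext_grading f' Hg i x -> tens_span g (deg j : set V) w ->
  tens_span g (deg (i + j) : set V) (bc_act x w).
Proof.
move=> [t [ht ->]] [u [hu ->]].
exists [seq (p.1 * q.1, act (pure f 1 p.2) q.2) | p <- t, q <- u]; split.
  move=> _ /allpairsP[[p q] [/ht pH /hu qV ->]] /=; apply: deg_act => //.
  by exists [:: (1, p.2)]; split=> [r|]; rewrite ?inE ?big_seq1 // => /eqP ->.
rewrite big_allpairs_dep /bc_act tev_sum; last exact: bc_balanced.
apply: eq_bigr => p _; rewrite tev_pure; last exact: bc_balanced.
rewrite tev_sum; last exact: bc_elt_balanced.
by apply: eq_bigr => q _; rewrite tev_pure //; exact: bc_elt_balanced.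
Qed.

Definition base_change : gmod (tens_in f' H) (ext_grading f' Hg) :=
  @GMod _ _ (tens_in f' H) (ext_grading f' Hg) (FMod bc_action bc_free) _
    bc_sum bc_deg_act.

End BaseChange.

Arguments base_change {R S S' f f' g} gf {H Hg} V.

(* The Grothendieck group R_0: a pair (x, y) of finite lists of modules stands
   for the difference of their sums.  [add_eq] is the congruence generated by
   short exact sequences on the free commutative monoid of lists, and elements
   of [R0] are the classes of pairs for the induced relation [r0_eq]. *)
Section Grothendieck.
Variables (R : comNzRingType) (B : pzRingType) (eta : {rmorphism R -> B}).
Variable g : int -> set B.
Notation G := (gmod eta g).

Inductive add_eq : seq G -> seq G -> Prop :=
| add_eq_refl x : add_eq x x
| add_eq_sym x y : add_eq x y -> add_eq y x
| add_eq_trans x y z : add_eq x y -> add_eq y z -> add_eq x z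
| add_eq_catC x y : add_eq (x ++ y) (y ++ x)
| add_eq_cat z x y : add_eq x y -> add_eq (z ++ x) (z ++ y)
| add_eq_exact V' V V'' :
    short_exact V' V V'' -> add_eq [:: V] [:: V'; V''].

Definition r0_eq (x y : seq G * seq G) : Prop :=
  exists z, add_eq (x.1 ++ y.2 ++ z) (y.1 ++ x.2 ++ z).

Definition R0 : Type := {X : seq G * seq G -> Prop | exists x, X = r0_eq x}.

Definition r0_cls (x : seq G * seq G) : R0 :=
  exist _ (r0_eq x) (ex_intro _ x erefl).

Definition r0_repr (X : R0) : seq G * seq G := sval (cid (svalP X)).

Definition r0_add (X Y : R0) : R0 :=
  r0_cls ((r0_repr X).1 ++ (r0_repr Y).1, (r0_repr X).2 ++ (r0_repr Y).2).

Definition r0_zero : R0 := r0_cls ([::], [::]).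

(* Multiplication by q^j. *)
Definition r0_shift (j : int) (X : R0) : R0 :=
  r0_cls (map (gshift j) (r0_repr X).1, map (gshift j) (r0_repr X).2).

Definition gcls (V : G) : R0 := r0_cls ([:: V], [::]).

Definition R0p : Type := {X : R0 | exists V, X = gcls V}.

Definition pcls (V : G) : R0p := exist _ (gcls V) (ex_intro _ V erefl).

Definition prepr (X : R0p) : G := sval (cid (svalP X)).

Lemma preprE (X : R0p) : gcls (prepr X) = sval X.
Proof. by rewrite /prepr; case: (cid _) => V /= ->. Qed.

Lemma add_eq_catr z x y : add_eq x y -> add_eq (x ++ z) (y ++ z).
Proof.
move=> h; apply: (add_eq_trans (add_eq_catC _ _)).
by apply: (add_eq_trans (add_eq_cat z h)); exact: add_eq_catC.
Qed.

Lemma add_eq_catCA x y z : add_eq (x ++ y ++ z) (y ++ x ++ z).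
Proof. by rewrite !catA; apply: add_eq_catr; exact: add_eq_catC. Qed.

Lemma add_eq_cat2 x y x' y' :
  add_eq x y -> add_eq x' y' -> add_eq (x ++ x') (y ++ y').
Proof.
by move=> h h'; apply: (add_eq_trans (add_eq_cat x h')); exact: add_eq_catr.
Qed.

Lemma add_eq_ACA a b c d : add_eq ((a ++ b) ++ (c ++ d)) ((a ++ c) ++ (b ++ d)).
Proof. by rewrite -!catA; apply: add_eq_cat; exact: add_eq_catCA. Qed.

Lemma r0_eq_refl x : r0_eq x x.
Proof. by exists [::]; exact: add_eq_refl. Qed.

Lemma r0_eq_sym x y : r0_eq x y -> r0_eq y x.
Proof. by move=> [z h]; exists z; exact: add_eq_sym. Qed.

Lemma r0_eq_trans y x z : r0_eq x y -> r0_eq y z -> r0_eq x z.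
Proof.
move=> [u hu] [v hv]; exists (y.1 ++ y.2 ++ u ++ v).
have A (a b s t : seq G) : add_eq (a ++ b ++ y.1 ++ y.2 ++ s ++ t)
    ((a ++ y.2 ++ s) ++ (y.1 ++ b ++ t)).
  rewrite -!catA; apply: add_eq_cat.
  apply: (add_eq_trans (add_eq_catCA _ _ _)).
  apply: (add_eq_trans (y := y.1 ++ y.2 ++ s ++ b ++ t)).
    apply: add_eq_cat; apply: (add_eq_trans (add_eq_catCA _ _ _)).
    by apply: add_eq_cat; exact: add_eq_catCA.
  apply: (add_eq_trans (add_eq_catCA _ _ _)); apply: add_eq_cat.
  exact: add_eq_catCA.
apply: (add_eq_trans (A _ _ _ _)).
apply: (add_eq_trans (add_eq_cat2 hu hv)).
apply: (add_eq_trans (add_eq_catC _ _)).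
apply: (add_eq_trans (add_eq_sym (A _ _ _ _))).
by do 4!apply: add_eq_cat; exact: add_eq_catC.
Qed.

Lemma r0_clsP x y : r0_cls x = r0_cls y <-> r0_eq x y.
Proof.
split=> [[E]|h]; first by rewrite E; exact: r0_eq_refl.
apply: eq_exist => /=; apply/funext => z; apply/propext.
by split; apply: r0_eq_trans => //; exact: r0_eq_sym.
Qed.

Lemma r0_reprK X : r0_cls (r0_repr X) = X.
Proof.
by case: X => X p; apply: eq_exist; rewrite /r0_repr; case: (cid _) => x /= ->.
Qed.

Lemma r0_repr_cls x : r0_eq (r0_repr (r0_cls x)) x.
Proof. by apply/r0_clsP; rewrite r0_reprK. Qed.

Lemma r0_addE x y :
  r0_add (r0_cls x) (r0_cls y) = r0_cls (x.1 ++ y.1, x.2 ++ y.2).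
Proof.
apply/r0_clsP; have [u hu] := r0_repr_cls x; have [v hv] := r0_repr_cls y.
exists (u ++ v) => /=.
have A (a b c d : seq G) : add_eq ((a ++ b) ++ (c ++ d) ++ u ++ v)
    ((a ++ c ++ u) ++ (b ++ d ++ v)).
  apply: (add_eq_trans (add_eq_cat _ (add_eq_ACA _ _ _ _))).
  exact: add_eq_ACA.
apply: (add_eq_trans (A _ _ _ _)); apply: (add_eq_trans (add_eq_cat2 hu hv)).
exact: (add_eq_sym (A _ _ _ _)).
Qed.

Lemma shift_exact j (V' V V'' : G) :
  short_exact V' V V'' ->
  short_exact (gshift j V') (gshift j V) (gshift j V'').
Proof.
move=> [a [b [[a1 a2 a3] [b1 b2 b3] ia sb ex]]]; exists a, b; split=> //.
- by split=> // i v; exact: a3.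
- by split=> // i v; exact: b3.
Qed.

Lemma add_eq_shift j (x y : seq G) :
  add_eq x y -> add_eq (map (gshift j) x) (map (gshift j) y).
Proof.
elim=> {x y} [x|x y _ h|x y z _ h _ h'|x y|z x y _ h|V' V V'' h].
- exact: add_eq_refl.
- exact: add_eq_sym.
- exact: (add_eq_trans h).
- by rewrite !map_cat; exact: add_eq_catC.
- by rewrite !map_cat; exact: add_eq_cat.
- by apply: add_eq_exact; exact: shift_exact.
Qed.

Lemma r0_shiftE j (x : seq G * seq G) :
  r0_shift j (r0_cls x) = r0_cls (map (gshift j) x.1, map (gshift j) x.2).
Proof.
apply/r0_clsP; have [u hu] := r0_repr_cls x.
by exists (map (gshift j) u); rewrite /= -!map_cat; exact: add_eq_shift.
Qed.

Lemma prod_exact (V W : G) : short_exact V (gprod V W) W.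
Proof.
exists (fun v : V => (v, 0 : W)), (fun x : V * W => x.2).
have a0 (W' : G) b : act b (0 : W') = 0.
  have := actL (actP W') b (- 1) 0 0.
  by rewrite !scaleN1r !addNr.
split=> //.
- split=> [a u v|b v|i v hv].
  + rewrite -[RHS]/(a *: u + v, a *: (0 : W) + 0); congr (_, _).
    by rewrite scaler0 addr0.
  + by rewrite -[RHS]/(act b v, act b (0 : W)) a0.
  + by split=> //; case: ((deg_sum W).1 i).
- by split=> // i [v w] [].
- by move=> u v [].
- by move=> w; exists (0, w).
- move=> [v w] /=; split=> [->|[u [_ ->]] //]; by exists v.
Qed.

Lemma gclsD (V W : G) : gcls (gprod V W) = r0_add (gcls V) (gcls W).
Proof.
rewrite r0_addE; apply/r0_clsP; exists [::]; rewrite /=.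
exact: (add_eq_exact (prod_exact V W)).
Qed.

Lemma gcls_zero : gcls (gzero eta g) = r0_zero.
Proof.
apply/r0_clsP; exists [:: gzero eta g] => /=; apply: add_eq_sym.
apply: add_eq_exact; exists id, (fun=> 0); split=> //.
- by split=> [a u v|b v|//]; exact: zero_eq.
- by move=> w; exists 0; exact: zero_eq.
- by move=> v; split=> _; [exists v|].
Qed.

Lemma r0p_add_subproof (X Y : R0p) :
  exists V, r0_add (sval X) (sval Y) = gcls V.
Proof. by exists (gprod (prepr X) (prepr Y)); rewrite gclsD !preprE. Qed.

Definition r0p_add (X Y : R0p) : R0p := exist _ _ (r0p_add_subproof X Y).

Lemma r0p_zero_subproof : exists V, r0_zero = gcls V.
Proof. by exists (gzero eta g); rewrite gcls_zero. Qed.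

Definition r0p_zero : R0p := exist _ _ r0p_zero_subproof.

Lemma r0p_shift_subproof j (X : R0p) : exists V, r0_shift j (sval X) = gcls V.
Proof. by exists (gshift j (prepr X)); rewrite -preprE r0_shiftE. Qed.

Definition r0p_shift j (X : R0p) : R0p := exist _ _ (r0p_shift_subproof j X).

(* The list e of exponents, each repeated according to its coefficient, stands
   for the Laurent polynomial \sum_(j <- e) q^j in N[q, q^-1]. *)
Definition r0p_laurent (e : seq int) (X : R0p) : R0p :=
  foldr (fun j Y => r0p_add (r0p_shift j X) Y) r0p_zero e.

End Grothendieck.

Arguments pcls {R B eta g} V.

Definition is_laurent_hom (R R' : comNzRingType) (B B' : pzRingType)
    (eta : {rmorphism R -> B}) (eta' : {rmorphism R' -> B'})
    (g : int -> set B) (g' : int -> set B') (d : R0p eta g -> R0p eta' g') :=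
  (forall X Y, d (r0p_add X Y) = r0p_add (d X) (d Y)) /\
  (forall e X, d (r0p_laurent e X) = r0p_laurent e (d X)).

(* p is the characteristic polynomial of phi on the phi-stable subspace U. *)
Definition is_char_poly (F : fieldType) (V : lmodType F) (U : set V)
    (phi : V -> V) (p : {poly F}) : Prop :=
  exists (n : nat) (e : 'I_n -> V) (M : 'M[F]_n),
    [/\ is_basis U e, forall j, phi (e j) = \sum_i M i j *: e i &
        p = char_poly M].

Section CharPolys.
Variables (A : comNzRingType) (H : algType A) (Hg : int -> set H).

Definition poly_maps (R : nzRingType) : Type :=
  {h : H | Hg 0 h} -> int -> {poly R}.

Definition map_poly_maps (R S : nzRingType) (f : R -> S) (P : poly_maps R) :
  poly_maps S := fun h0 i => map_poly f (P h0 i).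

Definition scalar_R0p (S : comNzRingType) (f : {rmorphism A -> S}) : Type :=
  R0p (tens_in f H) (ext_grading f Hg).

(* The set below is a singleton: characteristic polynomials of the homogeneous
   components are multiplicative along short exact sequences, hence depend only
   on the class X. *)
Definition char_polys (F : fieldType) (f : {rmorphism A -> F})
    (X : scalar_R0p f) : poly_maps F :=
  fun h0 i => xget 0 [set p | exists V : gmod (tens_in f H) (ext_grading f Hg),
    sval X = gcls V /\ is_char_poly (deg i : set V) (act (pure f 1 (sval h0))) p].

End CharPolys.

Arguments char_polys {A H Hg F} f X.

Definition subring_of (K : fieldType) (O : subringClosed K) : Type :=
  {x : K | x \in O}.

Section SubringOf.
Variables (K : fieldType) (O : subringClosed K).
HB.instance Definition _ := [isSub of subring_of O for @sval _ _].
HB.instance Definition _ := [Choice of subring_of O by <:].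
HB.instance Definition _ := [SubChoice_isSubComNzRing of subring_of O by <:].
End SubringOf.

Definition is_valuation_ring (K : fieldType) (O : subringClosed K) : Prop :=
  forall x : K, x != 0 -> x \in O \/ x^-1 \in O.

(* The non-units of the subring O, i.e. its maximal ideal J(O) when O is a
   valuation ring. *)
Definition nonunit (K : fieldType) (O : subringClosed K) (x : K) : Prop :=
  x \in O /\ ~ exists2 y, y \in O & x * y = 1.

Definition integrally_closed (A : idomainType) : Prop :=
  forall x : {fraction A}, integralOver (@tofrac A) x -> exists a : A, x = tofrac a.

Definition is_frac_of_image (A : nzRingType) (L : fieldType) (theta : A -> L) :=
  forall x : L, exists a b : A, theta b != 0 /\ x = theta a / theta b.

Definition perfect_field (L : fieldType) : Prop :=
  forall p : {poly L}, irreducible_poly p -> separable_poly p.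

(* A valuation ring O of K as in the theorem, its residue field k with the
   reduction map O -> k, and the embedding of L into k. *)
Record valuation_setting (A : idomainType) (L : fieldType)
    (theta : {rmorphism A -> L}) := ValuationSetting {
  vO : subringClosed {fraction A};
  vO_valuation : is_valuation_ring vO;
  vO_sub : forall a : A, tofrac a \in vO;
  vO_ker : forall a : A, nonunit vO (tofrac a) <-> theta a = 0;
  vk : fieldType;
  vres : {rmorphism subring_of vO -> vk};
  vres_surj : forall y : vk, exists x, vres x = y;
  vres_ker : forall x, vres x = 0 <-> nonunit vO (val x);
  vemb : {rmorphism L -> vk};
  vemb_theta : forall a : A, vemb (theta a) = vres (exist _ (tofrac a) (vO_sub a)) }.

Section Decomposition.
Variables (A : idomainType) (L : fieldType) (theta : {rmorphism A -> L}).
Variable D : valuation_setting theta.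

Definition to_vO (a : A) : subring_of (vO D) := exist _ (tofrac a) (vO_sub D a).

Lemma to_vO_zmod_morphism : zmod_morphism to_vO.
Proof. by move=> a b; apply: val_inj; rewrite /= !rmorphB. Qed.
Lemma to_vO_monoid_morphism : monoid_morphism to_vO.
Proof.
split=> [|a b]; apply: val_inj; first by rewrite /= rmorph1.
by rewrite /= !rmorphM.
Qed.
HB.instance Definition _ := GRing.isZmodMorphism.Build A (subring_of (vO D))
  to_vO to_vO_zmod_morphism.
HB.instance Definition _ := GRing.isMonoidMorphism.Build A (subring_of (vO D))
  to_vO to_vO_monoid_morphism.

Let f_O : {rmorphism A -> subring_of (vO D)} := to_vO.
Definition to_K : {rmorphism A -> {fraction A}} := @tofrac A.
Definition to_k : {rmorphism A -> vk D} := vres D \o to_vO.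
Definition vO_to_K : {rmorphism subring_of (vO D) -> {fraction A}} := val.

Lemma vO_to_KE a : vO_to_K (f_O a) = to_K a. Proof. by []. Qed.
Lemma vresE a : vres D (f_O a) = to_k a. Proof. by []. Qed.
Lemma vembE a : vemb D (theta a) = to_k a. Proof. exact: vemb_theta. Qed.

Variables (H : algType A) (Hg : int -> set H).

Definition graded_lattice : Type := gmod (tens_in f_O H) (ext_grading f_O Hg).

(* The identification of R_0^+(LH) with R_0^+(kH), [V] |-> [k (x)_L V]; the
   class on the right depends only on [V] as k (x)_L - is exact. *)
Definition residue_ident (X : scalar_R0p Hg theta) : scalar_R0p Hg to_k :=
  pcls (base_change vembE (prepr X)).

Definition is_modular_reduction
    (d : scalar_R0p Hg to_K -> scalar_R0p Hg theta) : Prop :=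
  forall V : graded_lattice,
    residue_ident (d (pcls (base_change vO_to_KE V))) =
    pcls (base_change vresE V).

Definition split_or_perfect : Prop :=
  split_algebra (tens_in theta H) \/
  ((forall y : vk D, exists x : L, vemb D x = y) /\ perfect_field L).

End Decomposition.

Definition char_poly_identity (A : idomainType) (L : fieldType)
    (theta : {rmorphism A -> L}) (H : algType A) (Hg : int -> set H)
    (d : scalar_R0p Hg (to_K A) -> scalar_R0p Hg theta) : Prop :=
  forall X (P : poly_maps Hg A),
    char_polys (to_K A) X = map_poly_maps (to_K A) P ->
    char_polys theta (d X) = map_poly_maps theta P.

(* Main.v *)
Require Import Defs.
From HB Require Import structures.
From mathcomp Require Import all_boot all_order all_algebra.
From mathcomp Require Import boolp classical_sets ring.

(** A graded module over [KH] is determined, up to its class in the Grothendieck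
    group, by the characteristic polynomials of the elements of [H_0] on its
    homogeneous components, and the same holds over [L].  The decomposition map
    is therefore the only map compatible with applying [theta] to these
    polynomials; its additivity, its compatibility with shifts and its
    independence of the valuation ring follow from the corresponding properties
    of characteristic polynomials.  Three points carry the proof.

    Characteristic polynomials separate classes ([cp_inj]), over any field [F]
    that is the field of fractions of the image of the base ring.  Let [V] and
    [W] have the same polynomials, and let [V_i] be nonzero.  An element of [F
    (x) H_0] with eigenvalue [1] on [V_i] also has eigenvalue [1] on [W_i].
    Take a minimal left ideal [I] of [F (x) H_0] containing such an element, and
    eigenvectors [v], [w] for it.  The graded submodule [Z] of [V + W] whose
    component of degree [i] is [I (v, w)] contains [(v, w)] but, by minimality
    of [I], not [(v, 0)].  Hence, as in Goursat's lemma, [Z] identifies nonzero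
    subquotients of [V] and [W]; what remains of [V] and [W] has smaller
    dimension and again the same polynomials.

    Polynomials can be transported from [K] to [L].  A [KH]-module [V] is
    spanned by a finitely generated [A]-submodule stable under [H].  The maximal
    minors of a generating family show that the coefficients of the polynomials
    are integral over [A] ([char_poly_integral]), hence in [A].  The
    [O]-submodule generated by the same elements is a lattice, because finitely
    generated torsion-free modules over a valuation ring are free
    ([lattice_exists]).  One matrix over [O] then computes the polynomials over
    [K] and over [k] ([lattice_cp]).

    Every class over [kH] comes from [LH] ([residue_descent]).  For [L = k] this
    is clear.  For split [LH], let [S] be a graded [LH]-submodule of a
    [kH]-module that is finite-dimensional over [L], nonzero, and of minimal
    dimension.  It is graded simple, hence simple ([graded_simple_simple]), so
    that its endomorphisms are scalars, and [k (x)_L S] still embeds into the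
    given module ([split_bcmap_inj]).  One concludes by induction on the
    dimension. *)

Set Implicit Arguments.
Unset Strict Implicit.
Unset Printing Implicit Defensive.

Import Order.TTheory GRing.Theory Num.Theory.
Local Open Scope ring_scope.
Local Open Scope classical_set_scope.

(** * Linear algebra with explicit bases *)

Section LinearFunctions.
Variables (R : comNzRingType) (M N : lmodType R) (phi : M -> N).
Hypothesis phiL : linear phi.

Lemma linD u v : phi (u + v) = phi u + phi v.
Proof. by have := phiL 1 u v; rewrite !scale1r. Qed.

Lemma lin0 : phi 0 = 0.
Proof. by apply: (addIr (phi 0)); rewrite -linD !add0r. Qed.

Lemma linZ a u : phi (a *: u) = a *: phi u.
Proof. by have := phiL a u 0; rewrite lin0 !addr0. Qed.

Lemma linN u : phi (- u) = - phi u.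
Proof. by rewrite -scaleN1r linZ scaleN1r. Qed.

Lemma linB u v : phi (u - v) = phi u - phi v.
Proof. by rewrite linD linN. Qed.

Lemma lin_sum I (r : seq I) (P : pred I) (F : I -> M) :
  phi (\sum_(i <- r | P i) F i) = \sum_(i <- r | P i) phi (F i).
Proof. exact: (big_morph phi linD lin0). Qed.

Lemma lin_inj : (forall u, phi u = 0 -> u = 0) -> injective phi.
Proof.
by move=> h u v E; apply/eqP; rewrite -subr_eq0; apply/eqP/h;
  rewrite linB E subrr.
Qed.

End LinearFunctions.

Section Submodules.
Variables (R : comNzRingType) (M : lmodType R) (U : set M).
Hypothesis Us : is_submodule U.

Lemma sub0 : U 0. Proof. by case: Us. Qed.

Lemma subD u v : U u -> U v -> U (u + v).
Proof. by move=> Uu Uv; rewrite -[u]scale1r; apply: Us.2. Qed.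

Lemma subZ a u : U u -> U (a *: u).
Proof. by move=> Uu; rewrite -[_ *: _]addr0; apply: Us.2 => //;
  exact: sub0. Qed.

Lemma subB u v : U u -> U v -> U (u - v).
Proof. by move=> Uu Uv; apply: subD => //; rewrite -scaleN1r; exact: subZ. Qed.

Lemma sub_sum I (r : seq I) (P : pred I) (F : I -> M) :
  (forall i, P i -> U (F i)) -> U (\sum_(i <- r | P i) F i).
Proof.
move=> h; elim/big_ind: _ => //; [exact: sub0|move=> ? ?; exact: subD].
Qed.

End Submodules.

Lemma setT_sub (R : comNzRingType) (M : lmodType R) : is_submodule (setT : set
  M).
Proof. by []. Qed.

Definition lincomb (R : comNzRingType) (M : lmodType R) n (e : 'I_n -> M)
  (c : 'rV[R]_n) : M := \sum_i c 0 i *: e i.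

Section Bases.
Variable R : comNzRingType.
Implicit Type M : lmodType R.

Lemma lincombL M n (e : 'I_n -> M) : linear (lincomb e).
Proof.
move=> a u v; rewrite /lincomb scaler_sumr -big_split; apply: eq_bigr => i _.
by rewrite !mxE scalerDl scalerA.
Qed.

Lemma lincomb_delta M n (e : 'I_n -> M) i : lincomb e (delta_mx 0 i) = e i.
Proof.
rewrite /lincomb (bigD1 i) //= big1 => [|j ji].
  by rewrite mxE !eqxx scale1r addr0.
by rewrite mxE (negbTE ji) andbF scale0r.
Qed.

Lemma lin_lincomb M (N : lmodType R) (phi : M -> N) n (e : 'I_n -> M) c :
  linear phi -> phi (lincomb e c) = lincomb (phi \o e) c.
Proof.
by move=> h; rewrite lin_sum //; apply: eq_bigr => i _; rewrite linZ.
Qed.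

Lemma lincomb_mul M m n (e : 'I_n -> M) (P : 'M_(m, n)) (c : 'rV_m) :
  lincomb e (c *m P) = lincomb (fun i => lincomb e (row i P)) c.
Proof.
rewrite /lincomb; under [RHS]eq_bigr do rewrite scaler_sumr.
rewrite exchange_big; apply: eq_bigr => j _ /=.
by rewrite mxE scaler_suml; apply: eq_bigr => i _; rewrite mxE scalerA.
Qed.

Lemma sub_lincomb M (U : set M) n (e : 'I_n -> M) c :
  is_submodule U -> (forall i, U (e i)) -> U (lincomb e c).
Proof. by move=> Us Ue; apply: sub_sum => // i _; exact: subZ. Qed.

Lemma basis_intro M (U : set M) n (e : 'I_n -> M) :
  (forall i, U (e i)) -> (forall v, U v -> exists c, v = lincomb e c) ->
  (forall c, lincomb e c = 0 -> c = 0) -> is_basis U e.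
Proof.
move=> Ue Us e0; split=> // v /Us[c ->]; exists c; split=> // c' E.
by apply: (lin_inj (@lincombL _ _ e)) => //.
Qed.

Section BasisOf.
Variables (M : lmodType R) (U : set M) (n : nat) (e : 'I_n -> M).
Hypothesis Ue : is_basis U e.

Lemma basis_span v : U v -> exists c, v = lincomb e c.
Proof. by move=> /(Ue.2)[c [E _]]; exists c. Qed.

Lemma basis_free c : is_submodule U -> lincomb e c = 0 -> c = 0.
Proof.
move=> Us c0; have [d [_ h]] := Ue.2 0 (sub0 Us).
by rewrite -(h c) ?(h 0) // /lincomb big1 // => i _; rewrite mxE scale0r.
Qed.

Lemma basis_inj : is_submodule U -> injective (lincomb e).
Proof. by move=> Us; apply: lin_inj; [exact: lincombL|move=> c;
  exact: basis_free]. Qed.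

End BasisOf.

(** Extending a basis of a subspace by lifts of a basis of the quotient,
    relative to subsets [U'], [U], [U''] so as to apply in each degree
    separately. *)
Lemma basis_ext M (M' M'' : lmodType R) (al : M' -> M) (be : M -> M'')
    (U' : set M') (U : set M) (U'' : set M'') n' n''
    (e' : 'I_n' -> M') (e'' : 'I_n'' -> M'') (l : 'I_n'' -> M) :
  is_submodule U' -> is_submodule U'' -> is_submodule U ->
  linear al -> linear be -> injective al ->
  (forall v, U' v -> U (al v)) -> (forall v, U v -> U'' (be v)) ->
  (forall v, U' v -> be (al v) = 0) ->
  (forall v, U v -> be v = 0 -> exists2 u, U' u & al u = v) ->
  is_basis U' e' -> is_basis U'' e'' ->
  (forall j, U (l j) /\ be (l j) = e'' j) ->
  is_basis U (fun k => match split k with inl i => al (e' i) | inr j =>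
    l j end).
Proof.
move=> s' s'' s aL bL ai aU bU ba ex h' h'' hl; set e := fun k => _.
have eE c : lincomb e c = al (lincomb e' (lsubmx c)) + lincomb l (rsubmx c).
  rewrite (lin_lincomb _ _ aL) /lincomb big_split_ord /=; congr (_ + _).
    apply: eq_bigr => i _; rewrite mxE /e.
    by rewrite -[lshift _ i]/(unsplit (inl i)) unsplitK.
  apply: eq_bigr => i _; rewrite mxE /e.
  by rewrite -[rshift _ i]/(unsplit (inr i)) unsplitK.
have bl c : be (lincomb l c) = lincomb e'' c.
  by rewrite (lin_lincomb _ _ bL); apply: eq_bigr => j _ /=; rewrite (hl j).2.
have Ul c : U (lincomb l c) by apply: sub_lincomb => // j; case: (hl j).
apply: basis_intro.
- by move=> k; rewrite /e; case: split => [i|j]; [apply/aU;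
  case: h'|case: (hl j)].
- move=> v Uv; have [c'' E''] := basis_span h'' (bU _ Uv).
  have [||u U'u Eu] := ex (v - lincomb l c''); first exact: subB.
    by rewrite (linB bL) bl E'' subrr.
  have [c' E'] := basis_span h' U'u; exists (row_mx c' c'').
  by rewrite eE row_mxKl row_mxKr -E' Eu subrK.
- move=> c; rewrite eE => c0; have := congr1 be c0.
  rewrite (linD bL) ba; last by apply: sub_lincomb => // i; case: h'.
  rewrite add0r bl (lin0 bL) => /(basis_free h'' s'') r0.
  move: c0; rewrite r0 (lin0 (lincombL l)) addr0 -(lin0 aL) => /ai.
  move=> /(basis_free h' s') l0.
  by rewrite -[c]hsubmxK l0 r0 row_mx0.
Qed.

(** [P] restricts the quotients: all of [R] for divisibility in [R], the
    elements of a valuation ring when comparing elements of its field of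
    fractions. *)
Lemma max_divisor n (c : 'rV[R]_n) (P : R -> Prop) :
  P 1 -> (forall a b, P a -> P b -> P (a * b)) ->
  (forall a b, (exists2 d, P d & a = d * b) \/ (exists2 d, P d & b = d * a)) ->
  c != 0 ->
  exists2 j, c 0 j != 0 & forall i, exists2 d, P d & c 0 i = d * c 0 j.
Proof.
move=> P1 PM dv c0; have /existsP[i0 ci0] : [exists i, c 0 i != 0].
  rewrite -negb_forall; apply: contra c0 => /forallP h; apply/eqP/rowP => i.
  by rewrite mxE; apply/eqP.
suff [j cj h] : exists2 j, c 0 j != 0 &
    forall i, i \in enum 'I_n -> exists2 d, P d & c 0 i = d * c 0 j.
  by exists j => // i; apply: h; rewrite mem_enum.
elim: (enum _) => [|i s [j cj IH]]; first by exists i0.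
have [[d Pd E]|[d Pd E]] := dv (c 0 i) (c 0 j).
  exists j => // k; rewrite inE => /orP[/eqP ->|]; [by exists d|exact: IH].
have ci : c 0 i != 0 by apply: contraNneq cj => z; rewrite E z mulr0.
exists i => // k; rewrite inE => /orP[/eqP ->|/IH[d' Pd' ->]].
  by exists 1; rewrite ?mul1r.
by exists (d' * d); [exact: PM|rewrite E mulrA].
Qed.

(** In a nontrivial relation, divide by a coefficient dividing all the others:
    the corresponding generator is a combination of the remaining ones. *)
Lemma fg_torsionfree_free M (U : set M) n (y : 'I_n -> M) :
  (forall a b : R, (exists d, a = d * b) \/ (exists d, b = d * a)) ->
  is_submodule U -> (forall a u, U u -> a *: u = 0 -> a = 0 \/ u = 0) ->
  (forall i, U (y i)) -> (forall v, U v -> exists c, v = lincomb y c) ->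
  exists m (e : 'I_m -> M), is_basis U e.
Proof.
move=> dv Us tf; elim: n y => [|n IH] y Uy yU.
  by exists 0%N, y; apply: basis_intro => // c _; apply/rowP => -[].
have [ind|] := pselect (forall c, lincomb y c = 0 -> c = 0).
  by exists n.+1, y; exact: basis_intro.
move=> /existsNP[c /not_implyP[c0 /eqP cn0]].
have [//|//||j cj dv'] := @max_divisor _ c (fun=> True) _ _ _ cn0.
  by move=> a b; case: (dv a b) => -[d E]; [left|right]; exists d.
have /choice[d dE] : forall i, exists d, c 0 i = d * c 0 j.
  by move=> i; have [d _ E] := dv' i; exists d.
pose d' i := if i == j then 1 else d i.
have dE' i : c 0 i = d' i * c 0 j.
  by rewrite /d'; case: eqP => [->|_]; rewrite ?mul1r.
have r0 : \sum_i d' i *: y i = 0.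
  have [||/eqP|//] := tf (c 0 j) (\sum_i d' i *: y i).
  - by apply: sub_sum => // i _; exact: subZ.
  - rewrite -[RHS]c0 scaler_sumr; apply: eq_bigr => i _.
    by rewrite scalerA mulrC -dE'.
  - by rewrite (negbTE cj).
move: r0; rewrite (bigD1_ord j) //= {1}/d' eqxx scale1r => /eqP.
rewrite addr_eq0 => /eqP Ej.
apply: (IH (y \o lift j)) => [i|v /yU[x ->]]; first exact: Uy.
exists (\row_i (x 0 (lift j i) - x 0 j * d' (lift j i))).
rewrite /lincomb (bigD1_ord j) //= Ej scalerN scaler_sumr -sumrN -big_split /=.
apply: eq_bigr => i _; rewrite mxE addrC scalerBl scalerA.
by [].
Qed.

Lemma sum_lincomb M (T : finType) (y : T -> M) (c : T -> R) :
  \sum_t c t *: y t = lincomb (y \o @enum_val T T) (\row_k c (@enum_val T T k)).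
Proof.
rewrite /lincomb; under [RHS]eq_bigr do rewrite mxE.
by rewrite (reindex _ (onW_bij _ (enum_val_bij T))).
Qed.

End Bases.

Section FieldBases.
Variable F : fieldType.
Implicit Type M : lmodType F.

Lemma field_divides (a b : F) : (exists d, a = d * b) \/ (exists d, b = d * a).
Proof.
have [->|b0] := eqVneq b 0; first by right; exists 0; rewrite mul0r.
by left; exists (a / b); rewrite mulfVK.
Qed.

(** The matrix expressing [e] in terms of [e'] has free rows, and is invertible
    when it is square. *)
Lemma indep_le M n m (e : 'I_n -> M) (e' : 'I_m -> M) :
  (forall c, lincomb e c = 0 -> c = 0) ->
  (forall i, exists c, e i = lincomb e' c) ->
  (n <= m)%N /\ (n = m -> forall j, exists c, e' j = lincomb e c).
Proof.
move=> ind /choice[P PE]; pose A := \matrix_(i < n) P i.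
have EA c : lincomb e c = lincomb e' (c *m A).
  by rewrite lincomb_mul; apply: eq_bigr => i _; rewrite PE rowK.
have fA : row_free A.
  rewrite -kermx_eq0; apply/eqP/row_matrixP => i; rewrite row0.
  apply: ind; rewrite EA -row_mul mulmx_ker row0; exact: (lin0 (lincombL e')).
split; first by rewrite -(eqP fA) rank_leq_col.
move=> nm; subst m => j.
exists (delta_mx 0 j *m invmx A); rewrite EA mulmxKV ?lincomb_delta //.
by rewrite -row_free_unit.
Qed.

(** A matrix of maximal rank among those with rows in [X] spans [X]. *)
Lemma row_space n (X : set 'rV[F]_n) : is_submodule X ->
  exists B : 'M[F]_n, forall u, X u <-> (u <= B)%MS.
Proof.
move=> Xs; pose P r := `[< exists2 B : 'M[F]_n,
  \rank B = r & forall u, (u <= B)%MS -> X u >].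
have P0 : exists r, P r.
  exists 0%N; apply/asboolP; exists 0; first exact: mxrank0.
  by move=> u; rewrite submx0 => /eqP ->; exact: sub0.
have Pn r : P r -> (r <= n)%N by move=> /asboolP[B <- _]; exact: rank_leq_row.
case: (ex_maxnP P0 Pn) => r /asboolP[B Br BX] rmax; exists B => u.
split=> [Xu|]; last exact: BX.
have le : (\rank (B + u)%MS <= \rank B)%N.
  rewrite Br; apply: rmax; apply/asboolP; exists (B + u)%MS => // v.
  move=> /sub_addsmxP[[a b] /= ->]; apply: subD => //; first exact/BX/submxMl.
  rewrite [b]mx11_scalar mul_scalar_mx; exact: subZ.
have : (B + u <= B)%MS by rewrite -(geq_leqif (mxrank_leqif_sup (addsmxSl B
  u))).
exact: submx_trans (addsmxSr B u).
Qed.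

Section Coordinates.
Variable M : lmodType F.
Hypothesis Mf : finite_free M.

Lemma coord_iso : exists n (x : M -> 'rV[F]_n) (y : 'rV[F]_n -> M),
  [/\ linear x, linear y, cancel x y & cancel y x].
Proof.
have [n [e he]] := Mf; have [x [xL [xE xU]]] := is_basis_coord he.
exists n, x, (lincomb e); split=> //; first exact: lincombL.
Qed.

Lemma submodule_basis (U : set M) : is_submodule U ->
  exists n (e : 'I_n -> M), is_basis U e.
Proof.
move=> Us; have [n [x [y [xL yL xK yK]]]] := coord_iso.
have [|B BE] := @row_space n (fun u => U (y u)).
  split; first by rewrite lin0 //; exact: sub0.
  by move=> a u v Uu Uv; rewrite yL; exact: Us.2.
exists (\rank B), (fun i => y (row i (row_base B))).
have yE c : lincomb (fun i => y (row i (row_base B))) c = y (c *m row_base B).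
  have -> : c *m row_base B = lincomb (fun i => row i (row_base B)) c.
    by rewrite mulmx_sum_row.
  by rewrite (lin_lincomb _ _ yL).
apply: basis_intro.
- by move=> i; apply/BE; rewrite (submx_trans (row_sub _ _)) // eq_row_base.
- move=> v Uv; have : (x v <= row_base B)%MS by rewrite eq_row_base; apply/BE;
  rewrite xK.
  by move=> /submxP[c E]; exists c; rewrite yE -E xK.
- move=> c; rewrite yE -(lin0 yL) => /(can_inj yK)/eqP.
  by rewrite mulmx_free_eq0 ?row_base_free // => /eqP.
Qed.

Lemma quotient_map (U : set M) : is_submodule U ->
  exists m (pi : M -> 'rV[F]_m) (sg : 'rV[F]_m -> M),
  [/\ linear pi, linear sg, cancel sg pi & forall v, U v <-> pi v = 0].
Proof.
move=> Us; have [n [x [y [xL yL xK yK]]]] := coord_iso.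
have [|B BE] := @row_space n (fun u => U (y u)).
  split; first by rewrite lin0 //; exact: sub0.
  by move=> a u v Uu Uv; rewrite yL; exact: Us.2.
set C := cokermx B.
exists (\rank C), (fun v => x v *m col_base C), (fun z =>
  y (z *m pinvmx (col_base C))).
split.
- by move=> a u v; rewrite xL mulmxDl scalemxAl.
- by move=> a u v; rewrite mulmxDl -scalemxAl yL.
- by move=> z; rewrite yK -mulmxA mulVpmx ?mulmx1 ?col_base_full.
- move=> v; rewrite -{1}(xK v) (BE (x v)) submxE.
  rewrite -/C -{1}(mulmx_base C) mulmxA mulmx_free_eq0 ?row_base_free //.
  by split=> /eqP.
Qed.

End Coordinates.

Lemma free_inj_le M (N : lmodType F) m n (e : 'I_m -> M) (d : 'I_n -> N)
    (phi : M -> N) : linear phi -> injective phi ->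
  is_basis setT e -> is_basis setT d ->
  (m <= n)%N /\ (m = n -> forall w, exists v, phi v = w).
Proof.
move=> pL pI he hd; have [||h1 h2] := @indep_le _ _ _ (phi \o e) d.
- move=> c; rewrite -(lin_lincomb _ _ pL) -(lin0 pL) => /pI.
  exact: (basis_free he (setT_sub M)).
- by move=> i; exact: (basis_span hd).
split=> // E w; have /choice[P PE] := h2 E.
have [c ->] := basis_span hd (I : setT w).
exists (\sum_i c 0 i *: lincomb e (P i)); rewrite (lin_sum pL).
by apply: eq_bigr => i _; rewrite (linZ pL) (lin_lincomb _ _ pL) -PE.
Qed.

End FieldBases.

(** * Homogeneous components and modules over a scalar extension *)

Section Components.
Variables (R : comNzRingType) (M : lmodType R) (g : int -> set M).
Hypothesis gd : direct_sum g.

Definition pr (i : int) (v : M) : M := sval (cid (direct_sum_proj gd)) i v.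

Lemma pr_spec : [/\ forall i, linear (pr i), forall v, is_finsum (pr^~ v) v,
  forall i v, g i (pr i v) &
  forall i j v, g j v -> pr i v = if i == j then v else 0].
Proof. by rewrite /pr; case: (cid _). Qed.

Lemma prL i : linear (pr i). Proof. by case: pr_spec. Qed.
Lemma pr_finsum v : is_finsum (pr^~ v) v. Proof. by case: pr_spec. Qed.
Lemma pr_in i v : g i (pr i v). Proof. by case: pr_spec. Qed.
Lemma pr_deg i j v : g j v -> pr i v = if i == j then v else 0.
Proof. by case: pr_spec => _ _ _; apply. Qed.
Lemma pr_id i v : g i v -> pr i v = v.
Proof. by move=> /pr_deg ->; rewrite eqxx. Qed.
Lemma pr_pr i j v : pr i (pr j v) = if i == j then pr j v else 0.
Proof. exact/pr_deg/pr_in. Qed.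

Lemma pr_eq0 v : (forall i, pr i v = 0) -> v = 0.
Proof.
by move=> h; have [s [_ _ ->]] := pr_finsum v; rewrite big1.
Qed.

Lemma homog_ind (P : M -> Prop) : P 0 ->
  (forall u v, P u -> P v -> P (u + v)) -> (forall i v, g i v -> P v) ->
  forall v, P v.
Proof.
move=> P0 PD Pg v; have [s [_ _ ->]] := pr_finsum v.
by elim/big_ind: _ => // i _; exact: Pg (pr_in i v).
Qed.

Lemma deg_sub i : is_submodule (g i). Proof. by case: gd. Qed.

Lemma common_support n (y : 'I_n -> M) :
  exists2 s : seq int, uniq s & forall i k, i \notin s -> pr i (y k) = 0.
Proof.
have /choice[s sP] : forall k, exists s : seq int,
    forall i, i \notin s -> pr i (y k) = 0.
  by move=> k; have [s [_ h _]] := pr_finsum (y k); exists s.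
exists (undup (flatten [seq s k | k <- enum 'I_n])); first exact: undup_uniq.
move=> i k; rewrite mem_undup => /flattenP h; apply: sP; apply/negP => ik.
by case: h; exists (s k) => //; apply: map_f; rewrite mem_enum.
Qed.

End Components.

Section TensorInduction.
Variables (R S : comNzRingType) (f : {rmorphism R -> S}) (M : lmodType R).

Lemma tens_ind (P : tens f M -> Prop) : P 0 ->
  (forall x y, P x -> P y -> P (x + y)) -> (forall s m, P (pure f s m)) ->
  forall x, P x.
Proof. by move=> P0 PD Pp x; rewrite [x]tensE; elim/big_ind: _. Qed.

Lemma pureDr s (u v : M) : pure f s (u + v) = pure f s u + pure f s v.
Proof. by case: (pure_balanced f M). Qed.
Lemma pureDl s t (v : M) : pure f (s + t) v = pure f s v + pure f t v.
Proof. by case: (pure_balanced f M). Qed.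
Lemma pureZ s a (v : M) : pure f (s * f a) v = pure f s (a *: v).
Proof. by case: (pure_balanced f M). Qed.
Lemma pure0r s : pure f s (0 : M) = 0.
Proof. exact: (balanced0r _ (pure_balanced f M)). Qed.
Lemma pure1s s (v : M) : pure f s v = s *: pure f 1 v.
Proof. by rewrite scale_pure mulr1. Qed.

(** Independence holds because the coordinate functions on [U], composed with
    the projection [p], extend to the tensor product. *)
Lemma tens_span_basis (U : set M) (p : M -> M) n (e : 'I_n -> M) :
  is_submodule U -> linear p -> (forall v, U (p v)) ->
  (forall v, U v -> p v = v) -> is_basis U e ->
  is_basis (tens_span f U) (fun i => pure f 1 (e i)).
Proof.
move=> Us pL Up pU he; set e' := fun i => _.
have /choice[x xE] : forall v, exists c, p v = lincomb e c.
  by move=> v; exact: (basis_span he).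
have xL : linear x.
  move=> a u v; apply: (basis_inj he Us).
  by rewrite lincombL -!xE pL.
have bE (s : S) c : s *: lincomb e' (map_mx f c) = pure f s (lincomb e c).
  rewrite /lincomb (big_morph _ (pureDr s) (pure0r s)) scaler_sumr.
  by apply: eq_bigr => i _; rewrite /e' !scale_pure mulr1 mxE pureZ.
apply: basis_intro.
- move=> i; exists [:: (1, e i)]; rewrite big_seq1; split=> // q.
  by rewrite inE => /eqP -> /=; case: he.
- move=> w [t [ht ->]]; elim: t ht => [|[s v] t IH] ht.
    by exists 0; rewrite big_nil (lin0 (lincombL _)).
  have [|c E] := IH; first by move=> q qt; apply: ht; rewrite inE qt orbT.
  exists (s *: map_mx f (x v) + c); rewrite big_cons E lincombL bE -xE pU //.
  by apply: (ht (s, v)); rewrite inE eqxx.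
- move=> c c0; apply/rowP => i.
  have bb : balanced f (fun s v => s * f (x v 0 i)).
    split=> [s s' v|s v v'|s r v]; first by rewrite mulrDl.
    - by rewrite (linD xL) mxE rmorphD mulrDr.
    - by rewrite (linZ xL) mxE rmorphM mulrA.
  have xe j : x (e j) = delta_mx 0 j.
    by apply: (basis_inj he Us); rewrite -xE lincomb_delta pU //; case: he.
  have := congr1 (tev (fun s v => s * f (x v 0 i))) c0.
  rewrite tev0 // /lincomb tev_sum // mxE => <-.
  rewrite (bigD1 i) //= big1 => [|j ji];
    rewrite /e' scale_pure mulr1 tev_pure // xe mxE.
    by rewrite !eqxx rmorph1 mulr1 addr0.
  by rewrite [i == j]eq_sym (negbTE ji) andbF rmorph0 mulr0.
Qed.

Lemma tens_spanT : tens_span f (setT : set M) = setT.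
Proof.
by apply/seteqP; split=> // x _; exists (repr x); split=> //; exact: tensE.
Qed.

Lemma tens_finite_free : finite_free M -> finite_free (tens f M).
Proof.
move=> [n [e he]]; exists n, (fun i => pure f 1 (e i)); rewrite -tens_spanT.
exact: (@tens_span_basis _ id).
Qed.

End TensorInduction.

(** A copy of [V], to carry the [S]-module structure obtained by restricting
    scalars along [g] beside its own structure. *)
Definition rs (S S' : comNzRingType) (g : {rmorphism S -> S'}) (V : lmodType S')
  : Type := V.

Section Restriction.
Variables (S S' : comNzRingType) (g : {rmorphism S -> S'}) (V : lmodType S').
HB.instance Definition _ := GRing.Zmodule.on (rs g V).
Definition rs_scale (s : S) (v : rs g V) : rs g V := g s *: (v : V).
Lemma rs_scaleA a b v : rs_scale a (rs_scale b v) = rs_scale (a * b) v.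
Proof. by rewrite /rs_scale scalerA rmorphM. Qed.
Lemma rs_scale1 : left_id 1 rs_scale.
Proof. by move=> v; rewrite /rs_scale rmorph1 scale1r. Qed.
Lemma rs_scaleDr : right_distributive rs_scale +%R.
Proof. by move=> a u v; rewrite /rs_scale scalerDr. Qed.
Lemma rs_scaleDl v : {morph rs_scale^~ v : a b / a + b}.
Proof. by move=> a b; rewrite /rs_scale rmorphD scalerDl. Qed.
HB.instance Definition _ := GRing.Zmodule_isLmodule.Build S (rs g V)
  rs_scaleA rs_scale1 rs_scaleDr rs_scaleDl.

Lemma rsZ (s : S) (v : rs g V) : s *: v = g s *: (v : V). Proof. by []. Qed.

Lemma rs_linear (phi : V -> V) : linear phi -> linear (phi : rs g V -> rs g V).
Proof. by move=> h a u v; rewrite rsZ h. Qed.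

End Restriction.

Arguments rs_linear {S S'} g {V phi}.

Notation gmodule f Hg := (gmod (tens_in f _) (ext_grading f Hg)).

Section HAction.
Variables (R S : comNzRingType) (f : {rmorphism R -> S}) (H : algType R).
Variable Hg : int -> set H.

(** Modules over [S (x)_R H] are built and compared through the action of [H]
    alone. *)
Record is_hact (M : lmodType S) (ha : H -> M -> M) : Prop := IsHact {
  haD : forall h h' v, ha (h + h') v = ha h v + ha h' v;
  haL : forall h, linear (ha h);
  ha1 : forall v, ha 1 v = v;
  haM : forall h h' v, ha (h * h') v = ha h (ha h' v);
  haZ : forall r h v, ha (r *: h) v = f r *: ha h v }.

Section Make.
Variables (M : lmodType S) (ha : H -> M -> M) (Hha : is_hact ha).
Variables (Mf : finite_free M) (d : int -> set M) (dd : direct_sum d).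
Hypothesis dh : forall i j h v, Hg i h -> d j v -> d (i + j) (ha h v).

Definition ha_act (x : tens f H) (v : M) : M := tev (fun s h => s *: ha h v) x.

Lemma ha_balanced v : balanced f (fun s h => s *: ha h v).
Proof.
split=> [s s' h|s h h'|s r h]; first by rewrite scalerDl.
- by rewrite (haD Hha) scalerDr.
- by rewrite (haZ Hha) scalerA.
Qed.

Lemma ha_act_pure s h v : ha_act (pure f s h) v = s *: ha h v.
Proof. by rewrite /ha_act tev_pure //; exact: ha_balanced. Qed.

Lemma ha_actD x y v : ha_act (x + y) v = ha_act x v + ha_act y v.
Proof. by rewrite /ha_act tevD //; exact: ha_balanced. Qed.

Lemma ha_act0 v : ha_act 0 v = 0.
Proof. by rewrite /ha_act tev0 //; exact: ha_balanced. Qed.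

Lemma ha_actL x : linear (ha_act x).
Proof.
elim/tens_ind: x => [|x y hx hy|s h] a u v.
- by rewrite !ha_act0 scaler0 addr0.
- by rewrite !ha_actD hx hy scalerDr addrACA.
- by rewrite !ha_act_pure (haL Hha) scalerDr !scalerA mulrC.
Qed.

Lemma ha_action : is_action (tens_in f H) ha_act.
Proof.
split=> [|||x y v|a v]; [exact: ha_actD|exact: ha_actL|..].
- by move=> v; rewrite ha_act_pure scale1r (ha1 Hha).
- elim/tens_ind: x => [|x x' hx hx'|s h].
  + by rewrite mul0r !ha_act0.
  + by rewrite mulrDl !ha_actD hx hx'.
  elim/tens_ind: y => [|y y' hy hy'|s' h'].
  + by rewrite mulr0 !ha_act0 (lin0 (ha_actL _)).
  + by rewrite mulrDr !ha_actD hy hy' (linD (ha_actL _)).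
  rewrite pureM !ha_act_pure (haM Hha) (linZ (haL Hha _)) scalerA.
  by [].
- by rewrite ha_act_pure (ha1 Hha).
Qed.

Lemma ha_deg i j x v : ext_grading f Hg i x -> d j v -> d (i + j) (ha_act x v).
Proof.
move=> [t [ht ->]] dv; elim: t ht => [|[s h] t IH] ht.
  by rewrite big_nil ha_act0; exact: (sub0 (deg_sub dd _)).
have ds := deg_sub dd (i + j).
rewrite big_cons ha_actD; apply: subD => //.
  rewrite ha_act_pure; apply: subZ => //; apply: dh => //.
  by apply: (ht (s, h)); rewrite inE eqxx.
by apply: IH => q qt; apply: ht; rewrite inE qt orbT.
Qed.

Definition mk_gmod : gmodule f Hg :=
  @GMod _ _ (tens_in f H) (ext_grading f Hg) (FMod ha_action Mf) d dd ha_deg.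

End Make.

Section Use.
Variable V : gmodule f Hg.

Definition hact (h : H) (v : V) : V := act (pure f 1 h) v.

Lemma act_pure s h (v : V) : act (pure f s h) v = s *: hact h v.
Proof.
rewrite -(actZ (actP V)) -(actM (actP V)) /tens_in pureM mulr1 mul1r //.
Qed.

Lemma act0l (v : V) : act (0 : tens f H) v = 0.
Proof. by apply: (addIr (act (0 : tens f H) v));
  rewrite -(actDl (actP V)) !add0r. Qed.

Lemma act_scale (s : S) (x : tens f H) (v : V) :
  act (s *: x : tens f H) v = s *: act x v.
Proof.
elim/tens_ind: x => [|x y hx hy|s' h]; first by rewrite scaler0 act0l scaler0.
  by rewrite scalerDr !(actDl (actP V)) hx hy scalerDr.
by rewrite scale_pure !act_pure scalerA.
Qed.

Lemma hactP : is_hact hact.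
Proof.
split.
- by move=> h h' v; rewrite /hact pureDr (actDl (actP V)).
- by move=> h; exact: (actL (actP V)).
- by move=> v; exact: (act1 (actP V)).
- by move=> h h' v; rewrite /hact -(actM (actP V)) pureM mulr1.
- by move=> r h v; rewrite {1}/hact -pureZ mul1r act_pure.
Qed.

Lemma hactL h : linear (hact h). Proof. exact: (haL hactP). Qed.

Lemma hact0l v : hact 0 v = 0.
Proof. by have := haZ hactP 0 0 v; rewrite scale0r rmorph0 scale0r. Qed.

Lemma hact_suml I (r : seq I) (P : pred I) (F : I -> H) v :
  hact (\sum_(i <- r | P i) F i) v = \sum_(i <- r | P i) hact (F i) v.
Proof.
exact: (big_morph (hact^~ v) (fun h h' => haD hactP h h' v) (hact0l v)).
Qed.

Lemma hact_deg i j h (v : V) : Hg i h -> deg j v -> deg (i + j) (hact h v).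
Proof.
move=> Hh dv; apply: deg_act => //; exists [:: (1, h)]; rewrite big_seq1.
by split=> // q; rewrite inE => /eqP ->.
Qed.

Lemma deg0_stable i h (v : V) : Hg 0 h -> deg i v -> deg i (hact h v).
Proof. by move=> Hh dv; rewrite -[i]add0r; exact: hact_deg. Qed.

Lemma pr_hact i j h (v : V) : Hg i h ->
  pr (deg_sum V) (i + j) (hact h v) = hact h (pr (deg_sum V) j v).
Proof.
move=> Hh; elim/(homog_ind (deg_sum V)): v => [|u v hu hv|k v dv].
- by rewrite !(lin0 (hactL h)) !(lin0 (prL _ _)) (lin0 (hactL h)).
- rewrite (linD (hactL h)) !(linD (prL _ _)) (linD (hactL h)).
  by rewrite -hu -hv.
- rewrite (pr_deg _ _ (hact_deg Hh dv)) (pr_deg _ _ dv) (inj_eq (addrI i)).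
  by case: eqP => // _; rewrite (lin0 (hactL h)).
Qed.

End Use.

Lemma hact_mk M ha Hha Mf d dd dh h v :
  hact h (v : @mk_gmod M ha Hha Mf d dd dh) = ha h v.
Proof. by rewrite /hact [LHS]ha_act_pure // scale1r. Qed.

Lemma gmorI (V W : gmodule f Hg) (phi : V -> W) : linear phi ->
  (forall h v, phi (hact h v) = hact h (phi v)) ->
  (forall i v, deg i v -> deg i (phi v)) -> is_gmor phi.
Proof.
move=> pL pH pD; split=> // b v.
elim/tens_ind: b => [|x y hx hy|s h]; first by rewrite !act0l (lin0 pL).
  by rewrite !(actDl (actP _)) (linD pL) hx hy.
by rewrite !act_pure (linZ pL) pH.
Qed.

Lemma gmor_hact (V W : gmodule f Hg) (phi : V -> W) h v :
  is_gmor phi -> phi (hact h v) = hact h (phi v).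
Proof. by case=> _ + _; apply. Qed.

Lemma gmor_lin (V W : gmodule f Hg) (phi : V -> W) : is_gmor phi -> linear phi.
Proof. by case. Qed.

Lemma gmor_deg (V W : gmodule f Hg) (phi : V -> W) i v :
  is_gmor phi -> deg i v -> deg i (phi v).
Proof. by case=> _ _; apply. Qed.

Lemma gmor_pr (V W : gmodule f Hg) (phi : V -> W) i v : is_gmor phi ->
  pr (deg_sum W) i (phi v) = phi (pr (deg_sum V) i v).
Proof.
move=> hp; have pL := gmor_lin hp.
elim/(homog_ind (deg_sum V)): v => [|u v hu hv|k v dv].
- by rewrite (lin0 pL) !(lin0 (prL _ _)) (lin0 pL).
- by rewrite (linD pL) !(linD (prL _ _)) (linD pL) hu hv.
- rewrite (pr_deg _ _ (gmor_deg hp dv)) (pr_deg _ _ dv).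
  by case: eqP => // _; rewrite (lin0 pL).
Qed.

End HAction.

Arguments hact {R S f H Hg V} h v.

Section GradedSubmodules.
Variables (R S S' : comNzRingType) (f' : {rmorphism R -> S'}).
Variables (g : {rmorphism S -> S'}) (H : algType R) (Hg : int -> set H).
Variable V : gmodule f' Hg.

(** Stability under scalars is only asked for those coming from [S], so that
    lattices and [LH]-submodules of [kH]-modules are covered together with
    graded submodules in the usual sense, for which [g] is the identity. *)
Definition gsub (U : set V) : Prop := [/\ is_submodule (U : set (rs g V)),
  forall i v, U v -> U (pr (deg_sum V) i v) & forall h v, U v -> U (hact h v)].

Hypothesis Hd : direct_sum Hg.

Lemma gsubI (U : set V) : is_submodule (U : set (rs g V)) ->
  (forall i v, U v -> U (pr (deg_sum V) i v)) ->
  (forall i h v, Hg i h -> U v -> U (hact h v)) -> gsub U.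
Proof.
move=> Us Up Uh; split=> // h v Uv; elim/(homog_ind Hd): h => [|h h' ? ?|i h].
- by rewrite hact0l; exact: (sub0 Us).
- by rewrite (haD (hactP V)); exact: (subD Us).
- by move=> /Uh; apply.
Qed.

End GradedSubmodules.

(** * Submodules, quotients and base change *)

Section Restrict.
Variables (R S S' : comNzRingType) (f : {rmorphism R -> S}).
Variables (f' : {rmorphism R -> S'}) (g : {rmorphism S -> S'}).
Hypothesis gf : forall r, g (f r) = f' r.
Variables (H : algType R) (Hg : int -> set H).

(** An injective [semimor] presents [M] as an [S]-submodule of [V]: a lattice,
    or an [LH]-submodule of a [kH]-module. *)
Definition semimor (M : gmodule f Hg) (V : gmodule f' Hg) (io : M -> V)
  : Prop :=
  [/\ linear (io : M -> rs g V), forall h m, io (hact h m) = hact h (io m) &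
      forall i m, deg i m -> deg i (io m)].

Section Sub.
Variables (V : gmodule f' Hg) (U : set V) (n : nat) (e : 'I_n -> rs g V).
Hypotheses (Ug : gsub g U) (he : is_basis (U : set (rs g V)) e).

Let Us : is_submodule (U : set (rs g V)). Proof. by case: Ug. Qed.
Let io : 'rV[S]_n -> rs g V := lincomb e.
Let iL : linear io. Proof. exact: lincombL. Qed.
Let ii : injective io. Proof. exact: (basis_inj he Us). Qed.
Let iU c : U (io c). Proof. by apply: sub_lincomb => // i; case: he. Qed.

Lemma restrict_coord : exists ka : V -> 'rV[S]_n, forall v, U v ->
  io (ka v) = v.
Proof.
suff /choice[ka kaP] : forall v : V, exists c, U v -> io c = v by exists ka.
move=> v; have [/(basis_span he)[c ->]|nU] := pselect (U v); first by exists c.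
by exists 0.
Qed.

(** The carrier is [S^n], on which the action and the grading are those of [U]
    read in the basis [e]. *)
Lemma restrict : exists (M : gmodule f Hg) (j : M -> V),
  [/\ semimor j, injective j & forall v, U v <-> exists m, j m = v].
Proof.
have [ka kaK] := restrict_coord.
have [_ Up Uh] := Ug.
pose ha h c := ka (hact h (io c)).
have haE h c : io (ha h c) = hact h (io c) by apply/kaK/Uh/iU.
have Hha : is_hact f ha.
  split.
  - by move=> h h' c; apply: ii; rewrite (linD iL) !haE (haD (hactP V)).
  - move=> h a u v; apply: ii; rewrite iL !haE iL.
    by rewrite !rsZ (hactL h).
  - by move=> v; apply: ii; rewrite haE (ha1 (hactP V)).
  - by move=> h h' v; apply: ii; rewrite !haE (haM (hactP V)).
  - by move=> r h v; apply: ii; rewrite (linZ iL) !haE (haZ (hactP V)) rsZ gf.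
pose d i c := deg i (io c : V).
pose q i c := ka (pr (deg_sum V) i (io c)).
have qE i c : io (q i c) = pr (deg_sum V) i (io c) by apply/kaK/Up/iU.
have dd : direct_sum d.
  apply: (@direct_sum_intro _ _ _ q).
  - move=> i; have ds := deg_sub (deg_sum V) i.
    split; first by rewrite /d (lin0 iL); exact: (sub0 ds).
    by move=> a u v du dv; rewrite /d iL; exact: ds.2.
  - by move=> i u v; apply: ii;
    rewrite (linD iL) !qE (linD iL) (linD (prL _ _)).
  - move=> c; have [s [us ps E]] := pr_finsum (deg_sum V) (io c).
    exists s; split=> // [i /ps pi|]; first by apply: ii;
      rewrite qE pi (lin0 iL).
    apply: ii; rewrite (lin_sum iL) [LHS]E; apply: eq_bigr => i _.
    by rewrite qE.
  - by move=> i c; rewrite /d qE; exact: pr_in.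
  - move=> i j c dc; apply: ii; rewrite qE (pr_deg (deg_sum V) i dc).
    by case: eqP => // _; rewrite (lin0 iL).
have Mf : finite_free 'rV[S]_n.
  exists n, (fun i => delta_mx 0 i).
  have bE c : lincomb (fun i => delta_mx 0 i) c = c :> 'rV[S]_n.
    by rewrite [RHS]row_sum_delta.
  by apply: basis_intro => // [c _|c]; [exists c|]; rewrite bE.
have dh i j h c : Hg i h -> d j c -> d (i + j) (ha h c).
  by move=> Hh dc; rewrite /d haE; exact: hact_deg.
exists (mk_gmod Hha Mf dd dh), io; split.
- by split=> // h m; rewrite hact_mk haE.
- exact: ii.
- move=> v; split=> [Uv|[m <-]]; last exact: iU.
  by exists (ka v); exact: kaK.
Qed.

End Sub.

Section BaseChangeMap.
Variables (M : gmodule f Hg) (V : gmodule f' Hg) (j : M -> V).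
Hypothesis jm : semimor j.

Definition bcmap (w : base_change gf M) : V := tev (fun s m => s *: j m) w.

Lemma bcmap_balanced : balanced g (fun s m => s *: j m).
Proof.
have [jL _ _] := jm; split=> [s s' m|s m m'|s r m]; first by rewrite scalerDl.
- by rewrite (linD jL) scalerDr.
- by rewrite (linZ jL) rsZ scalerA.
Qed.

Lemma bcmap_pure s m : bcmap (pure g s m) = s *: j m.
Proof. by rewrite /bcmap tev_pure //; exact: bcmap_balanced. Qed.

Lemma bcmapD (x y : tens g M) : bcmap (x + y) = bcmap x + bcmap y.
Proof. by rewrite /bcmap tevD //; exact: bcmap_balanced. Qed.

Lemma bcmap0 : bcmap (0 : tens g M) = 0.
Proof. by rewrite /bcmap tev0 //; exact: bcmap_balanced. Qed.

Lemma bcmapZ a (x : tens g M) : bcmap (a *: x) = a *: bcmap x.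
Proof.
elim/tens_ind: x => [|x y hx hy|s m]; first by rewrite scaler0 bcmap0 scaler0.
  by rewrite scalerDr !bcmapD hx hy scalerDr.
by rewrite scale_pure !bcmap_pure scalerA.
Qed.

Lemma bcmapL : linear bcmap.
Proof. by move=> a u v; rewrite bcmapD bcmapZ. Qed.

Lemma hact_bc h s m :
  hact h (pure g s m : base_change gf M) = pure g s (hact h m).
Proof.
rewrite /hact [LHS]/(bc_act _ _) /bc_act.
rewrite tev_pure ?tev_pure; [|exact: bc_elt_balanced|exact: bc_balanced].
by rewrite /bc_elt mul1r.
Qed.

Lemma bcmap_gmor : is_gmor bcmap.
Proof.
have [jL jh jd] := jm.
apply: gmorI; first exact: bcmapL.
- move=> h w; elim/tens_ind: w => [|x y hx hy|s m].
  + by rewrite (lin0 (hactL h)) bcmap0 (lin0 (hactL h)).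
  + by rewrite (linD (hactL h)) !bcmapD (linD (hactL h)) hx hy.
  + by rewrite hact_bc !bcmap_pure jh (linZ (hactL h)).
- move=> i w [t [ht ->]]; have ds := deg_sub (deg_sum V) i.
  rewrite (lin_sum bcmapL) big_seq; apply: sub_sum => // q qt.
  by rewrite bcmap_pure; apply: subZ => //; apply/jd/ht.
Qed.

(** A basis of [M] becomes a basis of the base change, so that injectivity means
    that [M] and [V] agree about independence. *)
Lemma bcmap_inj n (d : 'I_n -> M) : is_basis setT d ->
  (forall c : 'rV[S']_n, lincomb (j \o d) c = 0 -> c = 0) -> injective bcmap.
Proof.
move=> hd ind; apply: lin_inj; first exact: bcmapL.
have he : is_basis (setT : set (tens g M)) (fun i => pure g 1 (d i)).
  by rewrite -tens_spanT; apply: (@tens_span_basis _ _ _ _ _ id).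
move=> w; have [c ->] := basis_span he (I : setT w).
rewrite (lin_lincomb _ _ bcmapL) => c0; rewrite (ind c) ?(lin0 (lincombL _)) //.
rewrite -[RHS]c0; apply: eq_bigr => i _ /=.
by rewrite bcmap_pure scale1r.
Qed.

End BaseChangeMap.

End Restrict.

Section TensorMap.
Variables (S S' : comNzRingType) (g : {rmorphism S -> S'}).

Definition tmap (M N : lmodType S) (phi : M -> N) (x : tens g M) : tens g N :=
  tev (fun s m => pure g s (phi m)) x.

Section Linear.
Variables (M N : lmodType S) (phi : M -> N).
Hypothesis pL : linear phi.

Lemma tmap_balanced : balanced g (fun s m => pure g s (phi m)).
Proof.
split=> [s s' m|s m m'|s r m]; first exact: pureDl.
- by rewrite (linD pL) pureDr.
- by rewrite (linZ pL) pureZ.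
Qed.

Lemma tmap_pure s m : tmap phi (pure g s m) = pure g s (phi m).
Proof. by rewrite /tmap tev_pure //; exact: tmap_balanced. Qed.

Lemma tmapD x y : tmap phi (x + y) = tmap phi x + tmap phi y.
Proof. by rewrite /tmap tevD //; exact: tmap_balanced. Qed.

Lemma tmap0 : tmap phi 0 = 0.
Proof. by rewrite /tmap tev0 //; exact: tmap_balanced. Qed.

Lemma tmapL : linear (tmap phi).
Proof.
move=> a x y; rewrite tmapD; congr (_ + _).
elim/tens_ind: x => [|x x' hx hx'|s m]; first by rewrite scaler0 tmap0 scaler0.
  by rewrite scalerDr !tmapD hx hx' scalerDr.
by rewrite scale_pure !tmap_pure scale_pure.
Qed.

End Linear.

Lemma tmap_comp (M N P : lmodType S) (phi : M -> N) (psi : N -> P) x :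
  linear phi -> linear psi -> tmap psi (tmap phi x) = tmap (psi \o phi) x.
Proof.
move=> pL qL; have cL : linear (psi \o phi) by move=> a u v; rewrite /= pL qL.
elim/tens_ind: x => [|x y hx hy|s m]; first by rewrite !tmap0.
  by rewrite !tmapD // hx hy.
by rewrite !tmap_pure.
Qed.

Lemma tmap_id (M : lmodType S) (phi : M -> M) x :
  linear phi -> phi =1 id -> tmap phi x = x.
Proof.
move=> pL p1; elim/tens_ind: x => [|x y hx hy|s m]; first by rewrite !tmap0.
  by rewrite !tmapD // hx hy.
by rewrite tmap_pure // p1.
Qed.

Lemma tmap_sum (M N : lmodType S) (phi psi chi : M -> N) x :
  linear phi -> linear psi -> linear chi -> (forall m, chi m = phi m + psi m) ->
  tmap chi x = tmap phi x + tmap psi x.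
Proof.
move=> pL qL cL cE; elim/tens_ind: x => [|x y hx hy|s m].
- by rewrite !tmap0 // addr0.
- by rewrite !tmapD // hx hy addrACA.
- by rewrite !tmap_pure // cE pureDr.
Qed.

Lemma tmap_zero (M N : lmodType S) (phi : M -> N) x :
  linear phi -> (forall m, phi m = 0) -> tmap phi x = 0.
Proof.
move=> pL p0; elim/tens_ind: x => [|x y hx hy|s m]; first by rewrite !tmap0.
  by rewrite !tmapD // hx hy addr0.
by rewrite tmap_pure // p0 pure0r.
Qed.

End TensorMap.

Arguments tmap {S S'} g {M N} phi x.

Section BaseChangeFunctor.
Variables (R S S' : comNzRingType) (f : {rmorphism R -> S}).
Variables (f' : {rmorphism R -> S'}) (g : {rmorphism S -> S'}).
Hypothesis gf : forall r, g (f r) = f' r.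
Variables (H : algType R) (Hg : int -> set H).

Lemma tmap_gmor (V W : gmodule f Hg) (phi : V -> W) : is_gmor phi ->
  is_gmor (tmap g phi : base_change gf V -> base_change gf W).
Proof.
move=> hp; have pL := gmor_lin hp.
have tL := @tmapL _ _ g _ _ _ pL.
apply: gmorI => // [h w|i w [t [ht ->]]].
  elim/tens_ind: w => [|x y hx hy|s m].
  - by rewrite (lin0 (hactL h)) tmap0 // (lin0 (hactL h)).
  - by rewrite (linD (hactL h)) !tmapD // (linD (hactL h)) hx hy.
  - by rewrite hact_bc !tmap_pure // hact_bc (gmor_hact _ _ hp).
exists [seq (q.1, phi q.2) | q <- t]; split.
  by move=> _ /mapP[q /ht qt ->]; exact: gmor_deg.
by rewrite big_map (lin_sum tL); apply: eq_bigr => q _; rewrite tmap_pure.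
Qed.

End BaseChangeFunctor.

Section FieldSequences.
Variable F : fieldType.

Lemma exact_splitting (M' M M'' : lmodType F) (al : M' -> M) (be : M -> M'') :
  finite_free M'' -> linear al -> linear be -> injective al ->
  (forall w, exists v, be v = w) ->
  (forall v, be v = 0 <-> exists u, al u = v) ->
  exists (r : M -> M') (s : M'' -> M),
  [/\ linear r, linear s, forall u, r (al u) = u, forall w, be (s w) = w &
      forall v, v = al (r v) + s (be v)].
Proof.
move=> [n [e he]] aL bL ai bs ex.
have [x [xL [xE _]]] := is_basis_coord he.
have /choice[l lE] : forall i, exists v, be v = e i by move=> i; exact: bs.
pose s w := lincomb l (x w).
have sL : linear s by move=> a u v; rewrite /s xL lincombL.
have bsK w : be (s w) = w.
  rewrite /s (lin_lincomb _ _ bL) [RHS]xE; apply: eq_bigr => i _.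
  by rewrite /= lE.
have /choice[r rE] : forall v, exists u, al u = v - s (be v).
  by move=> v; apply/ex; rewrite (linB bL) bsK subrr.
exists r, s; split=> //.
- move=> a u v; apply: ai; rewrite rE aL !rE bL sL scalerBr.
  by rewrite opprD addrACA.
- move=> u; apply: ai; rewrite rE.
  have -> : be (al u) = 0 by apply/ex; exists u.
  by rewrite (lin0 sL) subr0.
- by move=> v; rewrite rE subrK.
Qed.

End FieldSequences.

Section GradedOverField.
Variables (R : comNzRingType) (F : fieldType) (f : {rmorphism R -> F}).
Variables (H : algType R) (Hg : int -> set H).
Implicit Types V W : gmodule f Hg.

Notation gsubf := (@gsub R F F f idfun H Hg _).

Lemma gsub_submodule V (U : set V) : gsubf U -> is_submodule U.
Proof. by case=> [[U0 U1] _ _]. Qed.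

Lemma sub_gmod V (U : set V) : gsubf U ->
  exists (M : gmodule f Hg) (j : M -> V),
  [/\ is_gmor j, injective j & forall v, U v <-> exists m, j m = v].
Proof.
move=> Ug; have [n [e he]] := submodule_basis (fmod_free V) (gsub_submodule Ug).
have [|M [j [[jL jh jd] ji jU]]] :=
  @restrict _ _ _ f f idfun _ _ _ _ _ _ e Ug he.
  by [].
by exists M, j; split=> //; exact: gmorI.
Qed.

(** The action and the projections of [V] pass to a complement of [U], modelled
    on [F^m], along a linear section of the quotient map. *)
Lemma quotient_gmod V (U : set V) : gsubf U ->
  exists (Q : gmodule f Hg) (p : V -> Q),
  [/\ is_gmor p, forall w, exists v, p v = w & forall v, U v <-> p v = 0].
Proof.
move=> Ug; have Us := gsub_submodule Ug; have [_ Up Uh] := Ug.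
have [m [p [s [pL sL sK pU]]]] := quotient_map (fmod_free V) Us.
have pE u v : U (u - v) -> p u = p v.
  by move=> /pU; rewrite (linB pL) => /eqP; rewrite subr_eq0 => /eqP.
have sp v : U (s (p v) - v) by apply/pU; rewrite (linB pL) sK subrr.
pose ha h z := p (hact h (s z)).
have haE h v : ha h (p v) = p (hact h v).
  by apply: pE; rewrite -(linB (hactL h)); exact/Uh/sp.
have Hha : is_hact f ha.
  split.
  - by move=> h h' z; rewrite /ha (haD (hactP V)) (linD pL).
  - by move=> h a u v; rewrite /ha sL (hactL h) pL.
  - by move=> z; rewrite /ha (ha1 (hactP V)) sK.
  - by move=> h h' z; rewrite -[ha h' z]/(p (hact h' (s z))) haE /ha (haM
    (hactP V)).
  - by move=> r h z; rewrite /ha (haZ (hactP V)) (linZ pL).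
pose d i z := exists2 v, deg i v & p v = z.
pose q i z := p (pr (deg_sum V) i (s z)).
have qE i v : q i (p v) = p (pr (deg_sum V) i v).
  by apply: pE; rewrite -(linB (prL _ _)); exact/Up/sp.
have dd : direct_sum d.
  apply: (@direct_sum_intro _ _ _ q).
  - move=> i; have ds := deg_sub (deg_sum V) i.
    split; first by exists 0; [exact: (sub0 ds)|exact: (lin0 pL)].
    by move=> a _ _ [u du <-] [v dv <-]; exists (a *: u + v);
      [exact: ds.2|exact: pL].
  - by move=> i u v; rewrite /q (linD sL) (linD (prL _ _)) (linD pL).
  - move=> z; have [l [ul pl E]] := pr_finsum (deg_sum V) (s z).
    exists l; split=> // [i /pl li|]; first by rewrite /q li (lin0 pL).
    by rewrite -[LHS]sK E (lin_sum pL).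
  - by move=> i z; exists (pr (deg_sum V) i (s z)) => //; exact: pr_in.
  - move=> i j _ [v dv <-]; rewrite qE (pr_deg (deg_sum V) i dv).
    by case: eqP => // _; rewrite (lin0 pL).
have Mf : finite_free 'rV[F]_m.
  exists m, (fun i => delta_mx 0 i).
  have bE c : lincomb (fun i => delta_mx 0 i) c = c :> 'rV[F]_m.
    by rewrite [RHS]row_sum_delta.
  by apply: basis_intro => // [c _|c]; [exists c|]; rewrite bE.
have dh i j h z : Hg i h -> d j z -> d (i + j) (ha h z).
  move=> Hh [v dv <-]; rewrite haE; exists (hact h v) => //.
  exact: hact_deg.
exists (mk_gmod Hha Mf dd dh), p; split=> // [|w]; last by exists (s w).
by apply: gmorI => // [h v|i v dv]; [rewrite hact_mk haE|exists v].
Qed.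

Definition gdim V : nat := sval (cid (fmod_free V)).

Lemma gdimP V : exists e : 'I_(gdim V) -> V, is_basis setT e.
Proof. by rewrite /gdim; case: (cid _). Qed.

Lemma gdim_eq V n (e : 'I_n -> V) : is_basis setT e -> n = gdim V.
Proof.
move=> he; have [d hd] := gdimP V; apply/eqP; rewrite eqn_leq.
have iL : linear (@id V) by [].
have ii : injective (@id V) by [].
by rewrite (free_inj_le iL ii he hd).1 (free_inj_le iL ii hd he).1.
Qed.

Lemma gdim_lt V W (phi : V -> W) (w : W) : linear phi -> injective phi ->
  (forall v, phi v <> w) -> (gdim V < gdim W)%N.
Proof.
move=> pL pI nw; have [d hd] := gdimP V; have [e he] := gdimP W.
have [le eq] := free_inj_le pL pI hd he.
rewrite ltn_neqAle le andbT; apply/eqP => /eq/(_ w)[v]; exact: nw.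
Qed.

Lemma gdim_exact V' V V'' : short_exact V' V V'' ->
  gdim V = (gdim V' + gdim V'')%N.
Proof.
move=> [al [be [aM bM ai bs ex]]]; have [e' he'] := gdimP V'.
have [e'' he''] := gdimP V''.
have /choice[l lE] : forall i, exists v, be v = e'' i by move=> i; exact: bs.
have sT (W : gmodule f Hg) : is_submodule (setT : set W) by [].
symmetry; apply: gdim_eq.
apply: (@basis_ext _ _ _ _ al be setT setT setT _ _ e' e'' l) => //.
- exact: gmor_lin aM.
- exact: gmor_lin bM.
- by move=> v _; apply/ex; exists v.
- by move=> v _ /ex[u <-]; exists u.
Qed.

End GradedOverField.

(** * The Grothendieck group *)

Section GrothendieckGroup.
Variables (R : comNzRingType) (B : pzRingType) (eta : {rmorphism R -> B}).
Variable g : int -> set B.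
Notation G := (gmod eta g).

(** The group laws are stated for the bare type [R0]: its elements are classes
    of modules, and live in a universe above the one of algebraic structures. *)
Definition r0_opp (X : R0 eta g) : R0 eta g :=
  r0_cls ((r0_repr X).2, (r0_repr X).1).

Lemma r0_addA : associative (@r0_add _ _ eta g).
Proof.
move=> X Y Z; rewrite -[X]r0_reprK -[Y]r0_reprK -[Z]r0_reprK.
by rewrite !r0_addE /= !catA.
Qed.

Lemma r0_addC : commutative (@r0_add _ _ eta g).
Proof.
move=> X Y; rewrite -[X]r0_reprK -[Y]r0_reprK !r0_addE.
apply/r0_clsP; exists [::]; rewrite /= !cats0.
by apply: add_eq_cat2; exact: add_eq_catC.
Qed.

Lemma r0_add0 : left_id (r0_zero eta g) (@r0_add _ _ eta g).
Proof. by move=> X; rewrite -[X]r0_reprK r0_addE; case: (r0_repr X). Qed.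

Lemma r0_addN : left_inverse (r0_zero eta g) r0_opp (@r0_add _ _ eta g).
Proof.
move=> X; rewrite -{2}[X]r0_reprK /r0_opp r0_addE.
apply/r0_clsP; exists [::]; rewrite /= !cats0; exact: add_eq_catC.
Qed.

Lemma r0_addI (X Y Z : R0 eta g) : r0_add X Y = r0_add X Z -> Y = Z.
Proof.
move=> /(congr1 (r0_add (r0_opp X))).
by rewrite !r0_addA r0_addN !r0_add0.
Qed.

Lemma r0_addACA (X Y Z T : R0 eta g) :
  r0_add (r0_add X Y) (r0_add Z T) = r0_add (r0_add X Z) (r0_add Y T).
Proof. by rewrite !r0_addA -(r0_addA X) (r0_addC Y) r0_addA. Qed.

Lemma gcls_exact (V' V V'' : G) :
  short_exact V' V V'' -> gcls V = r0_add (gcls V') (gcls V'').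
Proof.
move=> h; rewrite r0_addE; apply/r0_clsP; exists [::].
exact: add_eq_exact.
Qed.

Lemma gcls_iso (V W : G) (phi : V -> W) : is_gmor phi -> injective phi ->
  (forall w, exists v, phi v = w) -> gcls V = gcls W.
Proof.
move=> pM pI pS; rewrite -[LHS]r0_add0 r0_addC -gcls_zero; symmetry;
  apply: gcls_exact.
exists phi, (fun=> 0); split=> //.
- by split=> [a u v|b v|//]; exact: zero_eq.
- by move=> w; exists 0; exact: zero_eq.
Qed.

Lemma pcls_eq (X Y : R0p eta g) : sval X = sval Y -> X = Y.
Proof. by case: X Y => X p [Y q] /= E; exact: eq_exist. Qed.

End GrothendieckGroup.

(** * Characteristic polynomials *)

Section CharPolyMatrix.
Variable R : comNzRingType.

Lemma char_poly_tr n (A : 'M[R]_n) : char_poly A^T = char_poly A.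
Proof.
rewrite /char_poly -[RHS]det_tr; congr (\det _); apply/matrixP => i j.
by rewrite !mxE eq_sym.
Qed.

Lemma char_poly_lblock m n (A : 'M[R]_m) (C : 'M_(n, m)) (D : 'M_n) :
  char_poly (block_mx A 0 C D) = char_poly A * char_poly D.
Proof.
rewrite /char_poly -(@det_lblock _ _ _ _ (- map_mx polyC C)); congr (\det _).
by rewrite /char_poly_mx map_block_mx scalar_mx_block opp_block_mx add_block_mx
  map_mx0 oppr0 addr0 add0r.
Qed.

End CharPolyMatrix.

Section CharPolySpace.
Variable F : fieldType.
Implicit Type M : lmodType F.

(** With images of basis vectors as rows, [lincomb e] turns [phi] into
    multiplication by [N] on the right. *)
Lemma is_char_polyP M (U : set M) (phi : M -> M) p :
  is_char_poly U phi p <-> exists n (e : 'I_n -> M) (N : 'M[F]_n),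
    [/\ is_basis U e, forall j, phi (e j) = lincomb e (row j N) &
        p = char_poly N].
Proof.
split=> -[n [e [N [he hN ->]]]]; exists n, e, N^T; rewrite char_poly_tr;
  split=> // j.
  by rewrite hN; apply: eq_bigr => i _; rewrite !mxE.
by rewrite hN; apply: eq_bigr => i _; rewrite !mxE.
Qed.

Lemma lincomb_act M (phi : M -> M) n (e : 'I_n ->
  M) (N : 'M_n) c : linear phi ->
  (forall j, phi (e j) = lincomb e (row j N)) ->
  phi (lincomb e c) = lincomb e (c *m N).
Proof.
move=> pL hN; rewrite (lin_lincomb _ _ pL) lincomb_mul.
by apply: eq_bigr => j _ /=; rewrite hN.
Qed.

Lemma char_poly_exists M (U : set M) phi : finite_free M -> is_submodule U ->
  (forall v, U v -> U (phi v)) -> exists p, is_char_poly U phi p.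
Proof.
move=> Mf Us Up; have [n [e he]] := submodule_basis Mf Us.
have /choice[N NE] : forall j, exists c, phi (e j) = lincomb e c.
  by move=> j; apply/(basis_span he)/Up; case: he.
exists (char_poly (\matrix_j N j)); apply/is_char_polyP.
by exists n, e, (\matrix_j N j); split=> // j; rewrite rowK.
Qed.

Lemma char_poly_unique M (U : set M) phi p q : is_submodule U -> linear phi ->
  is_char_poly U phi p -> is_char_poly U phi q -> p = q.
Proof.
move=> Us pL /is_char_polyP[n [e [N [he hN ->]]]].
move=> /is_char_polyP[m [d [N' [hd hN' ->]]]].
have ed i : exists c, e i = lincomb d c by apply: (basis_span hd); case: he.
have de i : exists c, d i = lincomb e c by apply: (basis_span he); case: hd.
have e0 c : lincomb e c = 0 -> c = 0 by exact: (basis_free he).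
have d0 c : lincomb d c = 0 -> c = 0 by exact: (basis_free hd).
have E : n = m.
  by apply/eqP; rewrite eqn_leq (indep_le e0 ed).1 (indep_le d0 de).1.
subst m; move: ed de => /choice[A AE] /choice[B BE].
pose P := \matrix_j A j; pose Q := \matrix_j B j.
have PE c : lincomb e c = lincomb d (c *m P).
  by rewrite lincomb_mul; apply: eq_bigr => i _; rewrite AE rowK.
have QE c : lincomb d c = lincomb e (c *m Q).
  by rewrite lincomb_mul; apply: eq_bigr => i _; rewrite BE rowK.
have eI := basis_inj he Us; have dI := basis_inj hd Us.
have PQ : P *m Q = 1%:M.
  apply/row_matrixP => i; apply: eI; rewrite !rowE mulmxA -QE -PE mulmx1.
  by [].
have NP : N *m P = P *m N'.
  apply/row_matrixP => i; apply: dI; rewrite !rowE !mulmxA -PE.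
  by rewrite -(lincomb_act _ pL hN') -PE (lincomb_act _ pL hN).
have cP : char_poly_mx N *m map_mx polyC P = map_mx polyC P *m char_poly_mx N'.
  rewrite mulmxBl mulmxBr -!map_mxM NP; congr (_ - _).
  by rewrite mul_scalar_mx mul_mx_scalar.
have dP : \det (map_mx polyC P) != 0.
  apply/eqP => z; have := congr1 (fun X => \det (map_mx polyC X)) PQ.
  by rewrite map_mxM det_mulmx z mul0r map_mx1 det1 => /eqP;
    rewrite eq_sym oner_eq0.
apply: (mulIf dP); rewrite /char_poly -det_mulmx cP det_mulmx mulrC.
by [].
Qed.

Lemma root_char_poly M (U : set M) phi p a : is_submodule U -> linear phi ->
  is_char_poly U phi p ->
  (root p a <-> exists v, [/\ U v, v != 0 & phi v = a *: v]).
Proof.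
move=> Us pL /is_char_polyP[n [e [N [he hN ->]]]].
rewrite -eigenvalue_root_char; split=> [/eigenvalueP[c cN c0]|[v [Uv v0 E]]].
  exists (lincomb e c); split.
  - by apply: sub_lincomb => // i; case: he.
  - by apply: contra c0 => /eqP /(basis_free he Us) ->.
  - by rewrite (lincomb_act _ pL hN) cN (linZ (lincombL e)).
have [c Ec] := basis_span he Uv.
apply/eigenvalueP; exists c.
  by apply: (basis_inj he Us);
    rewrite -(lincomb_act _ pL hN) -Ec E Ec (linZ (lincombL e)).
by apply: contra v0 => /eqP z; rewrite Ec z (lin0 (lincombL e)).
Qed.

End CharPolySpace.

Section CharPolyModules.
Variables (R : comNzRingType) (F : fieldType) (f : {rmorphism R -> F}).
Variables (H : algType R) (Hg : int -> set H).
Implicit Types V W : gmodule f Hg.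

Definition cp V (i : int) (h : H) : {poly F} :=
  xget 0 [set p | is_char_poly (deg i : set V) (hact h) p].

Lemma cpP V i h : Hg 0 h -> is_char_poly (deg i : set V) (hact h) (cp V i h).
Proof.
move=> Hh; rewrite /cp; case: xgetP => // no.
have [p hp] := @char_poly_exists _ _ (deg i : set V) (hact h) (fmod_free V)
  (deg_sub (deg_sum V) i) (fun v => deg0_stable Hh).
by case: (no p).
Qed.

Lemma cp_eq V i h p : is_char_poly (deg i : set V) (hact h) p -> cp V i h = p.
Proof.
move=> hp; have ds := deg_sub (deg_sum V) i.
rewrite /cp; case: xgetP => [_ -> hq|no]; last by case: (no p).
exact: (char_poly_unique ds (hactL h) hq hp).
Qed.

Lemma cp_neq0 V i h : Hg 0 h -> cp V i h != 0.
Proof.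
move=> /(cpP V i) [n [e [N [_ _ ->]]]].
by rewrite monic_neq0 // char_poly_monic.
Qed.

Lemma cp_root V i h a : Hg 0 h -> (root (cp V i h) a <->
  exists v : V, [/\ deg i v, v != 0 & hact h v = a *: v]).
Proof.
move=> /(cpP V i); apply: root_char_poly; last exact: hactL.
exact: deg_sub (deg_sum V) i.
Qed.

(** Lifting a basis of [V''_i] to [V_i] makes the matrix block triangular. *)
Lemma cp_exact V' V V'' i h : Hg 0 h -> short_exact V' V V'' ->
  cp V i h = cp V' i h * cp V'' i h.
Proof.
move=> Hh [al [be [aM bM ai bs ex]]].
have [n' [e' [N' [he' hN' ->]]]] := (is_char_polyP _ _ _).1 (cpP V' i Hh).
have [n'' [e'' [N'' [he'' hN'' ->]]]] := (is_char_polyP _ _ _).1 (cpP V'' i Hh).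
have aL := gmor_lin aM; have bL := gmor_lin bM.
have dsub W := deg_sub (deg_sum W) i.
have /choice[l lP] : forall j, exists v : V, deg i v /\ be v = e'' j.
  move=> j; have [v E] := bs (e'' j); exists (pr (deg_sum V) i v).
  split; first exact: pr_in.
  by rewrite -(gmor_pr _ _ bM) E pr_id //; case: he''.
have exd (v : V) : deg i v -> be v = 0 -> exists2 u, deg i u & al u = v.
  move=> dv /ex[u E]; exists (pr (deg_sum V') i u); first exact: pr_in.
  by rewrite -(gmor_pr _ _ aM) E pr_id.
have he := @basis_ext _ _ _ _ al be (deg i) (deg i) (deg i) _ _ e' e'' l
  (dsub V') (dsub V'') (dsub V) aL bL ai (fun v dv => gmor_deg aM dv)
  (fun v dv => gmor_deg bM dv) _ exd he' he'' lP.
have {}he := he (fun v _ => (ex (al v)).2 (ex_intro _ v erefl)).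
set e := (fun k => _) in he.
have eE c d : lincomb e (row_mx c d) = al (lincomb e' c) + lincomb l d.
  rewrite (lin_lincomb _ _ aL) /lincomb big_split_ord /=; congr (_ + _).
    apply: eq_bigr => k _; rewrite row_mxEl /e.
    by rewrite -[lshift _ k]/(unsplit (inl k)) unsplitK.
  apply: eq_bigr => k _; rewrite row_mxEr /e.
  by rewrite -[rshift _ k]/(unsplit (inr k)) unsplitK.
have /choice[C CE] : forall j, exists c,
    hact h (l j) = al (lincomb e' c) + lincomb l (row j N'').
  move=> j; have [||u du E] := exd (hact h (l j) - lincomb l (row j N'')).
  - apply: subB => //; first by apply: deg0_stable => //; case: (lP j).
    by apply: sub_lincomb => // k; case: (lP k).
  - rewrite (linB bL) (gmor_hact _ _ bM) (lP j).2 hN'' (lin_lincomb _ _ bL).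
    apply/eqP; rewrite subr_eq0; apply/eqP.
    by apply: eq_bigr => k _ /=; rewrite (lP k).2.
  have [c Ec] := basis_span he' du; exists c.
  by rewrite -Ec E subrK.
apply: cp_eq; apply/is_char_polyP.
exists _, e, (block_mx N' 0 (\matrix_j C j) N''); split=> //.
  move=> k; rewrite /e -{2}(splitK k); case: (split k) => j /=.
    have -> : row (lshift n'' j) (block_mx N' 0 (\matrix_j C j) N'') =
        row_mx (row j N') 0.
      apply/rowP => x; rewrite !mxE -[lshift _ j]/(unsplit (inl j)) unsplitK.
      by rewrite !mxE; case: split => ?; rewrite ?mxE.
    by rewrite eE (lin0 (lincombL l)) addr0 -(gmor_hact _ _ aM) hN'.
  have -> : row (rshift n' j) (block_mx N' 0 (\matrix_j C j) N'') =
      row_mx (C j) (row j N'').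
    apply/rowP => x; rewrite !mxE -[rshift _ j]/(unsplit (inr j)) unsplitK.
    by rewrite !mxE; case: split => ?; rewrite ?mxE.
  by rewrite eE CE.
by rewrite char_poly_lblock.
Qed.

Lemma cp_prod V W i h : Hg 0 h -> cp (gprod V W) i h = cp V i h * cp W i h.
Proof. by move=> Hh; apply: cp_exact => //; exact: prod_exact. Qed.

(** The product of the characteristic polynomials over a list of modules
    respects the relations of the Grothendieck group, and can be cancelled. *)
Lemma cp_gcls V W i h : Hg 0 h -> gcls V = gcls W -> cp V i h = cp W i h.
Proof.
move=> Hh /r0_clsP[z] /=; set P :=
  fun x : seq (gmodule f Hg) => \prod_(U <- x) cp U i h.
have PD x y : P (x ++ y) = P x * P y by rewrite /P big_cat.
have P0 x : P x != 0.
  elim: x => [|U x IH]; first by rewrite /P big_nil oner_neq0.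
  by rewrite /P big_cons mulf_neq0 // cp_neq0.
have : forall x y, add_eq x y -> P x = P y.
  move=> x y; elim=> {x y} [//|//|x y z' _ -> //|x y|z' x y _ E|U' U U'' ex].
  - by rewrite !PD mulrC.
  - by rewrite !PD E.
  - by rewrite /P !big_cons !big_nil !mulr1 (cp_exact i Hh ex).
move=> PE /PE; rewrite -(cat1s V) -(cat1s W) !PD => /(mulIf (P0 z)).
by rewrite /P !big_seq1.
Qed.

Lemma cp_gshift V j i h : cp (gshift j V) i h = cp V (i - j) h.
Proof. by []. Qed.

End CharPolyModules.

Section CharPolyBaseChange.
Variables (R S : comNzRingType) (F : fieldType) (f : {rmorphism R -> S}).
Variables (f' : {rmorphism R -> F}) (g : {rmorphism S -> F}).
Hypothesis gf : forall r, g (f r) = f' r.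
Variables (H : algType R) (Hg : int -> set H).

Lemma cp_base_change (V : gmodule f Hg) i h n (e : 'I_n -> V) (N : 'M[S]_n) :
  is_basis (deg i) e -> (forall j, hact h (e j) = lincomb e (row j N)) ->
  cp (base_change gf V) i h = map_poly g (char_poly N).
Proof.
move=> he hN; apply: cp_eq; apply/is_char_polyP.
exists n, (fun j => pure g 1 (e j)), (map_mx g N); split.
- apply: (@tens_span_basis _ _ _ _ (deg i) (pr (deg_sum V) i)) => //.
  + exact: (deg_sub (deg_sum V) i).
  + exact: prL.
  + exact: pr_in.
  + exact: pr_id.
- move=> j; rewrite hact_bc hN /lincomb (big_morph _ (pureDr g 1) (pure0r g _
  1)).
  apply: eq_bigr => k _; rewrite !mxE scale_pure -pureZ mul1r mulr1.
  by [].
- by rewrite map_char_poly.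
Qed.

End CharPolyBaseChange.

(** * Characteristic polynomials determine the class *)

Section MinimalSubmodule.
Variables (F : fieldType) (M : lmodType F).

Lemma minimal_submodule (P : set M -> Prop) : finite_free M ->
  (forall U, P U -> is_submodule U) -> (exists U, P U) ->
  exists2 U, P U &
    forall U', P U' -> (forall v, U' v -> U v) -> forall v, U v -> U' v.
Proof.
move=> Mf Ps [U0 PU0].
pose Q r := `[< exists U, P U /\ exists e : 'I_r -> M, is_basis U e >].
have Q0 : exists r, Q r.
  have [r [e he]] := submodule_basis Mf (Ps _ PU0).
  by exists r; apply/asboolP; exists U0; split=> //; exists e.
case: (ex_minnP Q0) => r /asboolP[U [PU [e he]]] rmin;
  exists U => // U' PU' sub v.
have [r' [e' he']] := submodule_basis Mf (Ps _ PU').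
have [||le eq] := @indep_le _ _ _ _ e' e.
- by move=> c; exact: (basis_free he' (Ps _ PU')).
- by move=> i; apply/(basis_span he)/sub; case: he'.
have E : r' = r.
  apply/eqP; rewrite eqn_leq le rmin //; apply/asboolP.
  by exists U'; split=> //; exists e'.
move=> /(basis_span he)[c ->]; apply: sub_lincomb => [|i]; first exact: Ps.
have [c' ->] := eq E i; apply: sub_lincomb => [|k]; first exact: Ps.
by case: he'.
Qed.

End MinimalSubmodule.

Section GradedAlgebra.
Variables (R : comNzRingType) (H : algType R) (Hg : int -> set H).
Hypothesis Hgr : graded_algebra Hg.

(** The component of degree [0] of [1] is a left unit. *)
Lemma one_deg0 : Hg 0 1.
Proof.
have [Hd Hm] := Hgr; pose p := pr Hd.
have pM i j x y : Hg j x -> p (i + j) (y * x) = p i y * x.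
  move=> Hx; elim/(homog_ind Hd): y => [|y z hy hz|k y Hy].
  - by rewrite mul0r /p !(lin0 (prL _ _)) mul0r.
  - by rewrite mulrDl /p !(linD (prL _ _)) mulrDl -hy -hz.
  - rewrite /p (pr_deg _ _ (Hm _ _ _ _ Hy Hx)) (pr_deg _ _ Hy).
    by rewrite (inj_eq (addIr j)); case: eqP => // _; rewrite mul0r.
have p1 x : p 0 1 * x = x.
  elim/(homog_ind Hd): x => [|x y hx hy|j x Hx]; first by rewrite mulr0.
    by rewrite mulrDr hx hy.
  by rewrite -(pM _ _ _ _ Hx) mul1r add0r /p pr_id.
by rewrite -[1]p1 mulr1; exact: pr_in.
Qed.

Lemma common_denominator (F : fieldType) (f : {rmorphism R -> F}) x :
  is_frac_of_image f -> tens_span f (Hg 0) x ->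
  exists b h, [/\ f b != 0, Hg 0 h & f b *: x = pure f 1 h].
Proof.
move=> fr [t [ht ->]]; have Hs := deg_sub Hgr.1 0.
elim: t ht => [|[s h] t IH] ht.
  exists 1, 0; rewrite rmorph1 oner_neq0 big_nil scaler0 pure0r.
  by split=> //; exact: (sub0 Hs).
have [|b' [h' [b'0 Hh' E]]] := IH.
  by move=> q qt; apply: ht; rewrite inE qt orbT.
have [a [b [b0 ->]]] := fr s.
have Hh : Hg 0 h by apply: (ht (s, h)); rewrite inE eqxx.
exists (b * b'), ((b' * a) *: h + b *: h'); split.
- by rewrite rmorphM mulf_neq0.
- by apply: subD => //; exact: subZ.
- rewrite big_cons scalerDr /= pureDr -!pureZ !mul1r; congr (_ + _).
    by rewrite scale_pure !rmorphM -mulrA mulrCA [f b * _]mulrC mulfVK.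
  by rewrite rmorphM -scalerA E -pure1s.
Qed.

End GradedAlgebra.

Section Sequences.
Variables (R : comNzRingType) (F : fieldType) (f : {rmorphism R -> F}).
Variables (H : algType R) (Hg : int -> set H).
Implicit Types V W N : gmodule f Hg.

Lemma gmor_inj_deg V W (j : V -> W) i v :
  is_gmor j -> injective j -> deg i (j v) -> deg i v.
Proof.
move=> jM ji dj; suff <- : pr (deg_sum V) i v = v by exact: pr_in.
by apply: ji; rewrite -(gmor_pr _ _ jM) pr_id.
Qed.

Lemma gmor_comp V W N (a : V -> W) (b : W -> N) :
  is_gmor a -> is_gmor b -> is_gmor (b \o a).
Proof.
move=> [aL ah ad] [bL bh bd]; split=> [c u v|h v|i v dv] /=.
- by rewrite aL bL.
- by rewrite ah bh.
- exact/bd/ad.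
Qed.

Lemma gmor_sequences N W (phi : N -> W) : is_gmor phi ->
  exists (K J Q : gmodule f Hg) (k : K -> N) (p : N -> J),
  [/\ is_gmor k /\ injective k, forall u, phi (k u) = 0,
      linear p /\ (forall v w, p v = p w <-> phi v = phi w),
      short_exact K N J & short_exact J W Q].
Proof.
move=> pM; have pL := gmor_lin pM.
have [|K [k [kM ki kK]]] := @sub_gmod _ _ _ _ _ N (fun v => phi v = 0).
  split=> [|i v E|h v E].
  - split; first exact: (lin0 pL).
    move=> a u v Eu Ev.
    by rewrite (pL a u v) Eu Ev scaler0 addr0.
  - by rewrite -(gmor_pr _ _ pM) E (lin0 (prL _ _)).
  - by rewrite (gmor_hact _ _ pM) E (lin0 (hactL h)).
have im : @gsub _ _ _ _ idfun _ _ W (fun w => exists v, phi v = w).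
  split=> [|i _ [v <-]|h _ [v <-]].
  - split; first by exists 0; exact: (lin0 pL).
    by move=> a _ _ [u <-] [v <-]; exists (a *: u + v); exact: pL.
  - by exists (pr (deg_sum N) i v); rewrite (gmor_pr _ _ pM).
  - by exists (hact h v); exact: gmor_hact.
have [J [j [jM ji jJ]]] := sub_gmod im.
have [Q [q [qM qs qK]]] := quotient_gmod im.
have /choice[p pE] : forall v, exists u, j u = phi v.
  by move=> v; apply/jJ; exists v.
have jL := gmor_lin jM.
have ppM : is_gmor p.
  apply: gmorI.
  - by move=> a u v; apply: ji; rewrite jL !pE pL.
  - by move=> h v; apply: ji; rewrite (gmor_hact _ _ jM) !pE (gmor_hact _ _ pM).
  - by move=> i v dv; apply: (gmor_inj_deg jM ji); rewrite pE; exact: gmor_deg.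
exists K, J, Q, k, p; split=> //.
- by move=> u; apply/kK; exists u.
- split=> [|v w]; first exact: gmor_lin ppM.
  by rewrite -!pE; split=> [-> //|/ji].
- exists k, p; split=> // [u|v].
    have /jJ[v E] : exists m, j m = j u by exists u.
    by exists v; apply: ji; rewrite pE.
  rewrite -kK -pE; split=> [->|E]; first exact: (lin0 jL).
  by apply: ji; rewrite E (lin0 jL).
- by exists j, q; split=> // w; rewrite -qK jJ.
Qed.

End Sequences.

Section Injectivity.
Variables (R : comNzRingType) (F : fieldType) (f : {rmorphism R -> F}).
Hypothesis f_frac : is_frac_of_image f.
Variables (H : algType R) (Hg : int -> set H).
Hypotheses (Hgr : graded_algebra Hg) (Hf : finite_free H).
Implicit Types V W : gmodule f Hg.

Let B := tens f H.
Let B0 : set B := tens_span f (Hg 0).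

Lemma fst_gmor V W : is_gmor (fun z : gprod V W => z.1).
Proof. by split=> // i z []. Qed.

Lemma snd_gmor V W : is_gmor (fun z : gprod V W => z.2).
Proof. by split=> // i z []. Qed.

(** Clearing denominators turns [e] into an element of [H_0], whose eigenvalues
    on a component are the roots of its characteristic polynomial there. *)
Lemma eigen_transfer V W i (e : B) (v : V) :
  (forall h, Hg 0 h -> cp V i h = cp W i h) -> B0 e ->
  deg i v -> v != 0 -> act e v = v ->
  exists w : W, [/\ deg i w, w != 0 & act e w = w].
Proof.
move=> E Be dv v0 ev; have [b [h [b0 Hh Eh]]] :=
  common_denominator Hgr f_frac Be.
have eig (X : gmodule f Hg) (x : X) : hact h x = f b *: x <-> act e x = x.
  rewrite /hact -Eh act_scale; split=> [|-> //].
  by move=> /(congr1 (fun y => (f b)^-1 *: y));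
    rewrite !scalerA mulVf // !scale1r.
have : root (cp V i h) (f b) by apply/cp_root => //; exists v; split=> //;
  apply/eig.
rewrite E // => /cp_root -/(_ Hh)[w [dw w0 /eig ew]].
by exists w.
Qed.

(** This is the largest graded submodule that meets [V_i] inside [U].
    Describing it from above, by what [H] moves into [U], makes its stability
    immediate. *)
Definition coinduced V i (U : set V) : set V := fun z =>
  forall j h, Hg (i - j) h -> U (hact h (pr (deg_sum V) j z)).

Lemma coinduced_gsub V i (U : set V) : is_submodule U ->
  @gsub _ _ _ _ idfun _ _ V (coinduced i U).
Proof.
move=> Us; have [Hd Hm] := Hgr; apply: (gsubI Hd).
- split=> [j h _|a u v Zu Zv j h Hh].
    by rewrite (lin0 (prL _ _)) (lin0 (hactL h)); exact: (sub0 Us).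
  rewrite rsZ [pr _ _ _]prL hactL; apply: Us.2; [exact: Zu|exact: Zv].
- move=> l z Zz j h Hh; rewrite pr_pr; case: eqP Hh => [->|_ _].
    exact: Zz.
  by rewrite (lin0 (hactL h)); exact: (sub0 Us).
- move=> l h' z Hh' Zz j h Hh.
  rewrite -[j](subrK l) [_ + l]addrC (pr_hact _ _ Hh') -(haM (hactP V)).
  apply: Zz; have := Hm _ _ _ _ Hh Hh'; congr (Hg _ _).
  by rewrite opprB addrA addrAC.
Qed.

Lemma coinduced_deg V i (U : set V) z : 
  coinduced i U z -> deg i z -> U z.
Proof.
move=> Zz dz; have := Zz i 1; rewrite subrr (pr_id _ dz) (ha1 (hactP V)).
by apply; exact: one_deg0.
Qed.

(** An element of [F (x) H_0] with eigenvalue [1] on [V_i] also has eigenvalue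
    [1] on [W_i].  For a left ideal [I] of [F (x) H_0] that is minimal among
    those containing such an element [e], with eigenvectors [v] and [w], the
    graded submodule [Z] of [V + W] with component [I (v, w)] in degree [i] does
    not contain [(v, 0)]: an element of [I] sending [v] to [v] and [w] to [0]
    would generate a smaller left ideal. *)
Lemma linking_submodule V W i (v0 : V) :
  (forall h, Hg 0 h -> cp V i h = cp W i h) -> deg i v0 -> v0 != 0 ->
  exists (Z : set (gprod V W)) (v : V) (w : W),
  [/\ @gsub _ _ _ _ idfun _ _ (gprod V W) Z, Z (v, w) & ~ Z (v, 0)].
Proof.
move=> E dv0 v00.
pose P (I : set B) := [/\ is_submodule I, forall x, I x -> B0 x,
  forall h x, Hg 0 h -> I x -> I (pure f 1 h * x) &
  exists e (v : V), [/\ I e, deg i v, v != 0 & act e v = v]].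
have [|||I [Is IB IH [e [v [Ie dv vn0 ev]]]] Imin] := @minimal_submodule F B P.
- exact: tens_finite_free.
- by move=> U [].
- exists B0; split=> //; first exact: tens_span_sub.
    move=> h x Hh [t [ht ->]]; exists [seq (q.1, h * q.2) | q <- t]; split.
      move=> _ /mapP[q /ht Hq ->] /=; rewrite -[0]addr0.
      exact: (Hgr.2 _ _ _ _ Hh Hq).
    rewrite big_map mulr_sumr; apply: eq_bigr => q _.
    by rewrite pureM mul1r.
  exists 1, v0; split=> //; last exact: (act1 (actP V)).
  exists [:: (1, 1)]; rewrite big_seq1; split=> // q.
  by rewrite inE => /eqP -> /=; exact: one_deg0.
have [w [dw wn0 ew]] := eigen_transfer E (IB _ Ie) dv vn0 ev.
pose U : set (gprod V W) := fun z => exists2 x, I x & z = (act x v, act x w).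
have Us : is_submodule U.
  split; first by exists 0; [exact: (sub0 Is)|rewrite !act0l].
  move=> a _ _ [x Ix ->] [y Iy ->]; exists (a *: x + y); first exact: Is.2.
  by rewrite !(actDl (actP _)) !act_scale.
exists (coinduced i U), v, w; split; first exact: coinduced_gsub.
- move=> j h Hh; have dz : deg i ((v, w) : gprod V W) by [].
  rewrite (pr_deg _ _ dz); case: eqP Hh => [->|_ _]; last first.
    by rewrite (lin0 (hactL h)); exact: (sub0 Us).
  rewrite subrr => Hh; exists (pure f 1 h * e); first exact: IH.
  by rewrite !(actM (actP _)) ev ew.
- move=> /coinduced_deg[|x Ix [xv xw]].
    by split=> //=; exact: (sub0 (deg_sub (deg_sum W) i)).
  pose I' : set B := fun y => I y /\ act y w = 0.
  have /Imin h : P I'.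
    split.
    - split; first by split; [exact: (sub0 Is)|rewrite act0l].
      move=> a y z [Iy yw] [Iz zw]; split; first exact: Is.2.
      by rewrite (actDl (actP _)) act_scale yw zw scaler0 addr0.
    - by move=> y [/IB].
    - move=> h y Hh [Iy yw]; split; first exact: IH.
      by rewrite (actM (actP _)) yw -/(hact h 0) (lin0 (hactL h)).
    - by exists x, v; split.
  have [] := h _ e Ie; first by move=> y [].
  by move=> _; rewrite ew => /eqP; rewrite (negbTE wn0).
Qed.

(** Let [Z -> V] and [Z -> W] have images [V'] and [W'] and kernels [KW] and
    [KV].  Then [V - W = (KV + V / V') - (KW + W / W')] in the Grothendieck
    group, and [KV] is a proper submodule of [V'] when [Z] is a linking
    submodule, so that the dimensions decrease. *)
Lemma cp_inj V W : (forall i h, Hg 0 h -> cp V i h = cp W i h) ->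
  gcls V = gcls W.
Proof.
have [n] := ubnP (gdim V); elim: n V W => // n IH V W le E.
have [[i [v0 [dv0 v00]]]|no] := pselect (exists i (v : V), deg i v /\ v != 0);
  last first.
  have V0 (v : V) : v = 0.
    apply: (@pr_eq0 _ _ _ (deg_sum V)) => i; apply/eqP;
      apply: contrapT => /negP nz.
    by apply: no; exists i, (pr (deg_sum V) i v); split=> //; exact: pr_in.
  have W0 (w : W) : w = 0.
    apply: (@pr_eq0 _ _ _ (deg_sum W)) => i; apply/eqP;
      apply: contrapT => /negP nz.
    (* [1] has the eigenvalue [1] on [W_i] as soon as [W_i] is nonzero. *)
    have H1 := one_deg0 Hgr.
    have : root (cp W i 1) 1.
      apply/cp_root => //; exists (pr (deg_sum W) i w); split=> //;
        first exact: pr_in.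
      by rewrite (ha1 (hactP W)) scale1r.
    by rewrite -E // => /cp_root -/(_ H1)[v [_ /eqP vn _]]; exact/vn/V0.
  apply: (@gcls_iso _ _ _ _ V W (fun=> 0)).
  - split=> [a u v|b v|j v dv]; last exact: (sub0 (deg_sub (deg_sum W) j)).
    + by rewrite scaler0 addr0.
    + by rewrite [RHS]W0.
  - by move=> u v _; rewrite [u]V0 [v]V0.
  - by move=> w; exists 0; rewrite [w]W0.
have [Z [v [w [Zg Zvw nZ]]]] := linking_submodule (E i) dv0 v00.
have [M [io [ioM ioI ioZ]]] := sub_gmod Zg.
have aM := gmor_comp ioM (@fst_gmor V W).
have bM := gmor_comp ioM (@snd_gmor V W).
have [KW [V' [Q [kw [pa [[kwM kwI] kw0 [paL paE] ex1 ex2]]]]]] :=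
  gmor_sequences aM.
have [KV [W' [Q' [kv [pb [[kvM kvI] kv0 [pbL pbE] ex3 ex4]]]]]] :=
  gmor_sequences bM.
have kv2 x : (io (kv x)).2 = 0 := kv0 x.
have E1 : gcls (gprod KV Q) = gcls (gprod KW Q').
  apply: IH => [|j h Hh].
    move: le; rewrite ltnS; apply: leq_trans;
      rewrite (gdim_exact (prod_exact _ _)).
    rewrite (gdim_exact ex2) -addSn leq_add2r.
    have [m mE] : exists m, io m = (v, w) by apply/ioZ.
    apply: (@gdim_lt _ _ _ _ _ _ _ (pa \o kv) (pa m)).
    - by move=> a x y /=; rewrite (gmor_lin kvM) paL.
    - move=> x y /= /paE /= Exy; apply: kvI; apply: ioI.
      by rewrite [LHS]surjective_pairing [RHS]surjective_pairing Exy !kv2.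
    - move=> x /paE /= Ex; apply: nZ; apply/ioZ; exists (kv x).
      by rewrite [LHS]surjective_pairing Ex kv2 mE.
  (* Multiplying by the polynomials of [V'] and [W'] replaces both sides by
     those of [Z] times [V], and of [Z] times [W]. *)
  have n0 (X : gmodule f Hg) : cp X j h != 0 by exact: cp_neq0.
  apply: (mulIf (mulf_neq0 (n0 V') (n0 W'))).
  rewrite !cp_prod //.
  have := cp_exact j Hh ex1; rewrite (cp_exact j Hh ex3) => EM.
  have := E j h Hh; rewrite (cp_exact j Hh ex2) (cp_exact j Hh ex4) => EV.
  transitivity (cp KV j h * cp W' j h * (cp V' j h * cp Q j h)); first by ring.
  by rewrite EM EV; ring.
have := gcls_exact ex1; rewrite (gcls_exact ex3) => EM.
apply: (@r0_addI _ _ _ _ (r0_add (gcls KV) (gcls W'))).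
rewrite {2}EM (gcls_exact ex2) (gcls_exact ex4).
rewrite [r0_add (gcls V') (gcls Q)]r0_addC r0_addACA -gclsD E1 gclsD.
by rewrite [r0_add (gcls W') (gcls Q')]r0_addC [RHS]r0_addACA
  [r0_add (gcls W') (gcls V')]r0_addC.
Qed.

End Injectivity.

(** * Integrality of characteristic polynomials *)

Section IntegralMatrices.

Lemma det_mulmx_expand (R : comNzRingType) n t (B : 'M[R]_(n, t))
    (m : 'M_(t, n)) :
  \det (B *m m) =
  \sum_(u : {ffun 'I_n -> 'I_t}) (\prod_i B i (u i)) * \det (rowsub u m).
Proof.
rewrite /determinant.
under eq_bigr => s _.
  under eq_bigr do rewrite mxE.
  rewrite bigA_distr_bigA mulr_sumr; over.
rewrite exchange_big; apply: eq_bigr => u _ /=.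
rewrite mulr_sumr; apply: eq_bigr => s _.
rewrite big_split /= mulrCA; congr (_ * (_ * _)).
by apply: eq_bigr => i _; rewrite mxE.
Qed.

(** The maximal minors of [m] span a finitely generated [R]-submodule of the
    field; by multilinearity of the determinant it is stable under
    multiplication by the coefficients of the characteristic polynomial. *)
Lemma char_poly_integral (R : comNzRingType) (K : fieldType)
    (f : {rmorphism R -> K}) n t (N : 'M[K]_n) (m : 'M[K]_(t, n))
    (Q : 'M[R]_t) :
  row_full m -> m *m N = map_mx f Q *m m ->
  forall k, integralOver f (char_poly N)`_k.
Proof.
move=> fm mN k; pose T := {ffun 'I_n -> 'I_t}.
pose d (u : T) := \det (rowsub u m).
pose b (u v : T) := \prod_i char_poly_mx Q (u i) (v i).
have key u : char_poly N * (d u)%:P = \sum_v map_poly f (b u v) * (d v)%:P.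
  have dE v : (d v)%:P = \det (rowsub v (map_mx polyC m)).
    by rewrite -det_map_mx; congr (\det _); apply/matrixP => i j; rewrite !mxE.
  have E : rowsub u (map_mx polyC m) *m char_poly_mx N =
      rowsub u (map_mx (map_poly f) (char_poly_mx Q)) *m map_mx polyC m.
    rewrite !mul_rowsub_mx; congr (rowsub u _).
    rewrite /char_poly_mx map_mxB map_scalar_mx /= map_polyX mulmxBr mulmxBl.
    rewrite mul_mx_scalar mul_scalar_mx -map_mxM mN map_mxM -!map_mx_comp.
    by congr (_ - _ *m _); apply: eq_map_mx => x /=; rewrite map_polyC.
  rewrite dE mulrC /char_poly -det_mulmx E det_mulmx_expand.
  apply: eq_bigr => v _; rewrite dE /b rmorph_prod /=; congr (_ * _).
  by apply: eq_bigr => i _; rewrite !mxE.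
pose C := \matrix_(i < #|T|, j < #|T|)
  (b (@enum_val T T j) (@enum_val T T i))`_k.
have [u0 du0] : exists u0, d u0 != 0.
  exists (finfun (fullrankfun fm)).
  rewrite (_ : d _ = \det (rowsub (fullrankfun fm) m)).
    by have := fullrowsub_unit fm; rewrite unitmxE unitfE.
  by congr (\det _); apply/matrixP => i j; rewrite !mxE ffunE.
exists (char_poly C); first exact: char_poly_monic.
rewrite map_char_poly -eigenvalue_root_char; apply/eigenvalueP.
exists (\row_i d (@enum_val T T i)).
  apply/rowP => j; rewrite !mxE.
  have /= := congr1 (fun p : {poly K} => p`_k) (key (@enum_val T T j)).
  rewrite coefMC => ->; rewrite coef_sum.
  rewrite [RHS](reindex _ (onW_bij _ (enum_val_bij T))) /=.
  by apply: eq_bigr => i _; rewrite !mxE coefMC coef_map mulrC.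
apply: contra du0 => /eqP/rowP/(_ (enum_rank u0)).
by rewrite !mxE enum_rankK => ->.
Qed.

End IntegralMatrices.

Section Generators.
Variables (R F : comNzRingType) (f : {rmorphism R -> F}) (H : algType R).
Variables (Hg : int -> set H) (Hf : finite_free H) (V : gmodule f Hg).

(** The products [h_a v_b], for a basis [h_a] of [H] over [R], form such a
    family: [h h_a] is again a combination of the basis. *)
Lemma stable_generators n (v : 'I_n -> V) : exists t (y : 'I_t -> rs f V),
  (forall h, exists Q : 'M[R]_t,
     forall k, hact h (y k : V) = lincomb y (row k Q)) /\
  (forall b, exists c, v b = lincomb y c).
Proof.
have [r [e he]] := Hf.
pose T : finType := ('I_r * 'I_n)%type.
pose y0 (x : T) : rs f V := hact (e x.1) (v x.2).
have yE h b : exists c : T -> R, hact h (v b) = \sum_x c x *: y0 x.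
  have [c ->] := basis_span he (I : setT h).
  exists (fun x : T => if x.2 == b then c 0 x.1 else 0).
  rewrite -(pair_bigA _ (fun a b' =>
    (if b' == b then c 0 a else 0) *: y0 (a, b'))).
  rewrite /lincomb hact_suml; apply: eq_bigr => a _ /=.
  rewrite (bigD1 b) //= eqxx big1 => [|b' /negbTE ->]; last exact: scale0r.
  by rewrite addr0 rsZ (haZ (hactP V)).
exists #|T|, (y0 \o @enum_val T T); split=> [h|b].
  have /choice[c cE] : forall x : T, exists c : T -> R,
      hact h (y0 x : V) = \sum_x' c x' *: y0 x'.
    by move=> [a b]; rewrite /y0 -(haM (hactP V)); exact: yE.
  exists (\matrix_(k, l) c (@enum_val T T k) (@enum_val T T l)) => k.
  rewrite [RHS](_ : _ = lincomb (y0 \o @enum_val T T)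
    (\row_l c (@enum_val T T k) (@enum_val T T l))); last first.
    by congr lincomb; apply/rowP => l; rewrite !mxE.
  by rewrite -sum_lincomb -cE.
have [c E] := yE 1 b; exists (\row_k c (@enum_val T T k)).
by rewrite -sum_lincomb -E (ha1 (hactP V)).
Qed.

End Generators.

Section CpIntegral.
Variables (R : comNzRingType) (F : fieldType) (f : {rmorphism R -> F}).
Variables (H : algType R) (Hg : int -> set H) (Hf : finite_free H).
Variable V : gmodule f Hg.

(** The components of degree [i] of a stable family generate [V_i], and an
    element of [H_0] acts on them through a matrix over [R]. *)
Lemma cp_integral i h k : Hg 0 h -> integralOver f (cp V i h)`_k.
Proof.
move=> Hh; have [n [e [N [he hN ->]]]] := (is_char_polyP _ _ _).1 (cpP V i Hh).
have [t [y [yH ye]]] := stable_generators Hf e.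
have [Q QE] := yH h.
have ds := deg_sub (deg_sum V) i.
pose p : V -> V := pr (deg_sum V) i; have pL : linear p := prL _ i.
have pL' : linear (p : rs f V -> rs f V) := rs_linear f pL.
have /choice[m0 mE] : forall l, exists c, p (y l) = lincomb e c.
  by move=> l; exact: (basis_span he (pr_in (deg_sum V) i (y l))).
pose m := \matrix_l m0 l.
have rmE l : lincomb e (row l m) = p (y l) by rewrite rowK mE.
have bE c : lincomb e (map_mx f c *m m) = p (lincomb y c).
  rewrite (lin_lincomb _ _ pL') lincomb_mul; apply: eq_bigr => l _.
  by rewrite rsZ mxE rmE.
apply: (@char_poly_integral _ _ f n t N m Q).
- rewrite -sub1mx; apply/row_subP => b; have [c E] := ye b.
  have -> : row b 1%:M = map_mx f c *m m.
    apply: (basis_inj he ds); rewrite bE -E row1 lincomb_delta /p pr_id //.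
    by case: he.
  exact: submxMl.
- apply/row_matrixP => l; apply: (basis_inj he ds); rewrite !row_mul.
  rewrite -(lincomb_act _ (hactL h) hN) rmE -map_row bE -QE.
  by rewrite -(pr_hact _ _ Hh) add0r.
Qed.

End CpIntegral.

(** * Lattices *)

Section GeneratedLattice.
Variables (R S S' : comNzRingType) (f : {rmorphism R -> S}).
Variables (f' : {rmorphism R -> S'}) (g : {rmorphism S -> S'}).
Hypothesis gf : forall r, g (f r) = f' r.
Variables (H : algType R) (Hg : int -> set H).
Hypotheses (Hgr : graded_algebra Hg) (Hf : finite_free H).
Variable V : gmodule f' Hg.

(** The homogeneous components of a stable family span a graded [S]-submodule.
    It is stable as well, since homogeneous elements of [H] carry the components
    of one degree to those of another. *)
Lemma generated_gsub n (v : 'I_n -> V) : exists U : set V,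
  [/\ gsub g U, forall b, U (v b) & exists N (z : 'I_N -> rs g V),
      (forall i, U (z i)) /\ forall u, U u -> exists c, u = lincomb z c].
Proof.
have [t [y [yH yv]]] := stable_generators Hf v.
pose p i : V -> V := pr (deg_sum V) i.
have pL i : linear (p i : rs g V -> rs g V) := rs_linear g (prL (deg_sum V) i).
have hL h : linear (hact h : rs g V -> rs g V) := rs_linear g (hactL h).
pose yp i (k : 'I_t) : rs g V := p i (y k).
have yS i (c : 'rV[R]_t) : p i (lincomb y c) = lincomb (yp i) (map_mx f c).
  rewrite [LHS](lin_sum (prL (deg_sum V) i)); apply: eq_bigr => k _.
  by rewrite mxE !rsZ gf; exact: (linZ (prL (deg_sum V) i)).
pose U : set V := fun u => forall i, exists c, p i u = lincomb (yp i) c.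
have Us : is_submodule (U : set (rs g V)).
  split; first by move=> i; exists 0; rewrite (lin0 (pL i)) (lin0 (lincombL _)).
  move=> a u w Uu Uw i; have [c E] := Uu i; have [d E'] := Uw i.
  by exists (a *: c + d); rewrite lincombL -E -E' -[RHS](pL i).
have Up i u : U u -> U (p i u).
  move=> Uu j; rewrite /p pr_pr; case: eqP => [->|_]; first exact: Uu.
  by exists 0; rewrite (lin0 (lincombL _)).
have Uy i k : U (p i (y k)).
  move=> j; rewrite /p pr_pr; case: eqP => [->|_]; last first.
    by exists 0; rewrite (lin0 (lincombL _)).
  by exists (delta_mx 0 k); rewrite lincomb_delta.
exists U; split.
- apply: (gsubI Hgr.1) => // l h u Hh Uu i.
  have [c E] := Uu (i - l); have [Q QE] := yH h.
  have -> : i = l + (i - l) by rewrite addrC subrK.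
  exists (c *m map_mx f Q).
  rewrite /p (pr_hact _ _ Hh) [pr _ _ _]E (lin_lincomb _ _ (hL h)) lincomb_mul.
  apply: eq_bigr => k _; congr (_ *: _).
  by rewrite /= /yp /p -(pr_hact _ _ Hh) QE [pr _ _ _]yS map_row.
- by move=> b i; have [c ->] := yv b; exists (map_mx f c).
- have [s us ps] := common_support (deg_sum V) y.
  pose T : finType := ('I_(size s) * 'I_t)%type.
  pose z (x : T) : rs g V := yp (nth 0 s x.1) x.2.
  exists #|T|, (z \o @enum_val T T); split=> [i|u Uu]; first exact: Uy.
  have /choice[c cE] := Uu.
  exists (\row_k c (nth 0 s (@enum_val T T k).1) 0 (@enum_val T T k).2).
  rewrite -(@sum_lincomb _ _ T z (fun x => c (nth 0 s x.1) 0 x.2)).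
  rewrite -(pair_bigA _ (fun (i : 'I_(size s)) (k : 'I_t) =>
    c (nth 0 s i) 0 k *: yp (nth 0 s i) k)) /=.
  have -> : u = \sum_(i <- s) p i u :> V.
    apply: is_finsumP => // [i nis|]; last exact: pr_finsum.
    rewrite cE /lincomb big1 // => k _.
    by rewrite /yp [p _ _](ps _ _ nis) scaler0.
  rewrite (big_nth 0) big_mkord; apply: eq_bigr => i _.
  by rewrite cE.
Qed.

End GeneratedLattice.

(** What the inclusion of a valuation ring into its field of fractions and an
    isomorphism of fields have in common. *)
Definition dominating (S : comNzRingType) (S' : fieldType)
    (g : {rmorphism S -> S'}) : Prop :=
  injective g /\
     forall x : S', x != 0 -> (exists s, x = g s) \/ (exists s, x^-1 = g s).

Section Dominating.
Variables (S : comNzRingType) (S' : fieldType) (g : {rmorphism S -> S'}).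
Hypothesis gd : dominating g.

Lemma dominating_total (a b : S') :
  (exists2 d, (exists s, d = g s) & a = d * b) \/
  (exists2 d, (exists s, d = g s) & b = d * a).
Proof.
have [->|b0] := eqVneq b 0.
  by right; exists 0; rewrite ?mul0r //; exists 0; rewrite rmorph0.
have [->|a0] := eqVneq a 0.
  by left; exists 0; rewrite ?mul0r //; exists 0; rewrite rmorph0.
have [|h|h] := gd.2 (a / b); first by rewrite mulf_neq0 // invr_neq0.
  by left; exists (a / b) => //; rewrite mulfVK.
by right; exists (a / b)^-1 => //; rewrite invf_div mulfVK.
Qed.

Lemma dominating_divides (a b : S) :
  (exists d, a = d * b) \/ (exists d, b = d * a).
Proof.
have [[_ [s ->] E]|[_ [s ->] E]] := dominating_total (g a) (g b); [left|right];
  by exists s; apply: gd.1; rewrite rmorphM.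
Qed.

Lemma dominating_torsionfree (V : lmodType S') (a : S) (v : rs g V) :
  a *: v = 0 -> a = 0 \/ v = 0.
Proof.
rewrite rsZ => /eqP; rewrite scaler_eq0 => /orP[/eqP E|/eqP]; last by right.
by left; apply: gd.1; rewrite E rmorph0.
Qed.

(** In a relation over [S'], divide by a coefficient that makes all quotients
    lie in [S]. *)
Lemma dominating_indep (V : lmodType S') n (e : 'I_n -> V) :
  (forall c, lincomb (e : 'I_n -> rs g V) c = 0 -> c = 0) ->
  forall c : 'rV[S']_n, lincomb e c = 0 -> c = 0.
Proof.
move=> ind c c0; apply/eqP; apply: contraT => cn0.
have [||j cj dv] := max_divisor _ _ dominating_total cn0.
- by exists 1; rewrite rmorph1.
- by move=> _ _ [s ->] [s' ->]; exists (s * s'); rewrite rmorphM.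
have /choice[s sE] : forall i, exists s, c 0 i = g s * c 0 j.
  by move=> i; have [_ [s ->] E] := dv i; exists s.
have : lincomb (e : 'I_n -> rs g V) (\row_i s i) = 0.
  have /eqP : c 0 j *: (\sum_i g (s i) *: e i) = 0.
    rewrite -[RHS]c0 scaler_sumr; apply: eq_bigr => i _.
    by rewrite scalerA mulrC -sE.
  rewrite scaler_eq0 (negbTE cj) => /eqP E; rewrite -[RHS]E.
  by apply: eq_bigr => i _; rewrite rsZ mxE.
move=> /ind/rowP/(_ j); rewrite !mxE => sj; move: cj.
by rewrite sE sj rmorph0 mul0r eqxx.
Qed.

Variables (R : comNzRingType) (f : {rmorphism R -> S}).
Variable f' : {rmorphism R -> S'}.
Hypothesis gf : forall r, g (f r) = f' r.
Variables (H : algType R) (Hg : int -> set H).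

Section DegreeBases.
Variable V : gmodule f Hg.

Lemma lattice_deg_basis i : exists n (e : 'I_n -> V), is_basis (deg i) e.
Proof.
have [n [e he]] := fmod_free V; have ds := deg_sub (deg_sum V) i.
have pL := prL (deg_sum V) i.
apply: (@fg_torsionfree_free _ _ _ n (pr (deg_sum V) i \o e)) => //.
- exact: dominating_divides.
- move=> a u _; have [c ->] := basis_span he (I : setT u).
  rewrite -(linZ (lincombL e)) => /(basis_free he (setT_sub V)) /rowP ac.
  have [->|a0] := pselect (a = 0); [by left|right].
  suff -> : c = 0 by exact: (lin0 (lincombL e)).
  apply/rowP => k; have := ac k; rewrite !mxE => /(congr1 g)/eqP.
  rewrite rmorphM rmorph0 mulf_eq0 => /orP[] /eqP;
    rewrite -(rmorph0 g) => /gd.1 //.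
- by move=> k; exact: pr_in.
- move=> v dv; have [c E] := basis_span he (I : setT v); exists c.
  by rewrite -(lin_lincomb _ _ pL) -E pr_id.
Qed.

(** The components of a lattice are free, so that one matrix over [S] describes
    the action on them after every base change. *)
Lemma lattice_cp i h : Hg 0 h -> exists P : {poly S},
  forall (F : fieldType) (f1 : {rmorphism R -> F}) (g1 : {rmorphism S -> F})
    (gf1 : forall r, g1 (f r) = f1 r),
  cp (base_change gf1 V) i h = map_poly g1 P.
Proof.
move=> Hh; have [n [e he]] := lattice_deg_basis i.
have /choice[N NE] : forall j, exists c, hact h (e j) = lincomb e c.
  by move=> j; apply: (basis_span he); apply: deg0_stable => //; case: he.
exists (char_poly (\matrix_j N j)) => F f1 g1 gf1.
by apply: cp_base_change he _ => j; rewrite rowK.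
Qed.

End DegreeBases.

Hypotheses (Hgr : graded_algebra Hg) (Hf : finite_free H).

(** [M] is generated by a basis of [V]; it is free because [S] behaves like a
    valuation ring. *)
Lemma lattice_exists (V : gmodule f' Hg) :
  exists M : gmodule f Hg, gcls (base_change gf M) = gcls V.
Proof.
have [n [e he]] := fmod_free V.
have [U [Ug Ue [N [z [Uz zU]]]]] := generated_gsub gf Hgr Hf e.
have Us : is_submodule (U : set (rs g V)) by case: Ug.
have [m [b hb]] := fg_torsionfree_free dominating_divides Us
  (fun a u _ => @dominating_torsionfree _ a u) Uz zU.
have [M [j [jm ji jU]]] := restrict gf Ug hb.
have [jL _ _] := jm.
exists M; have [d [x hx]] := fmod_free M.
apply: (@gcls_iso _ _ _ _ _ _ (@bcmap _ _ _ _ _ _ gf _ _ _ _ j)).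
- exact: bcmap_gmor.
- apply: (bcmap_inj jm hx); apply: dominating_indep => c.
  rewrite -(lin_lincomb _ _ jL) -(lin0 jL) => /ji.
  exact: (basis_free hx (setT_sub M)).
- move=> v; have [c ->] := basis_span he (I : setT v).
  have /choice[l lE] : forall k, exists l, j l = e k by move=> k; apply/jU/Ue.
  exists (lincomb (fun k => pure g 1 (l k)) c).
  rewrite (lin_lincomb _ _ (bcmapL jm)); apply: eq_bigr => k _ /=.
  by rewrite (bcmap_pure gf jm) scale1r lE.
Qed.

End Dominating.

(** * Base change of fields *)

Section BaseChangeExact.
Variables (R : comNzRingType) (L k : fieldType) (f : {rmorphism R -> L}).
Variables (f' : {rmorphism R -> k}) (g : {rmorphism L -> k}).
Hypothesis gf : forall r, g (f r) = f' r.
Variables (H : algType R) (Hg : int -> set H).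
Implicit Types V W : gmodule f Hg.

(** Sequences of vector spaces split, and splittings survive base change. *)
Lemma bc_exact V' V V'' : short_exact V' V V'' ->
  short_exact (base_change gf V') (base_change gf V) (base_change gf V'').
Proof.
move=> [al [be [aM bM ai bs ex]]]; have aL := gmor_lin aM;
  have bL := gmor_lin bM.
have [r [s [rL sL rK sK E]]] := exact_splitting (fmod_free V'') aL bL ai bs ex.
have raL : linear (r \o al) by move=> a u v; rewrite /= aL rL.
have asL : linear (al \o r) by move=> a u v; rewrite /= rL aL.
have sbL : linear (s \o be) by move=> a u v; rewrite /= bL sL.
exists (tmap g al), (tmap g be); split.
- exact: tmap_gmor.
- exact: tmap_gmor.
- apply: (can_inj (g := tmap g r)) => x.
  by rewrite tmap_comp // tmap_id.
- by move=> w; exists (tmap g s w);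
  rewrite tmap_comp // tmap_id // => a u v /=; rewrite sL bL.
- move=> v; split=> [v0|[u <-]].
    exists (tmap g r v); rewrite tmap_comp //.
    have idL : linear (@id V) by [].
    rewrite -[RHS](tmap_id v idL) // (@tmap_sum _ _ _ _ _ _ _ _ v asL sbL idL
      E).
    by rewrite -(tmap_comp v bL sL) v0 tmap0 // addr0.
  rewrite tmap_comp // tmap_zero //; first by move=> a x y /=; rewrite aL bL.
  by move=> x; apply/ex; exists x.
Qed.

Lemma bc_add_eq (x y : seq (gmodule f Hg)) : add_eq x y ->
  add_eq (map (base_change gf) x) (map (base_change gf) y).
Proof.
elim=> {x y} [x|x y _ e|x y t _ e _ e'|x y|t x y _ e|U' U U'' e].
- exact: add_eq_refl.
- exact: add_eq_sym.
- exact: (add_eq_trans e).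
- by rewrite !map_cat; exact: add_eq_catC.
- by rewrite !map_cat; exact: add_eq_cat.
- by apply: add_eq_exact; exact: bc_exact.
Qed.

Lemma bc_gcls V W : gcls V = gcls W ->
  gcls (base_change gf V) = gcls (base_change gf W).
Proof.
move=> /r0_clsP[z /= h]; apply/r0_clsP; exists (map (base_change gf) z).
exact: (bc_add_eq h).
Qed.

Lemma bc_gcls_prod V W : gcls (base_change gf (gprod V W)) =
  r0_add (gcls (base_change gf V)) (gcls (base_change gf W)).
Proof. by apply: gcls_exact; apply: bc_exact; exact: prod_exact. Qed.

Lemma cp_bc V i h : Hg 0 h -> cp (base_change gf V) i h = map_poly g (cp V i h).
Proof.
move=> /(cpP V i)/is_char_polyP[n [e [N [he hN ->]]]].
exact: cp_base_change he hN.
Qed.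

End BaseChangeExact.

(** * Graded simple modules *)

Section GradedSimple.
Variables (R : comNzRingType) (F : fieldType) (f : {rmorphism R -> F}).
Variables (H : algType R) (Hg : int -> set H).
Hypothesis Hgr : graded_algebra Hg.

Lemma seq_int_max (s : seq int) : s != [::] ->
  exists2 j, j \in s & forall l, l \in s -> (l <= j)%R.
Proof.
elim: s => // i [|i' s] IH _; first by exists i => [|l];
  rewrite inE ?eqxx // => /eqP ->.
have [//|j js jm] := IH.
have [ij|ji] := leP i j.
  exists j; first by rewrite inE js orbT.
  by move=> l; rewrite inE => /orP[/eqP -> //|]; exact: jm.
exists i; first by rewrite inE eqxx.
move=> l; rewrite inE => /orP[/eqP -> //|/jm lj].
exact: le_trans lj (ltW ji).
Qed.

Lemma gdim_gt0 (M : gmodule f Hg) (m : M) : m != 0 -> (0 < gdim M)%N.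
Proof.
move=> m0; have [e he] := gdimP M; rewrite lt0n; apply: contra m0 => /eqP z.
have [c ->] := basis_span he (I : setT m);
  rewrite /lincomb big1 // => -[j jl] _.
by suff: False by []; move: jl; rewrite z.
Qed.

Variable M : gmodule f Hg.

(** The leading components of the elements of a submodule [U] form a graded
    submodule, which vanishes only if [U] does.  If it is everything,
    subtracting from an element of [M] one of [U] with the same leading
    component lowers the degree, and degrees are bounded below. *)
Lemma graded_simple_simple (m0 : M) : m0 != 0 ->
  (forall U : set M, @gsub _ _ _ _ idfun _ _ M U ->
     (forall m, U m -> m = 0) \/ (forall m, U m)) ->
  is_simple M.
Proof.
move=> m00 gs; split; first by exists m0; exact/eqP.
move=> U Us Uact; pose p : int -> M -> M := pr (deg_sum M).
have pL i : linear (p i) := prL (deg_sum M) i.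
have Uh h u : U u -> U (hact h u) by exact: Uact.
pose G : set M := fun z => forall j, exists u,
  [/\ U u, forall l, (j < l)%R -> p l u = 0 & p j u = p j z].
have Gg : @gsub _ _ _ _ idfun _ _ M G.
  apply: (gsubI Hgr.1).
  - split=> [j|a u v Gu Gv j].
      by exists 0; split=> // [|l _]; [exact: (sub0 Us)|exact: (lin0 (pL l))].
    have [x [Ux x1 x2]] := Gu j; have [y [Uy y1 y2]] := Gv j.
    exists (a *: x + y); split; first exact: Us.2.
      by move=> l jl; rewrite pL x1 // y1 // scaler0 addr0.
    by rewrite (pL j) x2 y2 rsZ [RHS](pL j).
  - move=> i z Gz j; rewrite /p pr_pr; case: eqP => [->|_]; first exact: Gz.
    exists 0; rewrite !(lin0 (prL _ _)); split=> // [|l _];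
      first exact: (sub0 Us).
    exact: (lin0 (pL l)).
  - move=> l h z Hh Gz j; have [u [Uu u1 u2]] := Gz (j - l).
    have ph i v : p i (hact h v) = hact h (p (i - l) v).
      by rewrite /p -(pr_hact _ _ Hh) addrC subrK.
    exists (hact h u); split; first exact: Uh.
      by move=> i ji; rewrite ph u1 ?(lin0 (hactL h)) // ltrD2r.
    by rewrite !ph u2.
have [G0|GT] := gs G Gg; [left|right]; apply/seteqP; split=> // z.
- move=> Uz; apply: contrapT => /= /eqP z0.
  have [s [us ps E]] := pr_finsum (deg_sum M) z.
  pose s' := [seq i <- s | p i z != 0].
  have s'0 : s' != [::].
    apply: contra z0 => /eqP s0; apply/eqP/(@pr_eq0 _ _ _ (deg_sum M)) => i.
    have [is_|/ps //] := boolP (i \in s); apply/eqP; apply: contraT => pz.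
    have : i \in s' by rewrite mem_filter pz.
    by rewrite s0.
  have [j js jm] := seq_int_max s'0.
  have pj : p j z != 0 by move: js; rewrite mem_filter => /andP[].
  have /G0 /eqP : G (p j z); last by rewrite (negbTE pj).
  move=> i; rewrite /p pr_pr; case: eqP => [->|_]; last first.
    exists 0; rewrite !(lin0 (prL _ _)); split=> // [|l _];
      first exact: (sub0 Us).
    exact: (lin0 (pL l)).
  exists z; split=> // l jl; apply/eqP; apply: contraT => pz.
  have ls : l \in s.
    by apply: contraT => /ps E'; move: pz; rewrite /p E' eqxx.
  have : l \in s' by rewrite mem_filter pz ls.
  by move=> /jm; rewrite leNgt jl.
- by move=> ->; exact: (sub0 Us).
- move=> _; have [n [e he]] := fmod_free M.
  have [s us ps] := common_support (deg_sum M) e.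
  have ps' i v : i \notin s -> p i v = 0.
    move=> is_; have [c ->] := basis_span he (I : setT v).
    rewrite (lin_lincomb _ _ (pL i)) /lincomb big1 // => b _.
    by rewrite /= /p (ps _ _ is_) scaler0.
  have [s0|/eqP s0] := eqVneq s [::].
    rewrite (_ : z = 0); first exact: (sub0 Us).
    by apply: (@pr_eq0 _ _ _ (deg_sum M)) => i; apply: ps'; rewrite s0.
  have [lo lom] : exists lo : int, forall l, l \in s -> (lo <= l)%R.
    have [|j js jm] := @seq_int_max [seq - i | i <- s].
      by case: (s) s0.
    by exists (- j) => l ls; rewrite lerNl; apply/jm/map_f.
  have [hi him] : exists hi : int, forall l, l \in s -> (l <= hi)%R.
    by have [|j js jm] := @seq_int_max s; [exact/eqP|exists j].
  (* An element whose degrees all lie in [lo, lo + r) belongs to [U]. *)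
  have key (r : nat) : forall z, (forall l, (lo + r%:Z <= l)%R ->
    p l z = 0) -> U z.
    elim: r => [|r IH] {}z zl.
      rewrite (_ : z = 0); first exact: (sub0 Us).
      apply: (@pr_eq0 _ _ _ (deg_sum M)) => i.
      have [/lom il|/ps' //] := boolP (i \in s).
      by apply: zl; rewrite addr0.
    have [u [Uu u1 u2]] := GT z (lo + r%:Z).
    rewrite -[z](subrK u); apply: (subD Us) => //; apply: IH => l ll.
    rewrite (linB (pL l)); have [->|lne] := eqVneq l (lo + r%:Z).
      by rewrite u2 subrr.
    have lt : (lo + r%:Z < l)%R by rewrite lt_neqAle eq_sym lne.
    rewrite u1 // zl ?subrr //.
    by rewrite -addn1 PoszD addrA lezD1.
  apply: (key `|(hi + 1 - lo)%R|%N) => l ll; apply: ps'.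
  apply/negP => ls; have := him _ ls; apply/negP; rewrite -ltNge.
  rewrite -lezD1; apply: le_trans ll; rewrite -lerBlDl.
  exact: lez_abs.
Qed.

End GradedSimple.

Section SplitDescent.
Variables (R : comNzRingType) (L k : fieldType) (f : {rmorphism R -> L}).
Variables (f' : {rmorphism R -> k}) (g : {rmorphism L -> k}).
Hypothesis gf : forall r, g (f r) = f' r.
Variables (H : algType R) (Hg : int -> set H).
Hypotheses (Hgr : graded_algebra Hg) (Hf : finite_free H).

Section SimpleSubmodule.
Variable V : gmodule f' Hg.

(** A graded [LH]-submodule of [V] of finite dimension over [L], nonzero of
    minimal dimension, is graded simple, hence simple. *)
Lemma minimal_semimor (v : V) : v != 0 ->
  exists (M : gmodule f Hg) (j : M -> V),
  [/\ semimor g j, injective j & is_simple M].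
Proof.
move=> v0; pose P r := `[< exists (M : gmodule f Hg) (j : M -> V),
  [/\ semimor g j, injective j, exists m : M, m != 0 & gdim M = r] >].
have P0 : exists r, P r.
  have [U [Ug Uv [N [z [Uz zU]]]]] :=
    generated_gsub gf Hgr Hf (fun _ : 'I_1 => v).
  have Us : is_submodule (U : set (rs g V)) by case: Ug.
  have [|n [e he]] := fg_torsionfree_free (@field_divides L) Us _ Uz zU.
    by move=> a u _ /eqP; rewrite scaler_eq0 => /orP[] /eqP; [left|right].
  have [M [j [jm ji jU]]] := restrict gf Ug he; have [jL _ _] := jm.
  have [m mv] := (jU v).1 (Uv ord0).
  exists (gdim M); apply/asboolP; exists M, j; split=> //; exists m.
  by apply: contra v0 => /eqP m0; rewrite -mv m0 (lin0 jL).
case: (ex_minnP P0) => r /asboolP[M [j [jm ji [m0 m00] Mr]]] rmin.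
exists M, j; split=> //; apply: (graded_simple_simple Hgr m00) => U Ug.
have [[m [Um mn0]]|no] := pselect (exists m, U m /\ m != 0); [right|left].
  move=> m'; apply: contrapT => nU.
  have [M' [j' [j'M j'i j'U]]] := sub_gmod Ug.
  have : (gdim M' < gdim M)%N.
    apply: (gdim_lt (w := m') (gmor_lin j'M) j'i) => x E; apply: nU.
    by apply/j'U; exists x.
  rewrite ltnNge Mr rmin //; apply/asboolP; exists M', (j \o j'); split=> //.
  - have [jL jh jd] := jm; split.
    + by move=> a x y; rewrite /= (gmor_lin j'M) jL.
    + by move=> h x; rewrite /= (gmor_hact _ _ j'M) jh.
    + by move=> i x dx /=; apply/jd/gmor_deg.
  - exact: inj_comp.
  - have [x E] := (j'U m).1 Um; exists x; apply: contra mn0 => /eqP x0.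
    by rewrite -E x0 (lin0 (gmor_lin j'M)).
move=> m Um; apply/eqP; apply: contraT => mn0.
by case: no; exists m.
Qed.

Variables (M : gmodule f Hg) (j : M -> V).
Hypotheses (jm : semimor g j) (ji : injective j) (Ms : is_simple M).
Hypothesis Mend : forall phi : M -> M, is_endo phi ->
  exists a : L, forall v, phi v = a *: v.

Lemma relation_act n (c : 'I_n -> k) (s : 'I_n -> M) (b : tens f H) :
  \sum_i c i *: j (s i) = 0 -> \sum_i c i *: j (act b (s i)) = 0.
Proof.
have [jL jh _] := jm; move=> E; elim/tens_ind: b => [|x y hx hy|a h].
- by rewrite big1 // => i _; rewrite act0l (lin0 jL) scaler0.
- transitivity (\sum_i c i *: j (act x (s i)) + \sum_i c i *: j (act y (s i))).
    rewrite -big_split; apply: eq_bigr => i _.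
    by rewrite (actDl (actP M)) (linD jL) scalerDr.
  by rewrite hx hy addr0.
- transitivity (g a *: hact h (\sum_i c i *: j (s i))).
    rewrite (lin_sum (hactL h)) scaler_sumr; apply: eq_bigr => i _.
    by rewrite act_pure (linZ jL) rsZ jh (linZ (hactL h)) !scalerA mulrC.
  by rewrite E (lin0 (hactL h)) scaler0.
Qed.

Lemma simple_gen (s : M) : s != 0 -> forall t, exists b : tens f H, act b s = t.
Proof.
move=> s0 t; pose U : set M := fun t => exists b : tens f H, act b s = t.
have [||U0|UT] := Ms.2 U.
- split; first by exists 0; rewrite act0l.
  move=> a _ _ [b <-] [c <-]; exists (a *: b + c).
  by rewrite (actDl (actP M)) act_scale.
- by move=> b _ [c <-]; exists (b * c); rewrite (actM (actP M)).
- have : U s by exists 1; rewrite (act1 (actP M)).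
  by rewrite U0 => /= E; rewrite E eqxx in s0.
- by have : U t by rewrite UT.
Qed.

(** By induction on the length: shorter relations being trivial, [b s_0 |-> b
    s_i] is a well-defined endomorphism of [M], hence a scalar, so that all the
    [s_i] are multiples of [s_0]. *)
Lemma split_independence n (c : 'I_n -> rs g k^o) (s : 'I_n -> M) :
  (forall a, lincomb c a = 0 -> a = 0) ->
  \sum_i (c i : k) *: j (s i) = 0 -> forall i, s i = 0.
Proof.
have [jL jh _] := jm.
elim: n c s => [|n IH] c s ind E; first by case.
pose c' i := c (lift ord0 i).
have ind' a : lincomb c' a = 0 -> a = 0.
  move=> a0; pose b : 'rV_n.+1 := \row_i oapp (a 0) 0 (unlift ord0 i).
  have b0 : b = 0.
    apply: ind; rewrite /lincomb big_ord_recl /b mxE unlift_none scale0r add0r.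
    by rewrite -[RHS]a0; apply: eq_bigr => i _; rewrite mxE liftK.
  apply/rowP => i; have := congr1 (fun x : 'rV_n.+1 => x 0 (lift ord0 i)) b0.
  by rewrite !mxE liftK.
have tail (t : 'I_n.+1 -> M) : t ord0 = 0 ->
    \sum_i (c i : k) *: j (t i) = 0 -> forall i, t i = 0.
  move=> t0; rewrite big_ord_recl t0 (lin0 jL) scaler0 add0r =>
    /(IH c' _ ind') h i.
  by case: (unliftP ord0 i) => [i' ->|->].
have [s00|s00] := eqVneq (s ord0) 0; first exact: tail.
have /choice[b bE] := simple_gen s00.
have bI (x y : tens f H) : act x (s ord0) = act y (s ord0) ->
    forall i, act x (s i) = act y (s i).
  move=> xy i; apply/eqP; rewrite -subr_eq0; apply/eqP.
  have aB z : act (x - y) z = act x z - act y z :> M.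
    by rewrite (actDl (actP M)) -scaleN1r act_scale scaleN1r.
  rewrite -aB; apply: (tail (fun i => act (x - y) (s i))).
    by rewrite aB xy subrr.
  exact: relation_act.
have /choice[a aE] : forall i, exists a : L, s i = a *: s ord0.
  move=> i; pose phi t := act (b t) (s i).
  have [|a aE] := Mend (phi := phi).
    split=> [x u v|x v]; rewrite /phi.
      rewrite -act_scale -(actDl (actP M)); apply: bI.
      by rewrite (actDl (actP M)) act_scale !bE.
    by rewrite -(actM (actP M)); apply: bI; rewrite (actM (actP M)) !bE.
  exists a; rewrite -aE /phi -[LHS](act1 (actP M)); apply: bI.
  by rewrite bE (act1 (actP M)).
have a0 : \row_i a i = 0.
  apply: ind; rewrite /lincomb.
  have : (\sum_i g (a i) * (c i : k)) *: j (s ord0) = 0.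
    rewrite -[RHS]E scaler_suml; apply: eq_bigr => i _.
    by rewrite [in RHS]aE (linZ jL) rsZ scalerA mulrC.
  move=> /eqP; rewrite scaler_eq0 => /orP[/eqP z|/eqP z].
    by refine (etrans _ z); apply: eq_bigr => i _; rewrite mxE.
  by move: s00; rewrite (ji (etrans z (esym (lin0 jL)))) eqxx.
move=> i; rewrite aE; have /rowP/(_ i) := a0; rewrite !mxE => ->.
by rewrite scale0r.
Qed.

(** Expanding the coefficients of a relation in an [L]-basis of their span gives
    the relation with independent coefficients treated before. *)
Lemma split_bcmap_inj : injective (@bcmap _ _ _ _ _ _ gf _ _ _ _ j).
Proof.
have [jL _ _] := jm; have [n [d hd]] := fmod_free M.
apply: (bcmap_inj jm hd) => x x0.
pose y (i : 'I_n) : rs g k^o := x 0 i.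
pose U : set (rs g k^o) := fun u => exists a, u = lincomb y a.
have Us : is_submodule U.
  split; first by exists 0; rewrite (lin0 (lincombL _)).
  by move=> a _ _ [b ->] [c ->]; exists (a *: b + c); rewrite lincombL.
have [|||m [ga hga]] := fg_torsionfree_free (@field_divides L) Us _ _ (y := y).
- by move=> a u _ /eqP; rewrite scaler_eq0 => /orP[] /eqP; [left|right].
- by move=> i; exists (delta_mx 0 i); rewrite lincomb_delta.
- by [].
have /choice[A AE] : forall i, exists a, y i = lincomb ga a.
  by move=> i; apply: (basis_span hga); exists (delta_mx 0 i);
    rewrite lincomb_delta.
have z0 : forall l, \sum_i A i 0 l *: d i = 0.
  apply: (@split_independence _ ga); first by move=> a;
    exact: (basis_free hga Us).
  rewrite -[RHS]x0.
  under eq_bigr do rewrite (lin_sum jL) scaler_sumr.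
  rewrite exchange_big; apply: eq_bigr => i _ /=.
  rewrite -[x 0 i]/(y i) AE scaler_suml; apply: eq_bigr => l _.
  by rewrite (linZ jL) rsZ scalerA mulrC.
apply/rowP => i; rewrite -[LHS]/(y i) AE mxE.
suff -> : A i = 0 by exact: (lin0 (lincombL ga)).
apply/rowP => l; have /(basis_free hd (setT_sub M)) : lincomb d (\row_i A i 0
  l) = 0.
  by rewrite -[RHS](z0 l); apply: eq_bigr => i' _; rewrite mxE.
by move=> /rowP/(_ i); rewrite !mxE.
Qed.

End SimpleSubmodule.

(** Split off the extensions of simple [LH]-submodules one after the other. *)
Lemma split_descent (V : gmodule f' Hg) : split_algebra (tens_in f H) ->
  exists W : gmodule f Hg, gcls (base_change gf W) = gcls V.
Proof.
move=> sp; have [n] := ubnP (gdim V); elim: n V => // n IH V le.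
have [[v v0]|no] := pselect (exists v : V, v != 0); last first.
  have V0 (v : V) : v = 0.
    by apply/eqP; apply: contrapT => /negP v0; apply: no; exists v.
  exists (gzero (tens_in f H) (ext_grading f Hg)).
  have Z0 (w : tens g (gzero (tens_in f H) (ext_grading f Hg))) : w = 0.
    elim/tens_ind: w => [//|x y -> ->|s m]; first by rewrite addr0.
    by rewrite (_ : m = 0) ?pure0r //; exact: zero_eq.
  apply: (gcls_iso (phi := fun=> 0)).
  - split=> [a x y|b x|i x _]; last exact: (sub0 (deg_sub (deg_sum V) i)).
      by rewrite scaler0 addr0.
    by rewrite [RHS]V0.
  - by move=> x y _; rewrite [x]Z0 [y]Z0.
  - by move=> v; exists 0; rewrite [v]V0.
have [M [j [jm ji Ms]]] := minimal_semimor v0.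
have bI := split_bcmap_inj jm ji Ms (sp _ Ms).
have bM := bcmap_gmor gf jm; have bL := gmor_lin bM.
set phi := bcmap _ in bI bM bL.
have im : @gsub _ _ _ _ idfun _ _ V (fun w => exists v, phi v = w).
  split=> [|i _ [w <-]|h _ [w <-]].
  - split; first by exists 0; exact: (lin0 bL).
    by move=> a _ _ [x <-] [y <-]; exists (a *: x + y); exact: bL.
  - by exists (pr (deg_sum _) i w); rewrite (gmor_pr _ _ bM).
  - by exists (hact h w); exact: gmor_hact.
have [Q [q [qM qs qK]]] := quotient_gmod im.
have ex : short_exact (base_change gf M) V Q.
  by exists phi, q; split=> // w; rewrite -qK.
have [W' EW'] : exists W : gmodule f Hg, gcls (base_change gf W) = gcls Q.
  apply: IH; move: le; rewrite ltnS (gdim_exact ex); apply: leq_trans.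
  rewrite -[X in (X < _)%N]add0n ltn_add2r.
  have [[m /eqP m0] _] := Ms.
  suff : (pure g 1 m : base_change gf M) != 0 by exact: gdim_gt0.
  apply: contra m0 => /eqP z; apply/eqP/ji; have [jL _ _] := jm.
  rewrite (lin0 jL) -[LHS]scale1r -(bcmap_pure gf jm) z.
  exact: (lin0 bL).
exists (gprod M W'); rewrite bc_gcls_prod EW'.
by symmetry; exact: gcls_exact.
Qed.

End SplitDescent.

(** * Modular reduction *)

Section CharPolyMaps.
Variables (A : comNzRingType) (H : algType A) (Hg : int -> set H).
Variables (F : fieldType) (f : {rmorphism A -> F}).

Lemma char_polysE (X : scalar_R0p Hg f) (V : gmodule f Hg) h0 i :
  sval X = gcls V -> char_polys f X h0 i = cp V i (sval h0).
Proof.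
move=> E; have Hh := svalP h0; rewrite /char_polys.
case: xgetP => [_ -> [W [EW hp]]|no]; last first.
  by case: (no (cp V i (sval h0))); exists V; split=> //; exact: cpP.
by rewrite (cp_gcls i Hh (etrans (esym E) EW)); symmetry; exact: cp_eq.
Qed.

(** Additivity, uniqueness and independence of the valuation ring all reduce to
    this. *)
Lemma char_polys_inj (X Y : scalar_R0p Hg f) : is_frac_of_image f ->
  graded_algebra Hg -> finite_free H ->
  char_polys f X = char_polys f Y -> X = Y.
Proof.
move=> fr Hgr Hf E; apply: pcls_eq; rewrite -(preprE X) -(preprE Y).
apply: (cp_inj fr Hgr Hf) => i h Hh.
have := congr1 (fun P : poly_maps Hg F => P (exist _ h Hh) i) E.
rewrite /= (char_polysE (V := prepr X)) ?preprE //.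
by rewrite (char_polysE (V := prepr Y)) ?preprE.
Qed.

Lemma char_polys_add (X Y : scalar_R0p Hg f) h0 i :
  char_polys f (r0p_add X Y) h0 i = char_polys f X h0 i * char_polys f Y h0 i.
Proof.
rewrite (char_polysE (V := gprod (prepr X) (prepr Y))) ?gclsD /= ?preprE //.
rewrite cp_prod; last exact: (svalP h0).
rewrite (char_polysE (X := X) (V := prepr X)) ?preprE //.
by rewrite (char_polysE (X := Y) (V := prepr Y)) ?preprE.
Qed.

Lemma char_polys_shift j (X : scalar_R0p Hg f) h0 i :
  char_polys f (r0p_shift j X) h0 i = char_polys f X h0 (i - j).
Proof.
rewrite (char_polysE (V := gshift j (prepr X))) ?cp_gshift.
  by rewrite (char_polysE (V := prepr X)) ?preprE.
by rewrite /= -preprE r0_shiftE.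
Qed.

Lemma char_polys_zero h0 i :
  char_polys f (r0p_zero (tens_in f H) (ext_grading f Hg)) h0 i = 1.
Proof.
rewrite (char_polysE (V := gzero (tens_in f H) (ext_grading f Hg))) ?gcls_zero
  //.
apply: cp_eq; exists 0%N, (fun=> 0), 0; split.
- by apply: basis_intro => // [v _|c _]; [exists 0|]; exact: zero_eq.
- by move=> [].
- by rewrite /char_poly det_mx00.
Qed.

End CharPolyMaps.

Lemma poly_lift (R S : nzRingType) (f : {rmorphism R -> S}) (p : {poly S}) :
  (forall k, exists a, p`_k = f a) -> exists q, p = map_poly f q.
Proof.
move=> /choice[a aE]; exists (\poly_(k < size p) a k); apply/polyP => k.
rewrite coef_map coef_poly; case: ltnP => [_|/(nth_default 0) ->];
  first exact: aE.
by rewrite raddf0.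
Qed.

Section Reduction.
Variables (A : idomainType) (H : algType A) (Hg : int -> set H).
Hypotheses (Hf : finite_free H) (Hgr : graded_algebra Hg).
Hypothesis A_closed : integrally_closed A.

Lemma generic_cp_lift (V : gmodule (to_K A) Hg) i h : Hg 0 h ->
  exists P, cp V i h = map_poly (to_K A) P.
Proof.
by move=> Hh; apply: poly_lift => k; apply: A_closed; exact: cp_integral.
Qed.

Variables (L : fieldType) (theta : {rmorphism A -> L}).
Hypothesis L_frac : is_frac_of_image theta.
Variable D : valuation_setting theta.

Notation K := {fraction A}.

Lemma val_dominating : dominating (vO_to_K D).
Proof.
split; first exact: val_inj.
move=> x x0; have [xO|xO] := vO_valuation D x0; [left|right].
  by exists (exist _ x xO).
by exists (exist _ x^-1 xO).
Qed.

(** Characteristic polynomials of a lattice have coefficients in [O]; by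
    integrality these come from [A]. *)
Lemma reduction_cp (V : graded_lattice D Hg) i h : Hg 0 h ->
  exists P, cp (base_change (vO_to_KE D) V) i h = map_poly (to_K A) P /\
    cp (base_change (vresE D) V) i h = map_poly (to_k D) P.
Proof.
move=> Hh; have [Q QE] := lattice_cp val_dominating V i Hh.
have [P PE] := generic_cp_lift (base_change (vO_to_KE D) V) i Hh.
exists P; split=> //; rewrite (QE _ _ _ (vresE D)).
suff -> : Q = map_poly (to_vO D) P by rewrite -map_poly_comp.
apply: (map_inj_poly (f := vO_to_K D)); first exact: val_inj.
  exact: rmorph0.
by rewrite -(QE _ _ _ (vO_to_KE D)) PE -map_poly_comp.
Qed.

Hypothesis D_hyp : split_or_perfect D H.

(** When [L = k] every module descends as a whole. *)
Lemma residue_descent (V : gmodule (to_k D) Hg) :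
  exists W : gmodule theta Hg, gcls (base_change (vembE D) W) = gcls V.
Proof.
case: D_hyp => [sp|[surj _]]; first exact: split_descent.
apply: lattice_exists => //; split; first exact: fmorph_inj.
by move=> x _; left; have [s <-] := surj x; exists s.
Qed.

Lemma residue_identE (X : scalar_R0p Hg theta) W : sval X = gcls W ->
  sval (residue_ident D X) = gcls (base_change (vembE D) W).
Proof. by move=> E; apply: bc_gcls; rewrite preprE. Qed.

Lemma residue_ident_inj : injective (@residue_ident _ _ _ D _ Hg).
Proof.
move=> X Y E; apply: (char_polys_inj L_frac Hgr Hf).
apply/funext => h0; apply/funext => i; have Hh := svalP h0.
rewrite (char_polysE (V := prepr X)) ?preprE //.
rewrite (char_polysE (V := prepr Y)) ?preprE //.
apply: (map_inj_poly (f := vemb D)); [exact: fmorph_inj|exact: rmorph0|].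
rewrite -!(cp_bc (vembE D)) //; apply: cp_gcls => //.
exact: (congr1 sval E).
Qed.

Lemma lattice_class (X : scalar_R0p Hg (to_K A)) :
  exists V : graded_lattice D Hg, X = pcls (base_change (vO_to_KE D) V).
Proof.
have [V E] := lattice_exists val_dominating (vO_to_KE D) Hgr Hf (prepr X).
by exists V; apply: pcls_eq; rewrite /= E preprE.
Qed.

(** The class of a descent [W] of [k (x) V] has characteristic polynomials given
    by those of [K (x) V], hence depends on the class of [K (x) V] only. *)
Lemma reduction_exists :
  exists d : scalar_R0p Hg (to_K A) -> scalar_R0p Hg theta,
  is_modular_reduction D d /\ char_poly_identity d.
Proof.
have /choice[lat latE] := lattice_class.
have /choice[W WE] : forall X, exists W : gmodule theta Hg,
    gcls (base_change (vembE D) W) = gcls (base_change (vresE D) (lat X)).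
  by move=> X; exact: residue_descent.
have red (V : graded_lattice D Hg) (U : gmodule theta Hg) (P : {poly A}) i h :
    Hg 0 h -> gcls (base_change (vembE D) U) = gcls (base_change (vresE D) V) ->
    cp (base_change (vO_to_KE D) V) i h = map_poly (to_K A) P ->
    cp U i h = map_poly theta P.
  move=> Hh EU EP; have [Q [QK Qk]] := reduction_cp V i Hh.
  have EQ : Q = P.
    apply: (map_inj_poly (f := to_K A)); [|exact: rmorph0|by rewrite -QK].
    by move=> a b E; apply/eqP; rewrite -tofrac_eq; exact/eqP.
  apply: (map_inj_poly (f := vemb D)); [exact: fmorph_inj|exact: rmorph0|].
  rewrite -(cp_bc (vembE D)) // (cp_gcls i Hh EU) Qk EQ -map_poly_comp.
  by apply: eq_map_poly => a; rewrite /= vembE.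
exists (fun X => pcls (W X)); split=> [V|X P EP].
  set X := pcls (base_change (vO_to_KE D) V);
    have [U EU] := residue_descent (base_change (vresE D) V).
  suff E : gcls (W X) = gcls U by apply: pcls_eq;
    rewrite (@residue_identE (pcls (W X)) U E).
  apply: (cp_inj L_frac Hgr Hf) => i h Hh.
  have [P PE] := generic_cp_lift (base_change (vO_to_KE D) V) i Hh.
  rewrite (red _ _ P i h Hh EU PE); apply: (red _ _ P i h Hh (WE X)).
  rewrite -PE; apply: cp_gcls => //.
  exact: (congr1 sval (esym (latE X))).
apply/funext => h0; apply/funext => i; have Hh := svalP h0.
rewrite (char_polysE (V := W X)) //.
apply: (red _ _ _ _ _ Hh (WE X)).
have := congr1 (fun Q : poly_maps Hg K => Q h0 i) EP;
  rewrite /= /map_poly_maps => <-.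
by symmetry; apply: char_polysE; rewrite {1}(latE X).
Qed.

End Reduction.

(** * The decomposition map *)

Theorem theorem2p9 (A : idomainType) (H : algType A) (Hg : int -> set H)
    (H_free : finite_free H) (H_graded : graded_algebra Hg)
    (A_closed : integrally_closed A)
    (L : fieldType) (theta : {rmorphism A -> L})
    (L_frac : is_frac_of_image theta)
    (D : valuation_setting theta) (D_hyp : split_or_perfect D H) :
  exists d : scalar_R0p Hg (to_K A) -> scalar_R0p Hg theta,
    [/\ is_modular_reduction D d,
        forall d', is_modular_reduction D d' -> d' = d &
        is_laurent_hom d] /\
    [/\ forall X, exists P : poly_maps Hg A,
          char_polys (to_K A) X = map_poly_maps (to_K A) P &
        char_poly_identity d] /\
    [/\ forall d', char_poly_identity d' -> d' = d &
        forall D' : valuation_setting theta, split_or_perfect D' H ->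
          is_modular_reduction D' d].
Proof.
have inj := @char_polys_inj _ _ _ _ theta _ _ L_frac H_graded H_free.
have lift (X : scalar_R0p Hg (to_K A)) : exists P : poly_maps Hg A,
    char_polys (to_K A) X = map_poly_maps (to_K A) P.
  have /choice[P PE] : forall x : {h : H | Hg 0 h} * int, exists P : {poly A},
      char_polys (to_K A) X x.1 x.2 = map_poly (to_K A) P.
    move=> [h0 i]; rewrite /= (char_polysE (V := prepr X)) ?preprE //.
    exact: generic_cp_lift H_free A_closed _ _ _ (svalP h0).
  exists (fun h0 i => P (h0, i)); apply/funext => h0; apply/funext => i.
  exact: (PE (h0, i)).
have [d [dred dcp]] := reduction_exists H_free H_graded A_closed L_frac D_hyp.
have uniq d' : char_poly_identity d' -> d' = d.
  move=> h; apply/funext => X; have [P PE] := lift X; apply: inj.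
  by rewrite (h X P PE) (dcp X P PE).
exists d; split; last split.
- split=> // [d' h|].
    apply/funext => X; apply: (residue_ident_inj H_free H_graded L_frac (D :=
      D)).
    by have [V ->] := lattice_class H_free H_graded D X; rewrite h dred.
  have dE X P : char_polys (to_K A) X = map_poly_maps (to_K A) P ->
      forall h0 i, char_polys theta (d X) h0 i = map_poly theta (P h0 i).
    by move=> E h0 i; rewrite (dcp X P E).
  have dadd X Y : d (r0p_add X Y) = r0p_add (d X) (d Y).
    have [P PE] := lift X; have [Q QE] := lift Y.
    apply: inj; apply/funext => h0; apply/funext => i.
    rewrite char_polys_add (dE X P) // (dE Y Q) // -rmorphM.
    rewrite (dE _ (fun h0 i => P h0 i * Q h0 i)) //.
    apply/funext => h1; apply/funext => l.
    by rewrite char_polys_add PE QE /map_poly_maps rmorphM.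
  split=> // e X; elim: e => [|j e IH] /=.
    apply: inj; apply/funext => h0; apply/funext => i.
    rewrite char_polys_zero (dE _ (fun _ _ => 1)) ?rmorph1 //.
    apply/funext => h1; apply/funext => l.
    by rewrite char_polys_zero /map_poly_maps rmorph1.
  rewrite dadd IH; congr r0p_add; have [P PE] := lift X.
  apply: inj; apply/funext => h0; apply/funext => i.
  rewrite char_polys_shift (dE X P) // (dE _ (fun h0 i => P h0 (i - j))) //.
  apply/funext => h1; apply/funext => l.
  by rewrite char_polys_shift PE.
- by split.
- split=> // D' D'_hyp.
  have [d' [d'red d'cp]] := reduction_exists H_free H_graded A_closed L_frac
    D'_hyp.
  by rewrite -(uniq d' d'cp).
Qed.
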